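(* Let $c=e_1e_2\cdots e_{12}\in\mathrm{Spin}(12)$. Any finite abelian subgroup $F$ of $\mathrm{Spin}(12)/\langle c\rangle$ satisfying condition $(\ast)$ and with $[-1]\in F$ is conjugate in $\mathrm{Spin}(12)/\langle c\rangle$ to one of the following three subgroups $F_1,F_2,F_3$: $$F_1=\Bigl\langle[e_1e_2e_3e_4e_5e_6],\ \Bigl[e_1e_3\tfrac{1+e_5e_6}{\sqrt2}e_7e_9\tfrac{1+e_{11}e_{12}}{\sqrt2}\Bigr],\ \Bigl[\tfrac{e_1+e_2}{\sqrt2}\tfrac{1+e_3e_4}{\sqrt2}e_5\tfrac{e_7+e_8}{\sqrt2}\tfrac{1+e_9e_{10}}{\sqrt2}e_{11}\Bigr]\Bigr\rangle,$$ $$F_2=\langle[-1],[e_1e_2e_3e_4],[e_5e_6e_7e_8],[e_3e_4e_5e_6],[e_7e_8e_9e_{10}],[e_1e_3e_5e_7e_9e_{11}]\rangle,$$ $$F_3=\langle[-1],[e_1e_2e_3e_4],[e_5e_6e_7e_8],[e_3e_4e_5e_6],[e_7e_8e_9e_{10}],[e_1e_3e_5e_7e_9e_{11}],[\delta]\rangle,$$ where $$\delta=\tfrac{1+e_1e_2}{\sqrt2}\tfrac{1+e_3e_4}{\sqrt2}\tfrac{1+e_5e_6}{\sqrt2}\tfrac{1+e_7e_8}{\sqrt2}\tfrac{1+e_9e_{10}}{\sqrt2}\tfrac{1+e_{11}e_{12}}{\sqrt2}.$$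
   Context: $e_1,\dots,e_{12}$ is an orthonormal basis of Euclidean $12$-space and $\mathrm{Spin}(12)$ is realized inside the Clifford algebra ($e_i^2=-1$, $e_ie_j=-e_je_i$ for $i\neq j$); $c$ is central in $\mathrm{Spin}(12)$. $[x]$ denotes the class in $\mathrm{Spin}(12)/\langle c\rangle$ of $x\in\mathrm{Spin}(12)$. Condition $(\ast)$ for a closed abelian subgroup $F$ of a compact Lie group $G$ with Lie algebra $\mathfrak{g}_0$: $\dim\mathfrak{g}_0^F=\dim F$, where $\mathfrak{g}_0^F$ is the fixed subalgebra of the adjoint action of $F$. For $F$ finite in $\mathrm{Spin}(12)/\langle c\rangle$ it says $\mathfrak{so}(12)^F=0$. *)

(* Defs.v *)
From HB Require Import structures.
From mathcomp Require Import all_boot all_order all_algebra.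
From mathcomp Require Import boolp classical_sets cardinality reals.
From mathcomp Require Import ring.

Set Implicit Arguments.
Unset Strict Implicit.
Unset Printing Implicit Defensive.

Import Order.TTheory GRing.Theory Num.Theory.

Local Open Scope classical_set_scope.
Local Open Scope ring_scope.

Section CliffordSign.
Context {n : nat}.
Implicit Types A B C : {set 'I_n}.

Definition symdiff A B : {set 'I_n} := [set i | (i \in A) (+) (i \in B)]%SET.

Lemma symdiffC A B : symdiff A B = symdiff B A.
Proof. by apply/setP => i; rewrite !inE addbC. Qed.

Lemma symdiffA A B C : symdiff A (symdiff B C) = symdiff (symdiff A B) C.
Proof. by apply/setP => i; rewrite !inE addbA. Qed.

Lemma symdiffK A B : symdiff A (symdiff A B) = B.
Proof. by apply/setP => i; rewrite !inE addKb. Qed.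

Lemma symdiff0s A : symdiff finset.set0 A = A.
Proof. by apply/setP => i; rewrite !inE. Qed.

Lemma symdiffss A : symdiff A A = finset.set0.
Proof. by apply/setP => i; rewrite !inE addbb. Qed.

Lemma symdiffs0 A : symdiff A finset.set0 = A.
Proof. by rewrite symdiffC symdiff0s. Qed.

(* Write e_A for the product of the e_i, i \in A, in increasing order.  Then
   e_A e_B = clifford_sign A B * e_(symdiff A B): every pair (i, j) in A x B
   with j < i contributes a transposition, and every i in A :&: B
   contributes e_i ^ 2 = -1. *)
Definition clifford_sign (R : pzRingType) A B : R :=
  (-1) ^+ #|[set p : 'I_n * 'I_n | [&& p.1 \in A, p.2 \in B
                                     & (p.2 <= p.1)%N]]%SET|.

Lemma clifford_sign_prod (R : comPzRingType) A B : clifford_sign R A B =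
  \prod_(i in A) \prod_(j in B) (-1) ^+ (j <= i)%N.
Proof.
rewrite pair_big_dep /= /clifford_sign.
rewrite (bigID (fun p : 'I_n * 'I_n => (p.2 <= p.1)%N)) /=.
rewrite [X in _ * X]big1 ?mulr1; last by move=> p /andP[_ /negbTE ->].
rewrite (eq_bigr (fun=> -1)); last by move=> p /andP[_ ->].
rewrite (eq_bigl [in [set p : 'I_n * 'I_n | [&& p.1 \in A, p.2 \in B
  & (p.2 <= p.1)%N]]%SET]); last by move=> p; rewrite !inE andbA.
by rewrite prodr_const.
Qed.

Lemma prod_symdiff (R : comPzRingType) (f : 'I_n -> R) A B :
  (forall i, f i * f i = 1) ->
  \prod_(i in symdiff A B) f i = (\prod_(i in A) f i) * (\prod_(i in B) f i).
Proof.
move=> f2; rewrite !(big_mkcond (fun i => i \in _)) /= -big_split /=.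
apply: eq_bigr => i _; rewrite inE.
by case: (i \in A); case: (i \in B) => //=; rewrite ?mulr1 ?mul1r ?f2.
Qed.

Lemma sqr_prod_sign (R : comPzRingType) (P : pred 'I_n) (f : 'I_n -> bool) :
  (\prod_(i | P i) (-1) ^+ f i) * (\prod_(i | P i) (-1) ^+ f i) = 1 :> R.
Proof. by rewrite -big_split big1 //= => i _; rewrite -signr_addb addbb. Qed.

Lemma clifford_signDl (R : comPzRingType) A B C : clifford_sign R (symdiff A B) C =
  clifford_sign R A C * clifford_sign R B C.
Proof.
rewrite !clifford_sign_prod prod_symdiff // => i; exact: sqr_prod_sign.
Qed.

Lemma clifford_signDr (R : comPzRingType) A B C : clifford_sign R A (symdiff B C) =
  clifford_sign R A B * clifford_sign R A C.
Proof.
rewrite !clifford_sign_prod -big_split; apply: eq_bigr => i _.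
by rewrite prod_symdiff // => j; rewrite -signr_addb addbb.
Qed.

Lemma clifford_sign_sqr (R : comPzRingType) A B :
  clifford_sign R A B * clifford_sign R A B = 1.
Proof. by rewrite /clifford_sign -expr2 sqrr_sign. Qed.

Lemma clifford_sign0s (R : comPzRingType) A : clifford_sign R finset.set0 A = 1.
Proof. by rewrite clifford_sign_prod big_set0. Qed.

Lemma clifford_signs0 (R : comPzRingType) A : clifford_sign R A finset.set0 = 1.
Proof. by rewrite clifford_sign_prod big1 // => i _; rewrite big_set0. Qed.

Lemma clifford_sign11 (R : comPzRingType) i j :
  clifford_sign R (finset.set1 i) (finset.set1 j) = (-1) ^+ (j <= i)%N.
Proof. by rewrite clifford_sign_prod !big_set1. Qed.

End CliffordSign.

(* The Clifford algebra of R^n with e_i ^ 2 = -1; x A is the coordinate of x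
   on e_A. *)
Definition clifford (R : realType) (n : nat) := {ffun {set 'I_n} -> R^o}.


HB.instance Definition _ (R : realType) n := GRing.Lmodule.on (clifford R n).

Section CliffordAlgebra.
Context {R : realType} {n : nat}.
Implicit Types (x y z : clifford R n) (A B : {set 'I_n}).

Definition clifford_basis A : clifford R n := [ffun B => (B == A)%:R].

Definition clifford_mul x y : clifford R n :=
  [ffun C => \sum_(p : {set 'I_n} * {set 'I_n} | symdiff p.1 p.2 == C)
     clifford_sign R p.1 p.2 * x p.1 * y p.2].

Lemma clifford_mulE x y C : clifford_mul x y C =
  \sum_A clifford_sign R A (symdiff A C) * x A * y (symdiff A C).
Proof.
rewrite ffunE.
rewrite (reindex_onto (fun A => (A, symdiff A C)) (fun p => p.1)) /=.
  by apply: eq_bigl => A; rewrite symdiffK !eqxx.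
by case=> A B /= /eqP <-; rewrite symdiffK.
Qed.

Lemma clifford_mulA : associative clifford_mul.
Proof.
move=> x y z; apply/ffunP => D; rewrite !clifford_mulE.
under eq_bigr => A _ do rewrite clifford_mulE big_distrr /=.
under [RHS]eq_bigr => C _ do rewrite clifford_mulE big_distrr big_distrl /=.
rewrite [RHS]exchange_big /=; apply: eq_bigr => A _.
rewrite (reindex (symdiff A)) /=; last first.
  by exists (symdiff A) => B _; rewrite symdiffK.
apply: eq_bigr => C _.
have -> : symdiff (symdiff A C) (symdiff A D) = symdiff C D.
  by apply/setP => i; rewrite !inE addbACA addbb.
rewrite !(clifford_signDl, clifford_signDr).
set sAA := clifford_sign R A A; set sAC := clifford_sign R A C.
set sAD := clifford_sign R A D; set sCC := clifford_sign R C C.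
set sCD := clifford_sign R C D.
have sAD2 : sAD * sAD = 1 by exact: clifford_sign_sqr.
move: (x A : R) (y _ : R) (z _ : R) => a b c.
transitivity (sAD * sAD * (sCC * sCD * (sAA * sAC * a * b) * c)); first by ring.
by rewrite sAD2 mul1r.
Qed.

Lemma clifford_mul1x : left_id (clifford_basis finset.set0) clifford_mul.
Proof.
move=> x; apply/ffunP => C; rewrite clifford_mulE (bigD1 finset.set0) //=.
rewrite big1 ?addr0; last first.
  by move=> A /negbTE A0; rewrite ffunE A0 mulr0 mul0r.
by rewrite ffunE eqxx symdiff0s clifford_sign0s !mul1r.
Qed.

Lemma clifford_mulx1 : right_id (clifford_basis finset.set0) clifford_mul.
Proof.
move=> x; apply/ffunP => C; rewrite clifford_mulE (bigD1 C) //=.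
rewrite big1 ?addr0; last first.
  move=> A AC; rewrite !ffunE; case: eqP => [AC0|]; last by rewrite mulr0.
  by move: AC; rewrite -(symdiffs0 A) -AC0 symdiffK eqxx.
by rewrite symdiffss ffunE eqxx clifford_signs0 mulr1 mul1r.
Qed.

Lemma clifford_mulDl : left_distributive clifford_mul +%R.
Proof.
move=> x y z; apply/ffunP => C; rewrite [LHS]clifford_mulE [RHS]ffunE !clifford_mulE -big_split /=.
by apply: eq_bigr => A _; rewrite ffunE mulrDr mulrDl.
Qed.

Lemma clifford_mulDr : right_distributive clifford_mul +%R.
Proof.
move=> x y z; apply/ffunP => C; rewrite [LHS]clifford_mulE [RHS]ffunE !clifford_mulE -big_split /=.
by apply: eq_bigr => A _; rewrite ffunE mulrDr.
Qed.

Lemma clifford_1neq0 : clifford_basis finset.set0 != 0.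
Proof.
apply/eqP => /ffunP /(_ finset.set0) /eqP.
by rewrite !ffunE eqxx oner_eq0.
Qed.

HB.instance Definition _ := GRing.Zmodule_isNzRing.Build (clifford R n)
  clifford_mulA clifford_mul1x clifford_mulx1
  clifford_mulDl clifford_mulDr clifford_1neq0.

Lemma clifford_scaleE (a : R) x A : (a *: x) A = a * (x A : R).
Proof. by rewrite ffunE. Qed.

Lemma clifford_scaleAl (a : R) x y : a *: (x * y) = a *: x * y.
Proof.
apply/ffunP => C; rewrite clifford_scaleE [X in _ * X = _]clifford_mulE.
rewrite [RHS]clifford_mulE big_distrr; apply: eq_bigr => A _.
rewrite clifford_scaleE /=.
by move: (clifford_sign _ _ _) (x A : R) (y _ : R) => s b c; ring.
Qed.

HB.instance Definition _ :=
  GRing.Lmodule_isLalgebra.Build R (clifford R n) clifford_scaleAl.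

Lemma clifford_scaleAr (a : R) x y : a *: (x * y) = x * (a *: y).
Proof.
apply/ffunP => C; rewrite clifford_scaleE [X in _ * X = _]clifford_mulE.
rewrite [RHS]clifford_mulE big_distrr; apply: eq_bigr => A _.
rewrite clifford_scaleE /=.
by move: (clifford_sign _ _ _) (x A : R) (y _ : R) => s b c; ring.
Qed.

HB.instance Definition _ :=
  GRing.Lalgebra_isAlgebra.Build R (clifford R n) clifford_scaleAr.

Definition clifford_unit : pred (clifford R n) :=
  fun x => `[< exists y, y * x = 1 /\ x * y = 1 >].

Definition clifford_inv x : clifford R n :=
  if pselect (exists y, y * x = 1 /\ x * y = 1) is left exy
  then projT1 (cid exy) else x.

Lemma clifford_mulVx : {in clifford_unit, left_inverse 1 clifford_inv *%R}.
Proof.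
move=> x /asboolP xU; rewrite /clifford_inv.
by case: pselect => // exy; case: (projT2 (cid exy)).
Qed.

Lemma clifford_mulxV : {in clifford_unit, right_inverse 1 clifford_inv *%R}.
Proof.
move=> x /asboolP xU; rewrite /clifford_inv.
by case: pselect => // exy; case: (projT2 (cid exy)).
Qed.

Lemma clifford_unitP x y : y * x = 1 /\ x * y = 1 -> clifford_unit x.
Proof. by move=> xy; apply/asboolP; exists y. Qed.

Lemma clifford_invr_out : {in [predC clifford_unit], clifford_inv =1 id}.
Proof. by move=> x /asboolP xU; rewrite /clifford_inv; case: pselect. Qed.

HB.instance Definition _ := GRing.NzRing_hasMulInverse.Build (clifford R n)
  clifford_mulVx clifford_mulxV clifford_unitP clifford_invr_out.

Definition clifford_gen (i : 'I_n) : clifford R n :=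
  clifford_basis (finset.set1 i).

Definition clifford_vec (v : 'rV[R]_n) : clifford R n :=
  \sum_i v 0 i *: clifford_gen i.

Lemma clifford_basisM A B : clifford_basis A * clifford_basis B =
  clifford_sign R A B *: clifford_basis (symdiff A B).
Proof.
apply/ffunP => C; rewrite [LHS]clifford_mulE (bigD1 A) //= big1 ?addr0.
  rewrite !ffunE eqxx mulr1; have [->|CAB] := eqVneq C (symdiff A B).
    by rewrite symdiffK eqxx.
  have [ACB|_] := eqVneq (symdiff A C) B; last by rewrite [RHS]mulr0 mulr0.
  by rewrite -ACB symdiffK eqxx in CAB.
by move=> D /negbTE DA; rewrite ffunE DA mulr0 mul0r.
Qed.

Lemma clifford_gen_sqr i : clifford_gen i * clifford_gen i = -1.
Proof.
by rewrite clifford_basisM symdiffss clifford_sign11 leqnn expr1 scaleN1r.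
Qed.

Lemma clifford_gen_anti i j : i != j ->
  clifford_gen i * clifford_gen j = - (clifford_gen j * clifford_gen i).
Proof.
move=> ij; rewrite !clifford_basisM symdiffC -scaleNr !clifford_sign11.
by congr (_ *: _); move: ij; rewrite neq_ltn => /orP[] ij;
  rewrite (ltnW ij) leqNgt ij /= expr0 expr1 ?opprK.
Qed.

Lemma clifford_vec_sqr v :
  clifford_vec v * clifford_vec v = - ((\sum_i v 0 i ^+ 2) *: 1).
Proof.
have E : clifford_vec v * clifford_vec v =
    \sum_i \sum_j (v 0 i * v 0 j) *: (clifford_gen i * clifford_gen j).
  rewrite big_distrl; apply: eq_bigr => i _; rewrite big_distrr.
  by apply: eq_bigr => j _; rewrite /= -scalerAl -scalerAr scalerA.
have two : (2%:R : R) != 0 by rewrite pnatr_eq0.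
apply: (scalerI two); rewrite scaler_nat mulr2n {1}E {1}exchange_big E -big_split.
rewrite scalerN -scaleNr scalerA mulr_sumr scaler_suml; apply: eq_bigr => i _.
rewrite -big_split (bigD1 i) //= big1 ?addr0.
  rewrite clifford_gen_sqr -scalerDl scalerN -scaleNr; congr (_ *: _); ring.
move=> j ji; rewrite (mulrC (v 0 j)) -scalerDr.
by rewrite (clifford_gen_anti ji) addNr scaler0.
Qed.

Definition unit_vector (v : 'rV[R]_n) : Prop := \sum_i v 0 i ^+ 2 = 1.

(* Spin(n): the products of an even number of unit vectors. *)
Definition in_spin x : Prop :=
  exists s : seq 'rV[R]_n, [/\ forall v, v \in s -> unit_vector v,
    ~~ odd (size s) & x = \prod_(v <- s) clifford_vec v].

Definition spin_pred : pred (clifford R n) := fun x => `[< in_spin x >].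

Definition unit_prod (b : bool) x : Prop :=
  exists s : seq 'rV[R]_n, [/\ forall v, v \in s -> unit_vector v,
    odd (size s) = b & x = \prod_(v <- s) clifford_vec v].

Lemma unit_prod_spin x : unit_prod false x -> in_spin x.
Proof. by case=> s [su so ->]; exists s; split; rewrite ?so. Qed.

Lemma spin_unit_prod x : in_spin x -> unit_prod false x.
Proof. by case=> s [su /negbTE so ->]; exists s; split. Qed.

Lemma unit_prod1 : unit_prod false 1.
Proof. by exists [::]; rewrite big_nil. Qed.

Lemma unit_prodM b c x y :
  unit_prod b x -> unit_prod c y -> unit_prod (b (+) c) (x * y).
Proof.
move=> [s [su <- ->]] [t [tu <- ->]]; exists (s ++ t).
rewrite size_cat oddD big_cat; split=> // v.
by rewrite mem_cat => /orP[/su|/tu].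
Qed.

Lemma unit_prod_vec v : unit_vector v -> unit_prod true (clifford_vec v).
Proof.
by move=> vu; exists [:: v]; rewrite big_seq1; split=> // w /[1!inE] /eqP ->.
Qed.

Lemma unit_vectorN v : unit_vector v -> unit_vector (- v).
Proof.
by rewrite /unit_vector => <-; apply: eq_bigr => i _; rewrite mxE sqrrN.
Qed.

Lemma clifford_vecN v : clifford_vec (- v) = - clifford_vec v.
Proof.
by rewrite /clifford_vec -sumrN; apply: eq_bigr => i _; rewrite mxE scaleNr.
Qed.

Lemma unit_prod_inv b x : unit_prod b x ->
  exists y, [/\ unit_prod b y, y * x = 1 & x * y = 1].
Proof.
move=> [s [su <- ->]]; elim: s su => [|v s IHs] su.
  by exists 1; rewrite !big_nil mulr1; split=> //; exact: unit_prod1.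
have [|y [yu yx xy]] := IHs.
  by move=> w ws; apply: su; rewrite inE ws orbT.
have vu : unit_vector v by apply: su; rewrite mem_head.
have v2 : clifford_vec v * clifford_vec v = -1.
  by rewrite clifford_vec_sqr vu scale1r.
exists (y * clifford_vec (- v)); rewrite big_cons /=; split.
- rewrite -addbT; exact/unit_prodM/unit_prod_vec/unit_vectorN.
- by rewrite mulrA -(mulrA y) clifford_vecN mulNr v2 opprK mulr1.
- by rewrite mulrA -(mulrA _ _ y) xy mulr1 clifford_vecN mulrN v2 opprK.
Qed.

Lemma in_spin1 : in_spin 1.
Proof. exact/unit_prod_spin/unit_prod1. Qed.

Lemma in_spinM x y : in_spin x -> in_spin y -> in_spin (x * y).
Proof.
move=> /spin_unit_prod xu /spin_unit_prod yu.
exact/unit_prod_spin/(unit_prodM xu yu).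
Qed.

Lemma in_spin_unit x : in_spin x -> x \is a GRing.unit.
Proof.
move=> /spin_unit_prod /unit_prod_inv[y [_ yx xy]].
by apply/unitrP; exists y.
Qed.

Lemma in_spinV x : in_spin x -> in_spin x^-1.
Proof.
move=> xs; have xU := in_spin_unit xs.
move: xs => /spin_unit_prod /unit_prod_inv[y [yu _ xy]].
suff -> : x^-1 = y by exact: unit_prod_spin.
by apply: (mulrI xU); rewrite divrr.
Qed.

End CliffordAlgebra.

Record spin (R : realType) (n : nat) :=
  Spin { spin_val :> clifford R n; _ : spin_pred spin_val }.

HB.instance Definition _ R n := [isSub for @spin_val R n].
HB.instance Definition _ R n := [Choice of spin R n by <:].

Definition mkspin R n (x : clifford R n) (hx : in_spin x) : spin R n :=
  Spin (asboolT hx).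

Section SpinGroup.
Context {R : realType} {n : nat}.
Implicit Types x y z : spin R n.

Lemma spinP x : in_spin (val x).
Proof. exact/asboolP/(valP x). Qed.

Definition spin_one : spin R n := mkspin in_spin1.
Definition spin_mul x y : spin R n := mkspin (in_spinM (spinP x) (spinP y)).
Definition spin_inv x : spin R n := mkspin (in_spinV (spinP x)).

Lemma spin_mulA : associative spin_mul.
Proof. by move=> x y z; apply: val_inj; rewrite /= mulrA. Qed.

Lemma spin_mul1 : left_id spin_one spin_mul.
Proof. by move=> x; apply: val_inj; rewrite /= mul1r. Qed.

Lemma spin_mulr1 : right_id spin_one spin_mul.
Proof. by move=> x; apply: val_inj; rewrite /= mulr1. Qed.

Lemma spin_mulV : left_inverse spin_one spin_inv spin_mul.
Proof.
by move=> x; apply: val_inj; rewrite /= mulVr //; exact/in_spin_unit/spinP.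
Qed.

Lemma spin_mulrV : right_inverse spin_one spin_inv spin_mul.
Proof.
by move=> x; apply: val_inj; rewrite /= divrr //; exact/in_spin_unit/spinP.
Qed.

HB.instance Definition _ := isGroup.Build (spin R n)
  spin_mulA spin_mul1 spin_mulr1 spin_mulV spin_mulrV.

Lemma val_spinM x y : val (x * y)%g = val x * val y. Proof. by []. Qed.
Lemma val_spin1 : val (1%g : spin R n) = 1. Proof. by []. Qed.
Lemma val_spinV x : val (x^-1)%g = (val x)^-1. Proof. by []. Qed.

End SpinGroup.

Section Subgroups.
Context {G : groupType}.
Implicit Types S H : set G.

Definition is_subgroup H : Prop :=
  H 1%g /\ forall x y, H x -> H y -> H (x * y^-1)%g.

Definition generated S : set G := smallest is_subgroup S.

Definition is_abelian H : Prop :=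
  forall x y, H x -> H y -> (x * y = y * x)%g.

Definition conjugate_subsets H1 H2 : Prop :=
  exists g : G, H1 = [set (x ^ g)%g | x in H2].

Lemma generated_subgroup S : is_subgroup (generated S).
Proof.
split=> [H [[H1 _] _] //|x y xS yS H HS].
by case: (HS) => -[_ HV] _; apply: HV; [exact: xS|exact: yS].
Qed.

Lemma is_subgroupV H x : is_subgroup H -> H x -> H (x^-1)%g.
Proof. by move=> [H1 HV] Hx; rewrite -[X in H X]mul1g; exact: HV. Qed.

Lemma is_subgroupM H x y : is_subgroup H -> H x -> H y -> H (x * y)%g.
Proof.
by move=> HG Hx Hy; rewrite -[y]invgK; apply: HG.2 => //; exact: is_subgroupV.
Qed.

End Subgroups.

(* The quotient of G by the subgroup generated by a central element z.  The
   type carries the centrality proof, on which its group structure depends. *)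
Section CentralQuotient.
Context {G : groupType} (z : G) (zC : forall x : G, commute x z).
Local Open Scope quotient_scope.
Local Open Scope group_scope.

Let Z := generated [set z].

Lemma central_generated (x y : G) : Z y -> commute x y.
Proof.
move=> Zy; pose H := [set y : G | commute x y].
suff : H y by [].
apply: Zy; split; last by move=> _ ->; exact: zC.
split; first exact: commute1.
by move=> a b xa xb; apply: commuteM => //; exact: commuteV.
Qed.

Definition central_rel : rel G := fun x y => `[< Z (x^-1 * y) >].

Lemma central_rel_refl : reflexive central_rel.
Proof.
by move=> x; apply/asboolP; rewrite mulVg; case: (generated_subgroup [set z]).
Qed.

Lemma central_rel_sym : symmetric central_rel.
Proof.
suff S x y : central_rel x y -> central_rel y x by move=> x y; apply/idP/idP; exact: S.
move=> /asboolP xy; apply/asboolP.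
rewrite (_ : y^-1 * x = (x^-1 * y)^-1); last by rewrite invgM invgK.
exact: (is_subgroupV (generated_subgroup _) xy).
Qed.

Lemma central_rel_trans : transitive central_rel.
Proof.
move=> y x w /asboolP xy /asboolP yw; apply/asboolP.
rewrite -(mulVKg y w) mulgA.
exact: (is_subgroupM (generated_subgroup _) xy yw).
Qed.

Definition central_equiv :=
  EquivRel central_rel central_rel_refl central_rel_sym central_rel_trans.

Definition central_quot of (forall x : G, commute x z) := {eq_quot central_equiv}.
HB.instance Definition _ (h : forall x : G, commute x z) :=
  EqQuotient.on (central_quot h).
HB.instance Definition _ (h : forall x : G, commute x z) :=
  Choice.on (central_quot h).

Local Notation Q := (central_quot zC).

Definition central_pi (x : G) : Q := \pi_Q x.

Definition cquot_one : Q := central_pi 1.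
Definition cquot_mul (a b : Q) := central_pi (repr a * repr b).
Definition cquot_inv (a : Q) := central_pi (repr a)^-1.

Lemma central_piP x y : central_pi x = central_pi y <-> Z (x^-1 * y).
Proof.
rewrite /central_pi; split=> [/eqquotP/asboolP //|xy].
exact/eqquotP/asboolP.
Qed.

Lemma central_repr x : Z ((repr (central_pi x))^-1 * x).
Proof. by apply/central_piP; rewrite /central_pi reprK. Qed.

Lemma central_piM x y :
  cquot_mul (central_pi x) (central_pi y) = central_pi (x * y).
Proof.
apply/central_piP; set u := repr _; set v := repr _.
have ux : Z (u^-1 * x) by exact: central_repr.
have vy : Z (v^-1 * y) by exact: central_repr.
rewrite invgM -mulgA (mulgA u^-1) -(central_generated y ux) mulgA.
exact: (is_subgroupM (generated_subgroup _) vy ux).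
Qed.

Lemma central_piV x : cquot_inv (central_pi x) = central_pi x^-1.
Proof.
apply/central_piP; rewrite invgK; set u := repr _.
have ux : Z (u^-1 * x) by exact: central_repr.
have uCx : commute u x.
  by apply: (mulgI u^-1); rewrite mulKg mulgA -(central_generated u ux) mulVKg.
rewrite (commuteV uCx) -[X in _ * X]invgK -invgM.
exact: (is_subgroupV (generated_subgroup _) ux).
Qed.

Lemma central_piK (a : Q) : central_pi (repr a) = a.
Proof. exact: reprK. Qed.

Lemma cquot_mulA : associative cquot_mul.
Proof.
move=> a b d; rewrite -(central_piK a) -(central_piK b) -(central_piK d).
by rewrite !central_piM mulgA.
Qed.

Lemma cquot_mul1 : left_id cquot_one cquot_mul.
Proof. by move=> a; rewrite -(central_piK a) central_piM mul1g. Qed.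

Lemma cquot_mulr1 : right_id cquot_one cquot_mul.
Proof. by move=> a; rewrite -(central_piK a) central_piM mulg1. Qed.

Lemma cquot_mulV : left_inverse cquot_one cquot_inv cquot_mul.
Proof.
by move=> a; rewrite -(central_piK a) central_piV central_piM mulVg.
Qed.

Lemma cquot_mulrV : right_inverse cquot_one cquot_inv cquot_mul.
Proof.
by move=> a; rewrite -(central_piK a) central_piV central_piM mulgV.
Qed.

HB.instance Definition _ := isGroup.Build Q
  cquot_mulA cquot_mul1 cquot_mulr1 cquot_mulV cquot_mulrV.

Lemma central_pi_morph x y : central_pi (x * y) = central_pi x * central_pi y.
Proof. by rewrite -central_piM. Qed.

End CentralQuotient.

Section Spin12.
Context {R : realType}.
Implicit Types (x y : spin R 12) (X : clifford R 12).

(* The orthonormal basis e_1, ..., e_12; indices start at 1. *)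
Definition e_ (i : nat) : clifford R 12 := clifford_gen (inord i.-1).

Definition c_elt : clifford R 12 := \prod_(1 <= i < 13) e_ i.

Definition one_plus (i j : nat) : clifford R 12 :=
  (Num.sqrt 2)^-1 *: (1 + e_ i * e_ j).

Definition e_plus (i j : nat) : clifford R 12 :=
  (Num.sqrt 2)^-1 *: (e_ i + e_ j).

Lemma c_eltE : c_elt = \prod_(i < 12) clifford_gen i.
Proof.
rewrite /c_elt (big_addn 0 13 1) big_mkord; apply: eq_bigr => i _.
by rewrite /e_ addn1 /= inord_val.
Qed.

Lemma unit_prod_gen n (i : 'I_n) : unit_prod true (clifford_gen i : clifford R n).
Proof.
have -> : clifford_gen i = clifford_vec (delta_mx 0 i) :> clifford R n.
  rewrite /clifford_vec (bigD1 i) //= big1 ?addr0; last first.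
    by move=> j /negbTE ji; rewrite mxE ji scale0r.
  by rewrite mxE !eqxx scale1r.
apply: unit_prod_vec; rewrite /unit_vector (bigD1 i) //= big1 ?addr0.
  by rewrite mxE !eqxx expr1n.
by move=> j /negbTE ji; rewrite mxE ji expr0n.
Qed.

Lemma unit_prod_e i : unit_prod true (e_ i).
Proof. exact: unit_prod_gen. Qed.

Lemma c_elt_spin : in_spin c_elt.
Proof.
apply: unit_prod_spin; rewrite /c_elt.
have P m : unit_prod (odd m) (\prod_(1 <= i < m.+1) e_ i).
  elim: m => [|m IHm]; first by rewrite big_geq //; exact: unit_prod1.
  rewrite big_nat_recr //= -addbT; exact/unit_prodM/unit_prod_e.
exact: (P 12).
Qed.

Lemma gen_mul_prod n (i : 'I_n) (s : seq 'I_n) :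
  clifford_gen i * \prod_(j <- s) clifford_gen j =
  (-1) ^+ (count (predC1 i) s) * (\prod_(j <- s) clifford_gen j * clifford_gen i)
  :> clifford R n.
Proof.
elim: s => [|j s IHs]; first by rewrite !big_nil mulr1 !mul1r.
rewrite big_cons /= mulrA; case: (eqVneq j i) => [->|ji] /=.
  by rewrite add0n -mulrA [in LHS]IHs mulrA (commr_sign (clifford_gen i)) -!mulrA.
rewrite (@clifford_gen_anti _ _ i j); last by rewrite eq_sym.
rewrite mulNr -(mulrA (clifford_gen j) (clifford_gen i)) IHs exprS mulN1r mulNr; congr (- _).
by rewrite !mulrA (commr_sign (clifford_gen j)).
Qed.

Lemma gen_c_anti (i : 'I_12) : clifford_gen i * c_elt = - (c_elt * clifford_gen i).
Proof.
rewrite c_eltE gen_mul_prod.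
suff -> : count (predC1 i) (index_enum 'I_12) = 11.
  by rewrite -signr_odd /= expr1 mulN1r.
apply/eqP; rewrite -(eqn_add2l (count (pred1 i) (index_enum 'I_12))).
rewrite count_predC count_uniq_mem ?index_enum_uniq // mem_index_enum.
by rewrite -sum1_size sum_nat_const card_ord.
Qed.

Lemma vec_c_anti (v : 'rV[R]_12) : clifford_vec v * c_elt = - (c_elt * clifford_vec v).
Proof.
rewrite mulr_suml mulr_sumr -sumrN; apply: eq_bigr => i _.
by rewrite -scalerAl gen_c_anti -scalerAr scalerN.
Qed.

Lemma unit_prod_c b X : unit_prod b X -> X * c_elt = (-1) ^+ b * (c_elt * X).
Proof.
case=> s [_ <- ->]; rewrite signr_odd; elim: s => [|v s IHs].
  by rewrite big_nil /= !mul1r mulr1.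
rewrite big_cons -mulrA IHs /= exprS mulN1r mulNr.
rewrite [LHS]mulrA (commr_sign (clifford_vec v)) -[LHS]mulrA.
rewrite (mulrA (clifford_vec v) c_elt) vec_c_anti.
by rewrite mulNr mulrN (mulrA c_elt).
Qed.

Definition c_spin : spin R 12 := mkspin c_elt_spin.

Lemma c_central x : commute x c_spin.
Proof.
apply: val_inj => /=.
by rewrite (unit_prod_c (spin_unit_prod (spinP x))) mul1r.
Qed.

Lemma unit_prod_e_plus i j : inord i.-1 != inord j.-1 :> 'I_12 ->
  unit_prod true (e_plus i j).
Proof.
rewrite /e_plus /e_; set a := inord _; set b := inord _ => ab.
pose v : 'rV[R]_12 := (Num.sqrt 2)^-1 *: (delta_mx 0 a + delta_mx 0 b).
have va : v 0 a = (Num.sqrt 2)^-1.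
  by rewrite !mxE !eqxx (negbTE ab) addr0 mulr1.
have vb : v 0 b = (Num.sqrt 2)^-1.
  by rewrite !mxE !eqxx eq_sym (negbTE ab) add0r mulr1.
have v0 k : k != a -> k != b -> v 0 k = 0.
  by move=> /negbTE ka /negbTE kb; rewrite !mxE ka kb addr0 mulr0.
have -> : (Num.sqrt 2)^-1 *: (clifford_gen a + clifford_gen b) = clifford_vec v.
  rewrite /clifford_vec (bigD1 a) //= (bigD1 b) 1?eq_sym //= va vb.
  rewrite big1 ?addr0 ?scalerDr // => k /andP[ka kb].
  by rewrite v0 // scale0r.
apply: unit_prod_vec; rewrite /unit_vector (bigD1 a) //= (bigD1 b) 1?eq_sym //=.
rewrite big1 ?addr0; last by move=> k /andP[ka kb]; rewrite v0 ?expr0n.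
rewrite va vb -mulr2n exprVn sqr_sqrtr ?ler0n // -[_ *+ 2]mulr_natr mulVf //.
by rewrite pnatr_eq0.
Qed.

Lemma unit_prod_one_plus i j : inord i.-1 != inord j.-1 :> 'I_12 ->
  unit_prod false (one_plus i j).
Proof.
rewrite /one_plus /e_; set a := inord _; set b := inord _ => ab.
pose v : 'rV[R]_12 := (Num.sqrt 2)^-1 *: (delta_mx 0 b - delta_mx 0 a).
have va : v 0 a = - (Num.sqrt 2)^-1.
  by rewrite !mxE !eqxx (negbTE ab) add0r mulrN1.
have vb : v 0 b = (Num.sqrt 2)^-1.
  by rewrite !mxE !eqxx eq_sym (negbTE ab) subr0 mulr1.
have v0 k : k != a -> k != b -> v 0 k = 0.
  by move=> /negbTE ka /negbTE kb; rewrite !mxE ka kb subr0 mulr0.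
have vE : clifford_vec v = (Num.sqrt 2)^-1 *: (clifford_gen b - clifford_gen a).
  rewrite /clifford_vec (bigD1 a) //= (bigD1 b) 1?eq_sym //= va vb.
  rewrite big1 ?addr0; last by move=> k /andP[ka kb]; rewrite v0 // scale0r.
  by rewrite scalerBr scaleNr addrC.
have -> : (Num.sqrt 2)^-1 *: (1 + clifford_gen a * clifford_gen b) =
    clifford_gen a * clifford_vec v.
  by rewrite vE -scalerAr mulrBr clifford_gen_sqr opprK addrC.
apply: (@unit_prodM _ _ true true); first exact: unit_prod_gen.
apply: unit_prod_vec; rewrite /unit_vector (bigD1 a) //= (bigD1 b) 1?eq_sym //=.
rewrite big1 ?addr0; last by move=> k /andP[ka kb]; rewrite v0 ?expr0n.
rewrite va vb sqrrN -mulr2n exprVn sqr_sqrtr ?ler0n // -[_ *+ 2]mulr_natr mulVf //.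
by rewrite pnatr_eq0.
Qed.

End Spin12.

(* The half-spin group Spin(12)/<c>. *)
Definition HSpin12 (R : realType) := central_quot (@c_central R).
HB.instance Definition _ (R : realType) := Group.on (HSpin12 R).

Section HSpin12.
Context {R : realType}.
Implicit Types (x y : spin R 12) (X : clifford R 12).

Definition cls x : HSpin12 R := central_pi c_central x.

(* The class [x] of an element x of the Clifford algebra lying in Spin(12). *)
Definition scls (x : clifford R 12) (hx : in_spin x) : HSpin12 R :=
  cls (mkspin hx).

(* The Lie algebra of Spin(12) inside the Clifford algebra: the span of the
   e_i e_j, i < j, which is so(12) through X |-> (v |-> X v - v X). *)
Definition so12 : set (clifford R 12) :=
  [set X | exists a : 'I_12 -> 'I_12 -> R,
     X = \sum_(i < 12) \sum_(j < 12 | (i < j)%N)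
           a i j *: (clifford_gen i * clifford_gen j)].

Definition Ad x X : clifford R 12 := val x * X * (val x)^-1.

Definition so12_fixed (F : set (HSpin12 R)) : set (clifford R 12) :=
  [set X | so12 X /\ forall x, F (cls x) -> Ad x X = X].

(* Condition dim g_0^F = dim F for a finite F, for which dim F = 0. *)
Definition condition_star (F : set (HSpin12 R)) : Prop :=
  so12_fixed F = [set 0].

Lemma so12_c X : so12 X -> X * c_elt = c_elt * X.
Proof.
case=> a ->; rewrite mulr_suml mulr_sumr; apply: eq_bigr => i _.
rewrite mulr_suml mulr_sumr; apply: eq_bigr => j _.
rewrite -scalerAl -scalerAr -mulrA gen_c_anti mulrN mulrA gen_c_anti.
by rewrite mulNr opprK mulrA.
Qed.

Lemma Ad_cls x y X : so12 X -> cls x = cls y -> Ad x X = Ad y X.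
Proof.
move=> /so12_c Xc /central_piP xy.
pose H := [set w : spin R 12 | X * val w = val w * X].
have Hw : H (x^-1 * y)%g.
  apply: xy; split; last by move=> _ ->.
  split=> [|a b /= aX bX]; first by rewrite /H /= mulr1 mul1r.
  have bU := in_spin_unit (spinP b).
  rewrite /H /= mulrA aX -!mulrA; congr (_ * _).
  by apply: (mulIr bU); rewrite mulrVK // -mulrA bX mulKr.
have xU := in_spin_unit (spinP x); have yU := in_spin_unit (spinP y).
move: Hw; rewrite /H /= => Hw.
apply: (mulIr yU); rewrite /Ad mulrVK // -!mulrA Hw.
by rewrite -!mulrA mulVKr.
Qed.

End HSpin12.
Arguments scls {R} x hx.

Lemma unit_prod_eq (R : realType) n b c (x : clifford R n) :
  unit_prod b x -> b = c -> unit_prod c x.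
Proof. by move=> xb <-. Qed.

Ltac unit_prod_tac := lazymatch goal with
  | |- unit_prod _ (e_ _) => exact: unit_prod_e
  | |- unit_prod _ (e_plus _ _) =>
      apply: unit_prod_e_plus; by rewrite -val_eqE /= !inordK
  | |- unit_prod _ (one_plus _ _) =>
      apply: unit_prod_one_plus; by rewrite -val_eqE /= !inordK
  | |- unit_prod _ (_ * _) => eapply unit_prodM; unit_prod_tac
  end.

Ltac in_spin_tac :=
  apply: unit_prod_spin; eapply unit_prod_eq; [unit_prod_tac | reflexivity].

Section Subgroups123.
Variable R : realType.
Local Notation e_ := (@e_ R).
Local Notation one_plus := (@one_plus R).
Local Notation e_plus := (@e_plus R).

Lemma m1_spin : in_spin (-1 : clifford R 12).
Proof.
have -> : -1 = e_ 1 * e_ 1 by rewrite clifford_gen_sqr.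
by in_spin_tac.
Qed.

Definition a1 := e_ 1 * e_ 2 * e_ 3 * e_ 4 * e_ 5 * e_ 6.
Definition a2 :=
  e_ 1 * e_ 3 * one_plus 5 6 * e_ 7 * e_ 9 * one_plus 11 12.
Definition a3 :=
  e_plus 1 2 * one_plus 3 4 * e_ 5 * e_plus 7 8 * one_plus 9 10 * e_ 11.

Definition b1 := e_ 1 * e_ 2 * e_ 3 * e_ 4.
Definition b2 := e_ 5 * e_ 6 * e_ 7 * e_ 8.
Definition b3 := e_ 3 * e_ 4 * e_ 5 * e_ 6.
Definition b4 := e_ 7 * e_ 8 * e_ 9 * e_ 10.
Definition b5 := e_ 1 * e_ 3 * e_ 5 * e_ 7 * e_ 9 * e_ 11.

Definition delta := one_plus 1 2 * one_plus 3 4 * one_plus 5 6 *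
  one_plus 7 8 * one_plus 9 10 * one_plus 11 12.

Lemma a1_spin : in_spin a1. Proof. rewrite /a1; in_spin_tac. Qed.
Lemma a2_spin : in_spin a2. Proof. rewrite /a2; in_spin_tac. Qed.
Lemma a3_spin : in_spin a3. Proof. rewrite /a3; in_spin_tac. Qed.
Lemma b1_spin : in_spin b1. Proof. rewrite /b1; in_spin_tac. Qed.
Lemma b2_spin : in_spin b2. Proof. rewrite /b2; in_spin_tac. Qed.
Lemma b3_spin : in_spin b3. Proof. rewrite /b3; in_spin_tac. Qed.
Lemma b4_spin : in_spin b4. Proof. rewrite /b4; in_spin_tac. Qed.
Lemma b5_spin : in_spin b5. Proof. rewrite /b5; in_spin_tac. Qed.
Lemma delta_spin : in_spin delta. Proof. rewrite /delta; in_spin_tac. Qed.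

Definition F1 : set (HSpin12 R) :=
  generated [set scls a1 a1_spin; scls a2 a2_spin; scls a3 a3_spin].

Definition F2_gens : set (HSpin12 R) :=
  [set scls (-1) m1_spin; scls b1 b1_spin; scls b2 b2_spin;
       scls b3 b3_spin; scls b4 b4_spin; scls b5 b5_spin].

Definition F2 : set (HSpin12 R) := generated F2_gens.

Definition F3 : set (HSpin12 R) :=
  generated (F2_gens `|` [set scls delta delta_spin]).

End Subgroups123.
Arguments F1 : clear implicits.
Arguments F2 : clear implicits.
Arguments F3 : clear implicits.

(* Main.v *)
Require Import Defs.
From mathcomp Require Import all_boot all_order all_algebra.
From mathcomp Require Import boolp classical_sets cardinality reals.
From mathcomp Require Import ring lra zify.

Set Implicit Arguments.
Unset Strict Implicit.
Unset Printing Implicit Defensive.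

Import Order.TTheory GRing.Theory Num.Theory.
Local Open Scope ring_scope.

(** The vector representation maps Spin(12) to SO(12) and c to -1.  As F contains
    [-1], it is determined by its image H in SO(12), a finite group that contains
    -1.  The lifts to Spin(12) of two elements of F commute up to c, so that two
    elements of H commute up to sign.  The condition on the Lie algebra says that no
    nonzero antisymmetric matrix commutes with H; averaging over H turns it into a
    numerical obstruction ([star_contra]).  The spin structure contributes a parity:
    lifts of commuting elements of H really commute, since -1 is not a power of c,
    and this makes the common (-1)-eigenspaces of commuting involutions
    even-dimensional ([commuting_parity]).

    A central element k of H is a symmetric involution, because k - k^T is
    antisymmetric and commutes with H.  So the centre, which contains the squares of
    all elements, is diagonal in some frame.  Counting frame vectors by the signs of
    four squares shows that H does not contain two anticommuting pairs that commute with
    each other ([no_quadruple]).  Hence H is abelian, or it is generated by its centre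
    and one anticommuting pair X, Y.

    If H is not abelian, the frame can be chosen so that it consists of six planes on
    which the centre acts by scalars and on which X and Y act by reflections and
    quarter turns, the shape depending on the signs of X ^ 2 and Y ^ 2
    ([plane_normal_form]).  Not both signs are negative, so there are three types of
    planes.  By parity, either there are two planes of each type, which gives F1, or
    all planes are of the same type, which gives F3 ([nonabelian_types]).

    If H is abelian, it is a binary code of length 12.  All its words have even
    weight and half the weight is additive modulo 2; the resulting character s
    satisfies s tr ^ 2 = tr ^ 2, as words of weight 2 or 10 do not occur.  Summation
    over H shows that the characters of the frame vectors come in pairs with quotient
    s, and the kernel of s consists of all even sign changes of these pairs, which
    gives F2 ([abelian_type2]).

    Finally, the frame is an orthogonal matrix, hence it is lifted by a product q of
    unit vectors, and conjugation by q takes the given generators to lifts of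
    generators of H ([conjugate_generated]).  It remains to see that q can be taken in
    Spin(12).  In the abelian case one frame vector may be replaced by its opposite.
    In the other cases the orientation of the frame is forced, because conjugation by
    an odd element replaces the commutator c of two of the generators by -c
    ([orientation]). *)

(** * Orthogonal matrices *)

Lemma colM (R : pzSemiRingType) m n p (A : 'M[R]_(m, n)) (B : 'M[R]_(n, p)) j :
  col j (A *m B) = A *m col j B.
Proof. by apply/colP => i; rewrite !mxE; apply: eq_bigr => k _; rewrite !mxE. Qed.

Section Dot.
Context {R : rcfType} {n : nat}.
Implicit Types (u v w : 'cV[R]_n) (M : 'M[R]_n).

Definition dot u v : R := (u^T *m v) 0 0.

Lemma dotE u v : dot u v = \sum_i u i 0 * v i 0.
Proof. by rewrite /dot mxE; apply: eq_bigr => i _; rewrite mxE. Qed.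

Lemma dotC u v : dot u v = dot v u.
Proof. by rewrite !dotE; apply: eq_bigr => i _; rewrite mulrC. Qed.

Lemma dotDl u v w : dot (u + v) w = dot u w + dot v w.
Proof. by rewrite /dot linearD mulmxDl mxE. Qed.

Lemma dotNl u w : dot (- u) w = - dot u w.
Proof. by rewrite /dot linearN mulNmx mxE. Qed.

Lemma dotZl a u w : dot (a *: u) w = a * dot u w.
Proof. by rewrite /dot linearZ -scalemxAl mxE. Qed.

Lemma dotDr u v w : dot w (u + v) = dot w u + dot w v.
Proof. by rewrite dotC dotDl !(dotC w). Qed.

Lemma dotNr u w : dot w (- u) = - dot w u.
Proof. by rewrite dotC dotNl dotC. Qed.

Lemma dotZr a u w : dot w (a *: u) = a * dot w u.
Proof. by rewrite dotC dotZl dotC. Qed.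

Lemma dotM M u v : dot (M *m u) v = dot u (M^T *m v).
Proof. by rewrite /dot trmx_mul mulmxA. Qed.

Lemma dot_ge0 u : 0 <= dot u u.
Proof. by rewrite dotE sumr_ge0 // => i _; rewrite -expr2 sqr_ge0. Qed.

Lemma dot_eq0 u : (dot u u == 0) = (u == 0).
Proof.
apply/idP/eqP => [|->]; last by rewrite /dot mulmx0 mxE.
rewrite dotE psumr_eq0 => [|i _]; last by rewrite -expr2 sqr_ge0.
move=> /allP u0; apply/colP => i; rewrite mxE; apply/eqP.
by have := u0 i (mem_index_enum i); rewrite /= -expr2 sqrf_eq0.
Qed.

Lemma unit_scale u : u != 0 -> exists2 a, a != 0 & dot (a *: u) (a *: u) = 1.
Proof.
move=> u0; have uu : 0 < dot u u by rewrite lt_def dot_eq0 u0 dot_ge0.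
have s0 : Num.sqrt (dot u u) != 0 by rewrite gt_eqF // sqrtr_gt0.
exists (Num.sqrt (dot u u))^-1; first by rewrite invr_eq0.
rewrite dotZl dotZr -{3}(sqr_sqrtr (ltW uu)).
by field.
Qed.

Lemma mul_outer u v w : (u *m v^T) *m w = dot v w *: u.
Proof.
rewrite -mulmxA [v^T *m w]mx11_scalar -/(dot v w).
by rewrite mul_mx_scalar.
Qed.

Lemma mx_ext M N : (forall v, M *m v = N *m v) -> M = N.
Proof.
move=> MN; apply/matrixP => i j.
by have := MN (delta_mx j 0); rewrite -!colE => /matrixP/(_ i 0); rewrite !mxE.
Qed.

Lemma tr_outer u v : \tr (u *m v^T) = dot u v.
Proof. by rewrite mxtrace_mulC trace_mx11 dotC. Qed.

Definition orthogonal M := M^T *m M = 1%:M.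

Lemma orthogonalC M : orthogonal M -> M *m M^T = 1%:M.
Proof. exact: mulmx1C. Qed.

Lemma orthogonal1 : orthogonal 1%:M.
Proof. by rewrite /orthogonal trmx1 mulmx1. Qed.

Lemma orthogonalM M N : orthogonal M -> orthogonal N -> orthogonal (M *m N).
Proof.
rewrite /orthogonal => MO NO.
by rewrite trmx_mul -mulmxA (mulmxA M^T) MO mul1mx.
Qed.

Lemma orthogonalN M : orthogonal M -> orthogonal (- M).
Proof. by rewrite /orthogonal => MO; rewrite [(- M)^T]linearN mulNmx mulmxN opprK. Qed.

Lemma orthogonal_dot M u v : orthogonal M -> dot (M *m u) (M *m v) = dot u v.
Proof. by move=> MO; rewrite dotM mulmxA MO mul1mx. Qed.

Lemma orthogonal_det M : orthogonal M -> \det M * \det M = 1.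
Proof. by move=> MO; rewrite -{1}det_tr -det_mulmx MO det1. Qed.

Lemma orthogonalP M :
  (forall i j, dot (col i M) (col j M) = (i == j)%:R) -> orthogonal M.
Proof.
move=> MO; apply/matrixP => i j; rewrite [RHS]mxE -MO dotE mxE.
by apply: eq_bigr => k _; rewrite !mxE.
Qed.

Lemma orthogonal_col M i j : orthogonal M ->
  dot (col i M) (col j M) = (i == j)%:R.
Proof.
move=> /matrixP/(_ i j); rewrite [X in _ = X]mxE => <-; rewrite dotE mxE.
by apply: eq_bigr => k _; rewrite !mxE.
Qed.

Lemma frame_neq0 M i : orthogonal M -> col i M != 0.
Proof.
by move=> MO; rewrite -dot_eq0 orthogonal_col // eqxx oner_eq0.
Qed.

Lemma frame_neqN Q i : orthogonal Q -> (col i Q == - col i Q) = false.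
Proof.
move=> QO; rewrite -subr_eq0 opprK -mulr2n -scaler_nat scaler_eq0 pnatr_eq0 /=.
exact/negbTE/frame_neq0.
Qed.

Lemma frame_ext Q M N : orthogonal Q ->
  (forall i, M *m col i Q = N *m col i Q) -> M = N.
Proof.
move=> QO MN; have MQ : M *m Q = N *m Q.
  by apply/matrixP => i j; have /matrixP/(_ i 0) := MN j; rewrite -!colM !mxE.
by rewrite -[M]mulmx1 -(orthogonalC QO) mulmxA MQ -mulmxA orthogonalC ?mulmx1.
Qed.

Lemma frame_trace Q M : orthogonal Q ->
  \tr M = \sum_i dot (col i Q) (M *m col i Q).
Proof.
move=> QO; have -> : \tr M = \tr (Q^T *m (M *m Q)).
  by rewrite mxtrace_mulC -mulmxA orthogonalC ?mulmx1.
apply: eq_bigr => i _; rewrite -colM dotE mxE.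
by apply: eq_bigr => k _; rewrite !mxE.
Qed.

Definition reflection u : 'M[R]_n := 1%:M - (2 / dot u u) *: (u *m u^T).

Lemma reflection_apply u v :
  reflection u *m v = v - (2 * dot u v / dot u u) *: u.
Proof.
rewrite mulmxBl mul1mx -scalemxAl mul_outer scalerA; congr (_ - _ *: _).
by rewrite -!mulrA; congr (_ * _); rewrite mulrC.
Qed.

Lemma reflectionT u : (reflection u)^T = reflection u.
Proof. by rewrite linearB linearZ /= trmx1 trmx_mul trmxK. Qed.

Lemma reflectionK u : u != 0 -> reflection u *m reflection u = 1%:M.
Proof.
move=> u0; apply: mx_ext => v; rewrite -mulmxA !reflection_apply mul1mx.
have d0 : dot u u != 0 by rewrite dot_eq0.
rewrite dotDr dotNr dotZr -addrA -opprD -scalerDl.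
rewrite [X in X *: u](_ : _ = 0) ?scale0r ?subr0 //.
by field.
Qed.

Lemma reflection_orthogonal u : u != 0 -> orthogonal (reflection u).
Proof. by move=> u0; rewrite /orthogonal reflectionT reflectionK. Qed.

(** The vector v - w is orthogonal to the mirror, which contains v + w. *)
Lemma reflection_swap v w : dot v v = dot w w -> v != w ->
  reflection (v - w) *m v = w.
Proof.
move=> vw neq; rewrite reflection_apply.
have d0 : dot (v - w) (v - w) != 0 by rewrite dot_eq0 subr_eq0.
suff -> : 2 * dot (v - w) v / dot (v - w) (v - w) = 1.
  by rewrite scale1r subKr.
apply: (mulIf d0); rewrite mul1r divfK //.
rewrite !(dotDl, dotDr, dotNl, dotNr) (dotC w v) -vw; ring.
Qed.

End Dot.

(** * Simultaneous diagonalization of involutions *)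

Section Diagonalization.
Context {R : rcfType}.

(** The joint eigenvector of commuting involutions is obtained by replacing v
    with v + k v, for one involution k after the other, unless it vanishes. *)
Lemma joint_eigenvector n (ks : seq 'M[R]_n.+1) :
  (forall k, k \in ks -> k *m k = 1%:M) ->
  (forall k l, k \in ks -> l \in ks -> k *m l = l *m k) ->
  exists2 v : 'cV[R]_n.+1, dot v v = 1 &
    forall k, k \in ks -> k *m v = v \/ k *m v = - v.
Proof.
move=> kk kC; suff [v v0 vP] : exists2 v : 'cV[R]_n.+1, v != 0 &
    forall k, k \in ks -> k *m v = v \/ k *m v = - v.
  have [a a0 va] := unit_scale v0; exists (a *: v) => // k /vP.
  by rewrite -scalemxAr => -[->|->]; rewrite ?scalerN; [left|right].
elim: ks kk kC => [|k ks IHks] kk kC.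
  exists (const_mx 1) => //; apply/eqP => /colP /(_ 0) /eqP.
  by rewrite !mxE oner_eq0.
have [||v v0 vP] := IHks.
- by move=> l ls; apply: kk; rewrite inE ls orbT.
- by move=> l m ls ms; apply: kC; rewrite inE ?ls ?ms orbT.
have k2 : k *m k = 1%:M by apply: kk; rewrite mem_head.
have [vk|vk] := eqVneq (v + k *m v) 0.
  exists v => // l; rewrite inE => /orP[/eqP ->|/vP //].
  by right; apply/eqP; rewrite -addr_eq0 addrC vk.
exists (v + k *m v) => // l; rewrite inE => /orP[/eqP ->|ls].
  by left; rewrite mulmxDr mulmxA k2 mul1mx addrC.
have -> : l *m (v + k *m v) = l *m v + k *m (l *m v).
  by rewrite mulmxDr !mulmxA (kC l k) // inE ?eqxx ?ls ?orbT.
by case: (vP _ ls) => ->; rewrite ?mulmxN -?opprD; [left|right].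
Qed.

(** A reflection takes the first vector of the standard frame to v. *)
Lemma unit_vector_orthogonal n (v : 'cV[R]_n.+1) : dot v v = 1 ->
  exists2 Q, orthogonal Q & col 0 Q = v.
Proof.
move=> v1; have [e1|ne] := eqVneq (delta_mx 0 0) v.
  by exists 1%:M; [exact: orthogonal1 | rewrite colE mul1mx].
exists (reflection (delta_mx 0 0 - v)).
  by apply: reflection_orthogonal; rewrite subr_eq0.
rewrite colE reflection_swap // v1 dotE (bigD1 0) //= big1 ?mxE ?eqxx ?mulr1 ?addr0 //.
by move=> i /negbTE i0; rewrite mxE i0 mul0r.
Qed.

(** In a frame that starts with a joint eigenvector, the involutions are block
    diagonal, and their lower right blocks are treated by induction. *)
Lemma simultaneous_diagonalization n (ks : seq 'M[R]_n) :
  (forall k, k \in ks -> k^T = k) -> (forall k, k \in ks -> k *m k = 1%:M) ->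
  (forall k l, k \in ks -> l \in ks -> k *m l = l *m k) ->
  exists2 Q, orthogonal Q & forall k i, k \in ks ->
    k *m col i Q = col i Q \/ k *m col i Q = - col i Q.
Proof.
elim: n ks => [|n IHn] ks kT kk kC.
  by exists 1%:M; [exact: orthogonal1 | move=> k []].
have [v v1 vP] := joint_eigenvector kk kC.
have [Q QO Q0] := unit_vector_orthogonal v1.
have QQ : Q *m Q^T = 1%:M by exact: orthogonalC.
pose cj (k : 'M[R]_n.+1) : 'M[R]_(1 + n) := Q^T *m k *m Q.
have cjM k l : cj (k *m l) = cj k *m cj l.
  by rewrite /cj !mulmxA -(mulmxA (Q^T *m k) Q) QQ mulmx1.
have cjT k : k^T = k -> (cj k)^T = cj k.
  by move=> kE; rewrite /cj !trmx_mul trmxK kE mulmxA.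
have cj1 : cj 1%:M = 1%:M by rewrite /cj mulmx1.
have kQ k w : k *m (Q *m w) = Q *m (cj k *m w).
  by rewrite /cj -!mulmxA (mulmxA Q) QQ mul1mx.
have c0 k : k \in ks -> exists b : bool,
    forall i, cj k i 0 = (-1) ^+ b * (i == 0)%:R.
  move=> ks_k.
  have [b kv] : exists b : bool, k *m v = (-1) ^+ b *: v.
    by case: (vP _ ks_k) => ->; [exists false | exists true];
      rewrite ?scale1r ?scaleN1r.
  exists b => i.
  have -> : cj k i 0 = (col 0 (cj k)) i 0 by rewrite [RHS]mxE.
  rewrite /cj -mulmxA !colM Q0 kv -scalemxAr -Q0 -colM QO.
  by rewrite !mxE.
clearbody cj; pose dr k := drsubmx (cj k).
have col0 k : k \in ks -> exists b : bool,
    cj k = block_mx ((-1) ^+ b)%:M 0 0 (dr k).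
  move=> ks_k; have [b cb] := c0 k ks_k; exists b.
  have r0 i : cj k 0 i = (-1) ^+ b * (i == 0)%:R.
    by rewrite -(cb i) -{1}(cjT k (kT _ ks_k)) [LHS]mxE.
  rewrite -[LHS](@submxK _ 1 n 1 n); congr block_mx; apply/matrixP => i j; rewrite !mxE ?ord1.
  + by rewrite !lshift0 cb eqxx mulr1.
  + by rewrite lshift0 r0 mulr0.
  + by rewrite lshift0 cb mulr0.
have drM k l : k \in ks -> l \in ks -> dr (k *m l) = dr k *m dr l.
  move=> /col0 [b kE] /col0 [c lE]; rewrite {1}/dr cjM kE lE.
  by rewrite mulmx_block block_mxKdr mul0mx add0r.
have [|||Q1 Q1O Q1P] := IHn (map dr ks).
- by move=> _ /mapP [k ks_k ->]; rewrite /dr trmx_drsub cjT // kT.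
- move=> _ /mapP [k ks_k ->]; rewrite -drM // kk // /dr cj1.
  by rewrite scalar_mx_block block_mxKdr.
- by move=> _ _ /mapP [k ks_k ->] /mapP [l ls ->]; rewrite -!drM // kC.
pose Q2 : 'M[R]_n.+1 := block_mx (1%:M : 'M_1) 0 0 Q1.
have Q2O : orthogonal Q2.
  rewrite /orthogonal /Q2.
  have := @tr_block_mx R 1 n 1 n 1%:M 0 0 Q1; rewrite !trmx0 trmx1 => ->.
  rewrite (@mulmx_block R 1 n 1 n 1 n) !mulmx0 !mul0mx mulmx1 !addr0 add0r Q1O.
  by rewrite -scalar_mx_block.
exists (Q *m Q2); first exact: orthogonalM.
move=> k i ks_k.
suff : cj k *m col i Q2 = col i Q2 \/ cj k *m col i Q2 = - col i Q2.
  by rewrite colM kQ => -[->|->]; rewrite ?mulmxN; [left|right].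
have [b kE] := col0 k ks_k; rewrite {}kE /Q2.
case: (@split_ordP 1 n i) => j ->.
  have -> : col (lshift n j) (block_mx (1%:M : 'M_1) 0 0 Q1) =
      col_mx (1%:M : 'M_1) 0 :> 'cV_(1+n).
    rewrite colE; apply/matrixP => k' l; rewrite -colE !mxE ord1.
    case: split_ordP => k1 _; rewrite !mxE; case: split_ordP => l1 /eqP;
     rewrite ?eq_lshift ?eq_lrshift // => /eqP <-; rewrite ?mxE ?ord1 //.
  rewrite (@mul_block_col R 1 n 1 n 1) mulmx0 mulmx0 mul0mx !addr0 mul_scalar_mx.
  case: b.
    by right; rewrite scaleN1r (@opp_col_mx _ 1 n 1) oppr0.
  by left; rewrite scale1r.
have -> : col (rshift 1 j) (block_mx (1%:M : 'M_1) 0 0 Q1) =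
      col_mx (0 : 'M_1) (col j Q1) :> 'cV_(1+n).
  apply/matrixP => k' l; rewrite !mxE ord1.
  case: split_ordP => k1 _; rewrite !mxE; case: split_ordP => l1 /eqP;
     rewrite ?eq_rshift ?eq_rlshift // => /eqP <-; rewrite ?mxE ?ord1 //.
rewrite (@mul_block_col R 1 n 1 n 1) !mulmx0 !mul0mx addr0 add0r.
have [->|->] := Q1P (dr k) j (map_f _ ks_k); first by left.
by right; rewrite (@opp_col_mx _ 1 n 1) oppr0.
Qed.

End Diagonalization.

(** * The centre of the Clifford algebra *)

Section Clifford.
Context {R : realType} {n : nat}.
Implicit Types (x y : clifford R n) (A B C : {set 'I_n}) (u v w : 'cV[R]_n).

Lemma clifford_sign_swap A B : clifford_sign R A B =
  (-1) ^+ (#|A| * #|B| + #|A :&: B|) * clifford_sign R B A.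
Proof.
have E : clifford_sign R A B * clifford_sign R B A =
    (-1) ^+ (#|A| * #|B| + #|A :&: B|).
  rewrite !clifford_sign_prod [X in _ * X]exchange_big /= -big_split /=.
  have -> : #|A :&: B| = (\sum_(i in A) (i \in B))%N.
    rewrite -sum1_card big_mkcond [RHS]big_mkcond /=; apply: eq_bigr => i _.
    by rewrite inE; case: (i \in A); case: (i \in B).
  rewrite -sum_nat_const -big_split /= expr_sum; apply: eq_bigr => i _.
  rewrite -big_split /= exprD -[in RHS]sum1_card expr_sum.
  have -> : (-1) ^+ (i \in B) = \prod_(j in B) (-1) ^+ (i == j) :> R.
    case: (boolP (i \in B)) => iB.
      rewrite (bigD1 i) //= eqxx big1 ?mulr1 // => j /andP[_ /negbTE ji].
      by rewrite eq_sym ji.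
    rewrite big1 // => j jB; case: eqP => // ij; by rewrite ij jB in iB.
  rewrite -big_split /=; apply: eq_bigr => j _.
  rewrite -val_eqE /=; case: (ltngtP i j) => _ /=; rewrite ?expr0 ?expr1; ring.
by rewrite -E -mulrA clifford_sign_sqr mulr1.
Qed.

Lemma mul_basis x B C :
  (x * clifford_basis B) C = clifford_sign R (symdiff C B) B * (x (symdiff C B) : R).
Proof.
rewrite [LHS]clifford_mulE (bigD1 (symdiff C B)) //= big1 ?addr0.
  have -> : symdiff (symdiff C B) C = B by rewrite symdiffC symdiffK.
  by rewrite ffunE eqxx mulr1.
move=> A AC; rewrite ffunE; case: eqP => [E|_]; last by rewrite mulr0.
by case/eqP: AC; rewrite -E (symdiffC A) symdiffK.
Qed.

Lemma basis_mul x B C :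
  (clifford_basis B * x) C = clifford_sign R B (symdiff B C) * (x (symdiff B C) : R).
Proof.
rewrite [LHS]clifford_mulE (bigD1 B) //= big1 ?addr0; last first.
  by move=> A /negbTE AB; rewrite ffunE AB mulr0 mul0r.
by rewrite ffunE eqxx mulr1.
Qed.

Lemma basis_swap A B : clifford_basis A * clifford_basis B =
  (-1) ^+ (#|A| * #|B| + #|A :&: B|) *: (clifford_basis B * clifford_basis A)
  :> clifford R n.
Proof.
by rewrite !clifford_basisM clifford_sign_swap scalerA symdiffC.
Qed.

(** An element commuting with all generators is a scalar: a nonempty A is
    either of even size, and then e_A anticommutes with e_i for i in A, or of
    odd size, and then it anticommutes with e_i for i outside A. *)
Lemma clifford_center x : ~~ odd n ->
  (forall i, x * clifford_gen i = clifford_gen i * x) -> x = x finset.set0 *: 1.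
Proof.
move=> n_even xC; apply/ffunP => A; rewrite ffunE.
have [->|/set0Pn[a aA]] := eqVneq A finset.set0.
  by rewrite [(1 : clifford R n) _]ffunE eqxx [RHS]mulr1.
have A0 : A != finset.set0 by apply/set0Pn; exists a.
rewrite [(1 : clifford R n) _]ffunE (negbTE A0) [RHS]mulr0.
have [i iP] : exists i, odd (#|A| + (i \in A)).
  case: (boolP (odd #|A|)) => oA; last by exists a; rewrite aA addn1 /= oA.
  case: (pickP [predC A]) => [i /= iA|AT]; first by exists i; rewrite (negbTE iA) addn0.
  case/negP: n_even; rewrite -(card_ord n) -cardsT.
  suff <- : A = [set: 'I_n]%SET by [].
  by apply/setP => i; rewrite inE; move: (AT i) => /= /negbFE ->.
have := xC i => /ffunP /(_ (symdiff A [set i]%SET)).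
rewrite /clifford_gen mul_basis basis_mul.
have -> : symdiff (symdiff A [set i]%SET) [set i]%SET = A.
  by rewrite -symdiffA symdiffss symdiffs0.
have -> : symdiff [set i]%SET (symdiff A [set i]%SET) = A.
  by rewrite (symdiffC A) symdiffK.
rewrite clifford_sign_swap cards1 muln1.
have -> : #|A :&: [set i]%SET| = (i \in A).
  case: (boolP (i \in A)) => iA.
    by rewrite (finset.setIidPr _) ?cards1 // finset.sub1set.
  apply/eqP; rewrite cards_eq0; apply/eqP/setP => j; rewrite !inE.
  by case: eqP => [->|]; rewrite ?(negbTE iA) ?andbF.
rewrite -signr_odd iP expr1 mulN1r mulNr => E.
have {E} : clifford_sign R [set i]%SET A * (x A : R) = 0.
  by apply: (mulfI (_ : 2 != 0 :> R)); rewrite ?pnatr_eq0 // mulr0 -[in LHS]mulr_natl; move: E; lra.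
move=> /(congr1 (fun z => clifford_sign R [set i]%SET A * z)).
by rewrite mulrA clifford_sign_sqr mul1r mulr0.
Qed.

Definition cvec v : clifford R n := clifford_vec v^T.

Lemma cvecE v : cvec v = \sum_i v i 0 *: clifford_gen i.
Proof. by apply: eq_bigr => i _; rewrite mxE. Qed.

Lemma cvecD u v : cvec (u + v) = cvec u + cvec v.
Proof.
by rewrite !cvecE -big_split; apply: eq_bigr => i _; rewrite mxE scalerDl.
Qed.

Lemma cvecZ (a : R) v : cvec (a *: v) = a *: cvec v.
Proof.
by rewrite !cvecE scaler_sumr; apply: eq_bigr => i _; rewrite mxE scalerA.
Qed.

Lemma cvecN v : cvec (- v) = - cvec v.
Proof. by rewrite -scaleN1r cvecZ scaleN1r. Qed.

Lemma cvec_delta i : cvec (delta_mx i 0) = clifford_gen i.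
Proof.
rewrite cvecE (bigD1 i) //= big1 ?addr0 ?mxE ?eqxx ?scale1r // => j /negbTE ji.
by rewrite mxE ji scale0r.
Qed.

Lemma cvec_inj : injective cvec.
Proof.
have cv v i : cvec v [set i]%SET = v i 0.
  rewrite cvecE sum_ffunE (bigD1 i) //= big1 ?addr0.
    by rewrite !ffunE eqxx [LHS]mulr1.
  move=> j ji; rewrite !ffunE; case: eqP => [/set1_inj E|_]; last by rewrite [LHS]mulr0.
  by rewrite E eqxx in ji.
by move=> u v uv; apply/colP => i; rewrite -!cv uv.
Qed.

Lemma cvec_sqr v : cvec v * cvec v = - (dot v v *: 1).
Proof.
rewrite /cvec clifford_vec_sqr; congr (- (_ *: _)); rewrite dotE.
by apply: eq_bigr => i _; rewrite mxE expr2.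
Qed.

Lemma cvec_anti u v :
  cvec u * cvec v = - (cvec v * cvec u) - (2 * dot u v) *: 1.
Proof.
have := cvec_sqr (u + v); rewrite cvecD mulrDl !mulrDr !cvec_sqr.
rewrite !(dotDl, dotDr) (dotC v u) => E.
move: E; move: (cvec u * cvec v) (cvec v * cvec u) (1 : clifford R n).
move=> a b c E; apply/ffunP => A; move/ffunP/(_ A): E.
rewrite !ffunE /= /GRing.scale /=; lra.
Qed.

(** * Products of unit vectors *)

(** Left multiplication by a unit vector is an isometry for this inner product, which
    leaves only the signs among the scalars relating products of unit vectors. *)
Definition inner x y : R := \sum_A (x A : R) * y A.

Lemma innerZl (a : R) x y : inner (a *: x) y = a * inner x y.
Proof. by rewrite mulr_sumr; apply: eq_bigr => A _; rewrite clifford_scaleE mulrA. Qed.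

Lemma innerZr (a : R) x y : inner x (a *: y) = a * inner x y.
Proof.
by rewrite mulr_sumr; apply: eq_bigr => A _; rewrite clifford_scaleE mulrCA.
Qed.

Lemma inner_gen i x y : inner (clifford_gen i * x) y = - inner x (clifford_gen i * y).
Proof.
have iso z t : inner (clifford_gen i * z) (clifford_gen i * t) = inner z t.
  rewrite /inner (reindex (symdiff [set i]%SET)) /=; last first.
    by exists (symdiff [set i]%SET) => B _; rewrite symdiffK.
  apply: eq_bigr => A _; rewrite /clifford_gen !basis_mul !symdiffK.
  by rewrite mulrACA clifford_sign_sqr mul1r.
rewrite -[in RHS]iso mulrA clifford_gen_sqr mulN1r.
by rewrite -[in RHS]scaleN1r innerZr mulN1r opprK.
Qed.

Lemma inner_cvec v x y : inner (cvec v * x) y = - inner x (cvec v * y).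
Proof.
have D (I : finType) (F : I -> clifford R n) z :
  (inner (\sum_i F i) z = \sum_i inner (F i) z) *
  (inner z (\sum_i F i) = \sum_i inner z (F i)).
  by split; rewrite exchange_big; apply: eq_bigr => A _;
    rewrite sum_ffunE (mulr_suml, mulr_sumr).
rewrite cvecE !mulr_suml !D -sumrN; apply: eq_bigr => i _.
by rewrite -!scalerAl innerZl innerZr inner_gen mulrN.
Qed.

Lemma unit_prod_norm b x : unit_prod b x -> inner x x = 1.
Proof.
case=> s [su _ ->]; elim: s su => [|v s IHs] su.
  rewrite big_nil /inner (bigD1 finset.set0) //= big1 ?addr0.
    by rewrite !ffunE eqxx mulr1.
  by move=> A /negbTE A0; rewrite !ffunE A0 mulr0.
rewrite big_cons -[v]trmxK -/(cvec _) inner_cvec mulrA cvec_sqr.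
rewrite mulNr -scalerAl mul1r -scaleNr innerZr mulNr opprK IHs ?mulr1; last first.
  by move=> w ws; apply: su; rewrite inE ws orbT.
rewrite dotE -[RHS](su v (mem_head _ _)).
by apply: eq_bigr => i _; rewrite !mxE expr2.
Qed.

Lemma unit_prod_scale b c x y (a : R) : unit_prod b x -> unit_prod c y ->
  x = a *: y -> a = 1 \/ a = -1.
Proof.
move=> /unit_prod_norm xx /unit_prod_norm yy xy; move: xx.
rewrite xy innerZl innerZr yy mulr1 => /eqP; rewrite -expr2 sqrf_eq1.
by case/orP => /eqP; [left|right].
Qed.

Lemma unit_prod_unit b x : unit_prod b x -> x \is a GRing.unit.
Proof. by move=> /unit_prod_inv[y [_ yx xy]]; apply/unitrP; exists y. Qed.

Lemma unit_neqN x : x \is a GRing.unit -> x <> - x.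
Proof.
move=> xU /eqP; rewrite -subr_eq0 opprK -mulr2n -scaler_nat scaler_eq0 pnatr_eq0 /=.
by move=> /eqP x0; rewrite x0 unitr0 in xU.
Qed.

Lemma unit_prodV b x : unit_prod b x -> unit_prod b x^-1.
Proof.
move=> xu; have xU := unit_prod_unit xu; have [y [yu _ xy]] := unit_prod_inv xu.
suff -> : x^-1 = y by [].
by apply: (mulrI xU); rewrite divrr.
Qed.

Lemma unit_prod_cvec v : dot v v = 1 -> unit_prod true (cvec v).
Proof.
move=> v1; apply: unit_prod_vec; rewrite /unit_vector -v1 dotE.
by apply: eq_bigr => i _; rewrite mxE expr2.
Qed.

(** * The action on vectors *)

(** This is the untwisted action: a unit vector acts as the opposite of a reflection. *)
Definition lifts x (M : 'M[R]_n) := forall v, x * cvec v = cvec (M *m v) * x.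

Lemma lifts1 : lifts 1 1%:M.
Proof. by move=> v; rewrite mul1mx mulr1 mul1r. Qed.

Lemma liftsM x y M N : lifts x M -> lifts y N -> lifts (x * y) (M *m N).
Proof. by move=> xM yN v; rewrite -mulrA yN mulrA xM -!mulrA mulmxA. Qed.

Lemma liftsZ (a : R) x M : lifts x M -> lifts (a *: x) M.
Proof. by move=> xM v; rewrite -scalerAl xM scalerAr. Qed.

Lemma liftsN x M : lifts x M -> lifts (- x) M.
Proof. by rewrite -scaleN1r; exact: liftsZ. Qed.

Lemma liftsV x M : x \is a GRing.unit -> orthogonal M -> lifts x M ->
  lifts x^-1 M^T.
Proof.
move=> xU MO xM v; apply: (mulrI xU); rewrite mulVKr // mulrA xM mulmxA.
by rewrite orthogonalC // mul1mx mulrK.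
Qed.

Lemma lifts_inj x M N : x \is a GRing.unit -> lifts x M -> lifts x N -> M = N.
Proof.
move=> xU xM xN; apply: mx_ext => v; apply: cvec_inj.
by apply: (mulIr xU); rewrite -xM -xN.
Qed.

Lemma lifts_cvec u : dot u u = 1 -> lifts (cvec u) (- reflection u).
Proof.
move=> u1 v; have uU : cvec u \is a GRing.unit.
  exact: (unit_prod_unit (unit_prod_cvec u1)).
rewrite mulNmx reflection_apply u1 divr1 cvecN cvecD cvecN cvecZ.
rewrite mulNr mulrBl -scalerAl cvec_sqr u1 scale1r cvec_anti.
by rewrite opprB scalerN addrC.
Qed.

Lemma lifts_unit_vectors (s : seq 'cV[R]_n) :
  (forall v, v \in s -> dot v v = 1) ->
  exists2 M, orthogonal M & lifts (\prod_(v <- s) cvec v) M.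
Proof.
elim: s => [|v s IHs] su.
  by exists 1%:M; [exact: orthogonal1 | rewrite big_nil; exact: lifts1].
have [|M MO sM] := IHs; first by move=> w ws; apply: su; rewrite inE ws orbT.
have v1 : dot v v = 1 by apply: su; rewrite mem_head.
exists (- reflection v *m M).
  apply/orthogonalM => //; apply/orthogonalN/reflection_orthogonal.
  by rewrite -dot_eq0 v1 oner_eq0.
by rewrite big_cons; apply: liftsM => //; exact: lifts_cvec.
Qed.

Lemma unit_prod_lifts b x : unit_prod b x -> exists2 M, orthogonal M & lifts x M.
Proof.
case=> s [su _ ->].
have [|M MO sM] := lifts_unit_vectors (s := [seq v^T | v : 'rV[R]_n <- s]).
  move=> _ /mapP[v vs ->]; rewrite dotE -[RHS](su v vs).
  by apply: eq_bigr => i _; rewrite !mxE expr2.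
exists M => //; move: sM; rewrite big_map.
by under eq_bigr => v _ do rewrite /cvec trmxK.
Qed.

(** The quotient of two lifts commutes with all vectors, hence is central. *)
Lemma lifts_scalar x y M : ~~ odd n -> y \is a GRing.unit -> orthogonal M ->
  lifts x M -> lifts y M -> exists a : R, x = a *: y.
Proof.
move=> n_even yU MO xM yM.
have c1 : lifts (y^-1 * x) 1%:M.
  by rewrite -MO; apply: liftsM => //; exact: liftsV.
exists ((y^-1 * x) finset.set0); apply: (mulrI (_ : y^-1 \is a GRing.unit)).
  by rewrite unitrV.
rewrite -scalerAr mulVr //; apply: clifford_center => // i.
by rewrite -cvec_delta c1 mul1mx.
Qed.

(** * Generation of the orthogonal group by reflections *)

(** One reflection after the other makes the matrix fix one more vector of the
    standard frame. *)
Lemma cartan_dieudonne M : orthogonal M ->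
  exists2 s : seq 'cV[R]_n, (forall v, v \in s -> dot v v = 1) &
    M = foldr (fun v N => reflection v *m N) 1%:M s.
Proof.
move=> MO; suff : forall m, (m <= n)%N -> forall M, orthogonal M ->
    (forall i : 'I_n, (i < n - m)%N -> M *m delta_mx i 0 = delta_mx i 0 :> 'cV_n) ->
    exists2 s : seq 'cV[R]_n, (forall v, v \in s -> dot v v = 1) &
    M = foldr (fun v N => reflection v *m N) 1%:M s.
  by move/(_ n (leqnn n) M MO); apply=> i; rewrite subnn.
elim=> [|m IHm] mn {}M {}MO Mfix.
  exists [::] => //=; apply/matrixP => i j.
  have := Mfix j; rewrite subn0 => /(_ (ltn_ord j)) /matrixP/(_ i 0).
  by rewrite -colE !mxE eqxx andbT.
have i0n : (n - m.+1 < n)%N by rewrite ltn_subrL /= (leq_trans _ mn).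
pose i0 := Ordinal i0n; pose e0 : 'cV[R]_n := delta_mx i0 0.
have step (N : 'M[R]_n) : N *m e0 = e0 ->
    (forall i : 'I_n, (i < n - m.+1)%N -> N *m delta_mx i 0 = delta_mx i 0 :> 'cV_n) ->
    forall i : 'I_n, (i < n - m)%N -> N *m delta_mx i 0 = delta_mx i 0 :> 'cV_n.
  move=> N0 Nfix i im; case: (ltngtP i (n - m.+1)) => [/Nfix //|im'|ii0].
    by move: im im'; lia.
  by have -> : i = i0 by exact: val_inj.
have [Me0|ne] := eqVneq (M *m e0) e0.
  by apply: IHm => //; [exact: ltnW | exact: step].
pose u := M *m e0 - e0.
have e01 : dot e0 e0 = 1.
  by have := orthogonal_col i0 i0 (@orthogonal1 R n); rewrite eqxx !colE !mul1mx.
have u0 : u != 0 by rewrite subr_eq0.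
have uM : reflection u *m (M *m e0) = e0.
  by rewrite reflection_swap // orthogonal_dot.
have [a a0 ua] := unit_scale u0.
have rE : reflection (a *: u) = reflection u.
  apply: mx_ext => v; rewrite !reflection_apply !dotZl !dotZr scalerA.
  congr (_ - _ *: _); have : dot u u != 0 by rewrite dot_eq0.
  by move=> d0; field; rewrite a0 d0.
have [||s su sE] := IHm (ltnW mn) (reflection u *m M).
- by apply: orthogonalM => //; exact: reflection_orthogonal.
- apply: step; first by rewrite -mulmxA.
  move=> i im; rewrite -mulmxA Mfix // reflection_apply.
  suff -> : dot u (delta_mx i 0) = 0 by rewrite mulr0 mul0r scale0r subr0.
  rewrite dotDl dotNl -{1}(Mfix i im) orthogonal_dot // subrr //.
exists (a *: u :: s) => [v|].
  by rewrite inE => /orP[/eqP -> //|/su].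
by rewrite /= -sE rE mulmxA reflectionK // mul1mx.
Qed.

End Clifford.

(** * Orthogonal matrices of order four *)

Section Quarter.
Context {R : rcfType} {n : nat}.
Implicit Types X Z : 'M[R]_n.

(** The algebra generated by X, when X ^ 4 = 1. *)
Definition quarter_comb X (a b c d : R) : 'M[R]_n :=
  a *: 1%:M + b *: X + c *: (X *m X) + d *: (X *m X *m X).

Lemma quarter_combM X a b c d a' b' c' d' : X *m X *m X *m X = 1%:M ->
  quarter_comb X a b c d *m quarter_comb X a' b' c' d' =
  quarter_comb X (a * a' + b * d' + c * c' + d * b')
    (a * b' + b * a' + c * d' + d * c') (a * c' + b * b' + c * a' + d * d')
    (a * d' + b * c' + c * b' + d * a').
Proof.
move=> X4; rewrite /quarter_comb !mulmxDl !mulmxDr -!scalemxAl -!scalemxAr !scalerA.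
rewrite !mulmx1 !mul1mx !mulmxA !X4 !mul1mx.
move: (X *m X *m X) (X *m X) (1%:M : 'M[R]_n) => X3 X2 X0.
by apply/matrixP => i j; rewrite !mxE; ring.
Qed.

Lemma quarter_comb_comm X Z a b c d : Z *m X = X *m Z ->
  Z *m quarter_comb X a b c d = quarter_comb X a b c d *m Z.
Proof.
move=> ZX; have ZX2 : Z *m (X *m X) = X *m X *m Z by rewrite mulmxA ZX -mulmxA ZX mulmxA.
rewrite /quarter_comb !mulmxDl !mulmxDr -!scalemxAl -!scalemxAr mulmx1 mul1mx ZX ZX2.
by rewrite mulmxA ZX2 -!mulmxA ZX.
Qed.

(** An orthogonal X with X ^ 4 = 1 is the product of an involution X1, which
    is -1 on the (-1)-eigenspace of X and 1 on its complement, and of the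
    square of S, which rotates by 45 degrees where X rotates by 90.  Both are
    polynomials in X, so that they commute with everything that X does. *)
Lemma quarter_decomposition X : orthogonal X -> X *m X *m X *m X = 1%:M ->
  exists X1 S, [/\ X1^T = X1, X1 *m X1 = 1%:M, orthogonal S, X = X1 *m (S *m S) &
    2 *: (1%:M - X1) = (1%:M - X) *m (1%:M + X *m X) /\
    forall Z, Z *m X = X *m Z -> Z *m X1 = X1 *m Z /\ Z *m S = S *m Z].
Proof.
move=> XO X4.
have XT : X^T = X *m X *m X by rewrite -[LHS]mulmx1 -X4 !mulmxA XO mul1mx.
have cT a b c d : (quarter_comb X a b c d)^T = quarter_comb X a d c b.
  have X2T : (X *m X)^T = X *m X.
    by rewrite trmx_mul XT !mulmxA -[RHS]mul1mx -X4 !mulmxA.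
  rewrite /quarter_comb !linearD !linearZ /= trmx1 X2T.
  have -> : (X *m X *m X)^T = X by rewrite -XT trmxK.
  by rewrite XT -!addrA; congr (_ + _); rewrite addrC -addrA addrCA.
pose r : R := (Num.sqrt 2)^-1.
have r2 : r * r = 2^-1 by rewrite -invfM -expr2 sqr_sqrtr ?ler0n.
have c1 : quarter_comb X 1 0 0 0 = 1%:M.
  by rewrite /quarter_comb !scale0r !addr0 scale1r.
have cX : quarter_comb X 0 1 0 0 = X.
  by rewrite /quarter_comb !scale0r !addr0 scale1r add0r.
exists (quarter_comb X 2^-1 2^-1 (- 2^-1) 2^-1).
exists (quarter_comb X (2^-1 + r / 2) (r / 2) (2^-1 - r / 2) (- (r / 2))).
split.
- by rewrite cT.
- by rewrite quarter_combM // -c1; congr quarter_comb; lra.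
- by rewrite /orthogonal cT quarter_combM // -c1; congr quarter_comb; lra.
- by rewrite !quarter_combM // -[LHS]cX; congr quarter_comb; lra.
split; last by move=> Z ZX; split; exact: quarter_comb_comm.
rewrite mulmxDr mulmx1 mulmxBl mul1mx mulmxA /quarter_comb.
move: (X *m X *m X) (X *m X) (1%:M : 'M[R]_n) => X3 X2 X0.
by apply/matrixP => i j; rewrite !mxE; lra.
Qed.

End Quarter.

(** * Lifts of orthogonal matrices *)

Section Pin12.
Context {R : realType}.
Implicit Types (x y z : clifford R 12) (A B : {set 'I_12}) (M : 'M[R]_12).

Lemma lifts_c : lifts (@c_elt R) (- 1%:M).
Proof.
by move=> v; rewrite mulNmx mul1mx cvecN mulNr /cvec vec_c_anti opprK.
Qed.

Lemma unit_prod_c_elt : unit_prod false (@c_elt R).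
Proof. exact/spin_unit_prod/c_elt_spin. Qed.

Lemma unit_prodN b x : unit_prod b x -> unit_prod b (- x).
Proof.
move=> xb; rewrite -mulN1r -(clifford_gen_sqr ord0).
apply: (@unit_prodM _ _ false) => //.
exact: (unit_prodM (unit_prod_gen _) (unit_prod_gen _)).
Qed.

Lemma unit_prod_parity x : unit_prod true x -> unit_prod false x -> False.
Proof.
move=> xt xf; have := unit_prod_c xt; rewrite (unit_prod_c xf) expr0 expr1 mul1r mulN1r.
exact/unit_neqN/(unit_prod_unit (unit_prodM unit_prod_c_elt xf)).
Qed.

(** A product of r unit vectors acts as (-1) ^ r times the product of the reflections;
    the sign is corrected by c, which acts as -1. *)
Lemma pin_lift M : orthogonal M -> exists b x, unit_prod b x /\ lifts x M.
Proof.
move=> MO; have [s su ->] := cartan_dieudonne MO.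
have [x [b [xb xM]]] : exists x b, unit_prod b x /\
    lifts x ((-1) ^+ size s *: foldr (fun v N => reflection v *m N) 1%:M s).
  elim: s su {MO M} => [|v s IHs] su.
    by exists 1, false; rewrite scale1r; split; [exact: unit_prod1|exact: lifts1].
  have [|x [b [xb xM]]] := IHs; first by move=> w ws; apply: su; rewrite inE ws orbT.
  have v1 : dot v v = 1 by apply: su; rewrite mem_head.
  exists (cvec v * x), (true (+) b); split.
    by apply: unit_prodM => //; exact: unit_prod_cvec.
  rewrite /= exprS mulN1r scaleNr -scalerN -mulNmx scalemxAr.
  by apply: liftsM => //; exact: lifts_cvec.
move: xM; rewrite -signr_odd; case: (odd _); last first.
  by rewrite expr0 scale1r => xM; exists b, x.
rewrite expr1 scaleN1r => xM; exists (b (+) false), (x * c_elt); split.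
  by apply: unit_prodM => //; exact: unit_prod_c_elt.
rewrite -[X in lifts _ X]opprK -[X in - X]mulmx1 -mulmxN.
by apply: liftsM => //; exact: lifts_c.
Qed.

(** Two lifts differ by a scalar, and both have norm 1. *)
Lemma lift_sign b c x y M : unit_prod b x -> unit_prod c y -> orthogonal M ->
  lifts x M -> lifts y M -> x = y \/ x = - y.
Proof.
move=> xb yc MO xM yM.
have [a xy] := lifts_scalar (n := 12) isT (unit_prod_unit yc) MO xM yM.
by have [a1|a1] := unit_prod_scale xb yc xy; rewrite xy a1 ?scale1r ?scaleN1r;
  [left|right].
Qed.

Lemma lift_comm_sign b c x y M N : unit_prod b x -> unit_prod c y ->
  orthogonal M -> orthogonal N -> lifts x M -> lifts y N ->
  M *m N = N *m M -> x * y = y * x \/ x * y = - (y * x).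
Proof.
move=> xb yc MO NO xM yN MN.
apply: (lift_sign (unit_prodM xb yc) (unit_prodM yc xb) (orthogonalM MO NO)).
  exact: liftsM.
by rewrite MN; exact: liftsM.
Qed.

Lemma comm_sign_sqr x y : x * y = y * x \/ x * y = - (y * x) ->
  x * (y * y) = y * y * x.
Proof.
by case=> E; rewrite mulrA E ?mulNr -!mulrA E ?mulrN ?opprK.
Qed.

(** * Lifts of diagonal matrices *)

Definition diagN A : 'M[R]_12 := \matrix_(i, j) ((i == j)%:R * (-1) ^+ (i \in A)).

Lemma diagN_delta A i :
  diagN A *m delta_mx i 0 = (-1) ^+ (i \in A) *: (delta_mx i 0 : 'cV_12).
Proof.
rewrite -colE; apply/colP => j; rewrite !mxE andbT.
by case: eqP => [->|_]; rewrite ?mul1r ?mulr1 ?mul0r ?mulr0.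
Qed.

Lemma lifts_delta x M : (forall i, x * clifford_gen i = cvec (M *m delta_mx i 0) * x) ->
  lifts x M.
Proof.
move=> xM v; have -> : v = \sum_i v i 0 *: (delta_mx i 0 : 'cV_12).
  apply/colP => j; rewrite summxE (bigD1 j) //= big1 ?mxE ?addr0; last first.
    by move=> i /negbTE ij; rewrite !mxE eq_sym ij mulr0.
  by rewrite ?mxE ?eqxx ?mulr1.
move: (fun i => v i 0) => f; rewrite mulmx_sumr.
have cs (F : 'I_12 -> 'cV[R]_12) : cvec (\sum_i F i) = \sum_i cvec (F i).
  have c0 : cvec 0 = 0 :> clifford R 12 by rewrite -[0 in LHS](scale0r 0) cvecZ scale0r.
  by elim/big_rec2: _ => // i a b _ <-; rewrite cvecD.
rewrite !cs mulr_sumr mulr_suml; apply: eq_bigr => i _.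
by rewrite -scalemxAr !cvecZ -scalerAr cvec_delta xM scalerAl.
Qed.

Lemma basis_unit_prod A : unit_prod (odd #|A|) (clifford_basis A : clifford R 12).
Proof.
have [m] := ubnP #|A|; elim: m A => // m IHm A Am.
have [->|/set0Pn[a aA]] := eqVneq A finset.set0.
  by rewrite cards0; exact: unit_prod1.
have Aa : (#|A :\ a| < m)%N by rewrite (cardsD1 a A) aA in Am.
have := unit_prodM (unit_prod_gen (n := 12) a) (IHm _ Aa).
rewrite clifford_basisM; have -> : symdiff [set a]%SET (A :\ a)%SET = A.
  apply/setP => i; rewrite !inE; case: eqP => [->|]; rewrite ?aA //.
have -> : true (+) odd #|A :\ a| = odd #|A|.
  by rewrite (cardsD1 a A) aA.
rewrite /clifford_sign -signr_odd; case: (odd #|[set _ | _]%SET|) => /=.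
  by rewrite ?expr1 scaleN1r => /unit_prodN; rewrite opprK.
by rewrite ?expr0 scale1r.
Qed.

Lemma lifts_basis A : lifts (clifford_basis A) ((-1) ^+ #|A| *: diagN A).
Proof.
apply: lifts_delta => i; rewrite /clifford_gen basis_swap cards1 muln1.
rewrite -scalemxAl diagN_delta !cvecZ cvec_delta -!scalerAl scalerA -exprD.
congr ((-1) ^+ (_ + _) *: _); case: (boolP (i \in A)) => iA.
  by rewrite (finset.setIidPr _) ?cards1 // finset.sub1set.
apply/eqP; rewrite cards_eq0; apply/eqP/setP => j; rewrite !inE.
by case: eqP => [->|]; rewrite ?(negbTE iA) ?andbF.
Qed.

(** Multiplying by c corrects the sign of the action of a monomial of odd size. *)
Definition diag_lift A : clifford R 12 := clifford_basis A * c_elt ^+ odd #|A|.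

Lemma diag_lift_unit_prod A : unit_prod (odd #|A|) (diag_lift A).
Proof.
rewrite -[odd _]addbF; apply: unit_prodM; first exact: basis_unit_prod.
by case: (odd _) => /=; [exact: unit_prod_c_elt | exact: unit_prod1].
Qed.

Lemma lifts_diagN A : lifts (diag_lift A) (diagN A).
Proof.
have := lifts_basis A; rewrite /diag_lift -signr_odd; case: (odd _) => /=.
  rewrite !expr1 scaleN1r => E.
  have -> : diagN A = - diagN A *m - 1%:M by rewrite mulNmx mulmxN mulmx1 opprK.
  by apply: liftsM => //; exact: lifts_c.
by rewrite !expr0 mulr1 scale1r.
Qed.

Lemma frame_diagN (Q M : 'M[R]_12) : orthogonal Q ->
  (forall i, M *m col i Q = col i Q \/ M *m col i Q = - col i Q) ->
  M = Q *m diagN [set i | M *m col i Q == - col i Q]%SET *m Q^T.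
Proof.
move=> QO MQ; apply: (frame_ext QO) => i.
have -> : Q *m diagN [set i | M *m col i Q == - col i Q]%SET *m Q^T *m col i Q =
    Q *m (diagN [set i | M *m col i Q == - col i Q]%SET *m (Q^T *m col i Q)).
  by rewrite !mulmxA.
rewrite -[Q^T *m _]colM QO colE mul1mx diagN_delta -scalemxAr inE -colE.
by case: (MQ i) => ->; rewrite ?eqxx ?frame_neqN // ?expr1 ?scaleN1r ?expr0 ?scale1r.
Qed.

Lemma frame_lift (Q : 'M[R]_12) q A : orthogonal Q -> q \is a GRing.unit -> lifts q Q ->
  lifts (q * diag_lift A * q^-1) (Q *m diagN A *m Q^T).
Proof.
move=> QO qU qQ; apply: liftsM; last exact: liftsV.
by apply: liftsM => //; exact: lifts_diagN.
Qed.

(** Elements of Spin(12) that commute have even-dimensional common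
    (-1)-eigenspaces.  In the factorizations of the two elements, the squares
    commute with everything, because lifts of commuting matrices commute up to
    sign; so the involutive parts commute as well, and those are conjugate to
    monomials e_A and e_B with A of even size, whose commutator is
    (-1) ^ #|A :&: B|. *)
Lemma commuting_parity x z X Z : unit_prod false x -> unit_prod false z ->
  lifts x X -> lifts z Z -> orthogonal X -> orthogonal Z ->
  X *m X *m X *m X = 1%:M -> Z *m Z *m Z *m Z = 1%:M ->
  X *m Z = Z *m X -> x * z = z * x ->
  exists2 d, ~~ odd d &
    \tr ((1%:M - X) *m (1%:M + X *m X) *m ((1%:M - Z) *m (1%:M + Z *m Z))) = (16 * d)%:R.
Proof.
move=> xu zu xX zZ XO ZO X4 Z4 XZ xz.
have [X1 [S [X1T X1X1 SO XE [X1E XC]]]] := quarter_decomposition XO X4.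
have [Z1 [T [Z1T Z1Z1 TO ZE [Z1E ZC]]]] := quarter_decomposition ZO Z4.
have [ZX1 ZS] := XC _ (esym XZ).
have [XZ1 XT] := ZC _ XZ.
have [X1Z1 X1T'] := ZC _ (esym ZX1).
have [SZ1 ST] := ZC _ (esym ZS).
have [|||Q QO QP] := @simultaneous_diagonalization R 12 [:: X1; Z1].
- by move=> k; rewrite !inE => /orP[] /eqP ->.
- by move=> k; rewrite !inE => /orP[] /eqP ->.
- by move=> k l; rewrite !inE => /orP[] /eqP -> /orP[] /eqP ->.
have X1Q i : X1 *m col i Q = col i Q \/ X1 *m col i Q = - col i Q.
  by apply: QP; rewrite inE eqxx.
have Z1Q i : Z1 *m col i Q = col i Q \/ Z1 *m col i Q = - col i Q.
  by apply: QP; rewrite !inE eqxx orbT.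
have X1D := frame_diagN QO X1Q; have Z1D := frame_diagN QO Z1Q.
set A := [set i | _]%SET in X1D; set B := [set i | _]%SET in Z1D.
have [bq [q [qu qQ]]] := pin_lift QO; have qU := unit_prod_unit qu.
have [bs [s [su sS]]] := pin_lift SO; have [bt [t [tu tT]]] := pin_lift TO.
pose x1 := q * diag_lift A * q^-1; pose z1 := q * diag_lift B * q^-1.
have conj_unit_prod (C : {set 'I_12}) : unit_prod (odd #|C|) (q * diag_lift C * q^-1).
  have := unit_prodM (unit_prodM qu (diag_lift_unit_prod C)) (unit_prodV qu).
  by rewrite addbAC addbb.
have x1X : lifts x1 X1 by rewrite X1D; exact: frame_lift.
have z1Z : lifts z1 Z1 by rewrite Z1D; exact: frame_lift.
have X1O : orthogonal X1 by rewrite /orthogonal X1T.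
have Z1O : orthogonal Z1 by rewrite /orthogonal Z1T.
have sz1 := comm_sign_sqr (lift_comm_sign (conj_unit_prod B) su Z1O SO z1Z sS (esym SZ1)).
have tx1 := comm_sign_sqr (lift_comm_sign (conj_unit_prod A) tu X1O TO x1X tT X1T').
have ts := comm_sign_sqr (lift_comm_sign tu su TO SO tT sS (esym ST)).
have tts : t * t * (s * s) = s * s * (t * t) by rewrite -mulrA ts mulrA ts mulrA.
have xu1 : unit_prod (odd #|A|) (x1 * (s * s)).
  rewrite -[odd _]addbF -(addbb bs).
  by apply: unit_prodM; [exact: conj_unit_prod | exact: unit_prodM].
have zu1 : unit_prod (odd #|B|) (z1 * (t * t)).
  rewrite -[odd _]addbF -(addbb bt).
  by apply: unit_prodM; [exact: conj_unit_prod | exact: unit_prodM].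
have xE : x = x1 * (s * s) \/ x = - (x1 * (s * s)).
  apply: (lift_sign xu xu1 XO xX); rewrite XE.
  by apply: liftsM => //; exact: liftsM.
have zE : z = z1 * (t * t) \/ z = - (z1 * (t * t)).
  apply: (lift_sign zu zu1 ZO zZ); rewrite ZE.
  by apply: liftsM => //; exact: liftsM.
have A_even : ~~ odd #|A|.
  apply/negP => oA; rewrite oA in xu1; apply: (unit_prod_parity xu1).
  by case: xE => xE; [rewrite -xE | rewrite -[_ * _]opprK -xE; exact: unit_prodN].
have xz' : x1 * (s * s) * (z1 * (t * t)) = z1 * (t * t) * (x1 * (s * s)).
  by case: xE zE => xE [] zE; move: xz; rewrite xE zE ?mulrNN // mulrN mulNr; exact: oppr_inj.
have x1z1 : x1 * z1 = z1 * x1.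
  have sstt : s * s * (t * t) \is a GRing.unit.
    have sU := unit_prod_unit su; have tU := unit_prod_unit tu.
    by rewrite !unitrMr.
  apply: (mulIr sstt).
  transitivity (x1 * (s * s) * (z1 * (t * t))).
    by rewrite -(mulrA x1 (s * s)) (mulrA (s * s) z1) -sz1 !mulrA.
  rewrite xz' -(mulrA z1) (mulrA (t * t)) -tx1 -(mulrA x1) tts.
  by rewrite !mulrA.
have AB_even : ~~ odd #|A :&: B|%SET.
  have eAU (C : {set 'I_12}) : clifford_basis C \is a @GRing.unit (clifford R 12).
    exact: unit_prod_unit (basis_unit_prod C).
  apply/negP => oAB.
  have : x1 * z1 = - (z1 * x1).
    have := basis_swap (R := R) A B.
    rewrite -signr_odd oddD oddM (negbTE A_even) /= oAB expr1 scaleN1r => E.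
    have {}E : diag_lift A * diag_lift B = - (diag_lift B * diag_lift A).
      rewrite /diag_lift (negbTE A_even) expr0 mulr1 mulrA E mulNr -!mulrA.
      congr (- (_ * _)); case: (odd _); rewrite ?expr0 ?mulr1 ?mul1r // expr1.
      by rewrite (unit_prod_c (basis_unit_prod A)) (negbTE A_even) expr0 mul1r.
    rewrite /x1 /z1; move: (diag_lift A) (diag_lift B) E => a b E.
    by rewrite !mulrA !mulrVK // -(mulrA q a) E mulrN mulNr !mulrA.
  rewrite x1z1; apply: unit_neqN.
  exact: unit_prod_unit (unit_prodM (conj_unit_prod B) (conj_unit_prod A)).
exists #|A :&: B|%SET => //.
rewrite -X1E -Z1E -scalemxAl -scalemxAr scalerA mxtraceZ (frame_trace _ QO).
have term i : dot (col i Q) ((1%:M - X1) *m (1%:M - Z1) *m col i Q) =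
    4 * (i \in (A :&: B)%SET)%:R.
  have ne := frame_neqN i QO.
  have dd : dot (col i Q) (col i Q) = 1 by rewrite orthogonal_col // eqxx.
  have sub M v : (1%:M - M) *m v = v - M *m v :> 'cV_12 by rewrite mulmxBl mul1mx.
  have dot0 v : dot v (0 : 'cV[R]_12) = 0 by rewrite /dot mulmx0 mxE.
  rewrite -mulmxA (sub Z1) !inE.
  case: (Z1Q i) => ->; rewrite ?eqxx ?ne ?andbF.
    by rewrite subrr mulmx0 dot0 mulr0.
  rewrite opprK sub mulmxDr.
  case: (X1Q i) => ->; rewrite ?eqxx ?ne.
    by rewrite subrr dot0 mulr0.
  rewrite opprD !opprK !dotDr dd /= mulr1; ring.
rewrite (eq_bigr _ (fun i _ => term i)) -mulr_sumr -natr_sum.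
have -> : (\sum_(i < 12) (i \in (A :&: B)%SET) = #|A :&: B|%SET)%N.
  by rewrite -sum1_card [RHS]big_mkcond; apply: eq_bigr => i _; case: (_ \in _).
by rewrite mulrA natrM; congr (_ * _); ring.
Qed.

End Pin12.

(** * Projectors and their ranks *)

Section Projectors.
Context {R : rcfType} {n : nat}.
Implicit Types (P E X Y Z W M : 'M[R]_n) (u v w : 'cV[R]_n).

Definition projector P := P^T = P /\ P *m P = P.

Lemma projectorM P E : projector P -> projector E -> P *m E = E *m P ->
  projector (P *m E).
Proof.
move=> [PT PP] [ET EE] PE; split; first by rewrite trmx_mul ET PT PE.
by rewrite -mulmxA (mulmxA E) -PE -mulmxA EE mulmxA PP.
Qed.

(** The projector on the (-1) ^ b-eigenspace of an involution. *)
Definition half (b : bool) E : 'M[R]_n := 2^-1 *: (1%:M + (-1) ^+ b *: E).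

Lemma half_projector b E : E^T = E -> E *m E = 1%:M -> projector (half b E).
Proof.
move=> ET EE; split; first by rewrite linearZ /= linearD /= linearZ /= trmx1 ET.
rewrite /half -scalemxAl -scalemxAr scalerA mulmxDl !mulmxDr !mulmx1 !mul1mx.
rewrite -scalemxAl -scalemxAr scalerA EE -signr_addb addbb expr0 scale1r.
rewrite [X in _ + X]addrC -mulr2n -scaler_nat scalerA; congr (_ *: _); lra.
Qed.

Lemma half_comm b E M : M *m E = E *m M -> M *m half b E = half b E *m M.
Proof.
move=> ME; rewrite /half -scalemxAl -scalemxAr mulmxDl mulmxDr mulmx1 mul1mx.
by rewrite -scalemxAl -scalemxAr ME.
Qed.

Lemma half_mul b E : E *m E = 1%:M -> E *m half b E = (-1) ^+ b *: half b E.
Proof.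
move=> EE; rewrite /half -scalemxAr mulmxDr mulmx1 -scalemxAr EE.
rewrite [RHS]scalerA [_ * 2^-1]mulrC -[RHS]scalerA; congr (_ *: _).
rewrite scalerDr scalerA.
by rewrite -signr_addb addbb expr0 scale1r addrC.
Qed.

Lemma trace_anticommute U M : orthogonal U -> U *m M = - (M *m U) -> \tr M = 0.
Proof.
move=> UO UM; have E : \tr M = - \tr M.
  rewrite -{1}[M]mul1mx -UO -mulmxA UM mulmxN linearN /= mxtrace_mulC -mulmxA.
  by rewrite orthogonalC // mulmx1.
by lra.
Qed.

(** U exchanges the two eigenspaces of X and preserves the image of P. *)
Lemma half_trace b P X U : orthogonal U -> U *m X = - (X *m U) -> U *m P = P *m U ->
  \tr (P *m half b X) = 2^-1 * \tr P.
Proof.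
move=> UO UX UP; rewrite /half -scalemxAr mulmxDr mulmx1 -scalemxAr mxtraceZ.
rewrite linearD /= mxtraceZ (trace_anticommute (M := P *m X) UO) ?mulr0 ?addr0 //.
by rewrite mulmxA UP -!mulmxA UX mulmxN.
Qed.

(** The trace of a projector is its rank. *)
Lemma projector_trace P : projector P -> exists m : nat, \tr P = m%:R.
Proof.
move=> [PT PP]; pose E := 2 *: P - 1%:M.
have ET : E^T = E by rewrite linearB linearZ /= trmx1 PT.
have EE : E *m E = 1%:M.
  rewrite /E mulmxBl !mulmxBr mulmx1 mul1mx mulmx1 -scalemxAl -scalemxAr PP.
  by apply/matrixP => i j; rewrite !mxE; lra.
have [|||Q QO QP] := @simultaneous_diagonalization R n [:: E].
- by move=> k; rewrite inE => /eqP ->.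
- by move=> k; rewrite inE => /eqP ->.
- by move=> k l; rewrite !inE => /eqP -> /eqP ->.
exists (\sum_i (E *m col i Q == col i Q))%N.
rewrite (frame_trace _ QO) natr_sum; apply: eq_bigr => i _.
have PE : P *m col i Q = 2^-1 *: (col i Q + E *m col i Q).
  rewrite mulmxBl mul1mx addrC subrK -scalemxAl scalerA mulVf ?scale1r //.
  by rewrite pnatr_eq0.
have dd : dot (col i Q) (col i Q) = 1 by rewrite orthogonal_col // eqxx.
have [Ei|Ei] := QP E i (mem_head _ _); rewrite PE Ei.
  by rewrite eqxx dotZr dotDr dd mulr1n; lra.
rewrite subrr dotZr /dot mulmx0 mxE mulr0; case: eqP => // cE.
have : 2 *: col i Q = 0 by rewrite scaler_nat mulr2n -{1}cE addNr.
move=> /eqP; rewrite scaler_eq0 pnatr_eq0 /= => /eqP c0.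
by move: dd; rewrite c0 /dot mulmx0 mxE => /eqP; rewrite eq_sym oner_eq0.
Qed.

Definition outer_sum (I : finType) (u : I -> 'cV[R]_n) : 'M[R]_n :=
  \sum_a u a *m (u a)^T.

Lemma outer_sum_projector (I : finType) (u : I -> 'cV[R]_n) :
  (forall a b, dot (u a) (u b) = (a == b)%:R) ->
  projector (outer_sum u) /\ \tr (outer_sum u) = #|I|%:R.
Proof.
move=> uO; split; first split.
- by rewrite /outer_sum linear_sum; apply: eq_bigr => a _; rewrite /= trmx_mul trmxK.
- rewrite {1}/outer_sum mulmx_suml; apply: eq_bigr => a _.
  rewrite mulmx_sumr (bigD1 a) //= big1 ?addr0.
    by rewrite mulmxA mul_outer uO eqxx scale1r.
  by move=> b /negbTE ba; rewrite mulmxA mul_outer uO eq_sym ba scale0r mul0mx.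
rewrite /outer_sum linear_sum /= (eq_bigr (fun=> 1)) => [|a _].
  by rewrite sumr_const.
by rewrite tr_outer uO eqxx.
Qed.

(** The quaternion action of X and Y makes the dimension of the image of P a
    multiple of 4: for a unit vector w in the image, w, X w, Y w, X Y w are
    orthonormal and span an invariant subspace, which can be split off. *)
Lemma quaternionic_trace P X Y : projector P -> orthogonal X -> orthogonal Y ->
  X *m P = P *m X -> Y *m P = P *m Y -> X *m Y = - (Y *m X) ->
  X *m X *m P = - P -> Y *m Y *m P = - P -> exists m : nat, \tr P = (4 * m)%:R.
Proof.
move=> PP XO YO XP YP XY XX YY; have [t trP] := projector_trace PP.
have [k] := ubnP t; elim: k t P PP XP YP XX YY trP => // k IHk t P [PT PP] XP YP XX YY trP tk.
have [->|P0] := eqVneq P 0; first by exists 0%N; rewrite mxtrace0.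
have [v Pv] : exists v, P *m v != 0.
  apply/not_existsP => P0'; case/eqP: P0; apply: mx_ext => v; rewrite mul0mx.
  by apply/eqP/negPn/negP; exact: P0'.
have [a a0] := unit_scale Pv; set w := a *: _ => w1.
have Pw : P *m w = w by rewrite -scalemxAr mulmxA PP.
have Xin u : P *m u = u -> P *m (X *m u) = X *m u by move=> Pu; rewrite mulmxA -XP -mulmxA Pu.
have Yin u : P *m u = u -> P *m (Y *m u) = Y *m u by move=> Pu; rewrite mulmxA -YP -mulmxA Pu.
have X2 u : P *m u = u -> X *m (X *m u) = - u.
  by move=> Pu; rewrite -{1}Pu !mulmxA XX mulNmx Pu.
have Y2 u : P *m u = u -> Y *m (Y *m u) = - u.
  by move=> Pu; rewrite -{1}Pu !mulmxA YY mulNmx Pu.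
have YX u : Y *m (X *m u) = - (X *m (Y *m u)) by rewrite !mulmxA XY mulNmx opprK.
have Xd u v' : P *m u = u -> dot u (X *m v') = - dot (X *m u) v'.
  by move=> Pu; rewrite -(orthogonal_dot (X *m u) v' XO) X2 // dotNl opprK.
have Yd u v' : P *m u = u -> dot u (Y *m v') = - dot (Y *m u) v'.
  by move=> Pu; rewrite -(orthogonal_dot (Y *m u) v' YO) Y2 // dotNl opprK.
have PX := Xin w Pw; have PY := Yin w Pw; have PXY := Xin _ PY.
have wX : dot w (X *m w) = 0 by have := Xd w w Pw; rewrite (dotC (X *m w)); lra.
have wY : dot w (Y *m w) = 0 by have := Yd w w Pw; rewrite (dotC (Y *m w)); lra.
have wXY : dot w (X *m (Y *m w)) = 0.
  have := Xd w (Y *m w) Pw; have := Yd (X *m w) w PX; rewrite YX dotNl (dotC _ w); lra.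
have XwYw : dot (X *m w) (Y *m w) = 0 by have := Xd w (Y *m w) Pw; rewrite wXY; lra.
pose u (j : 'I_4) := nth 0 [:: w; X *m w; Y *m w; X *m (Y *m w)] j.
have uO i j : dot (u i) (u j) = (i == j)%:R.
  have YwXY : dot (Y *m w) (X *m (Y *m w)) = 0.
    by have := Xd (Y *m w) (Y *m w) PY; rewrite (dotC (X *m _)); lra.
  have XwXY : dot (X *m w) (X *m (Y *m w)) = 0 by rewrite orthogonal_dot.
  have dC (p q : 'cV[R]_n) : dot p q = 0 -> dot q p = 0 by rewrite dotC.
  by case: i j => [[|[|[|[|//]]]] ?] [[|[|[|[|//]]]] ?] //=; rewrite /u /= ?orthogonal_dot ?w1 //;
    exact: dC.
have [[RT RR] trR] := outer_sum_projector uO; set S := outer_sum u in RT RR trR.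
have SE : S = w *m w^T + X *m w *m (X *m w)^T + Y *m w *m (Y *m w)^T
    + X *m (Y *m w) *m (X *m (Y *m w))^T.
  by rewrite /S /outer_sum !big_ord_recl big_ord0 addr0 !addrA.
have Pq (p q : 'cV[R]_n) : P *m p = p -> P *m (p *m q^T) = p *m q^T.
  by move=> Pp; rewrite mulmxA Pp.
have PS : P *m S = S by rewrite SE !mulmxDr !Pq.
have SP : S *m P = S by rewrite -[LHS]trmxK trmx_mul PT RT PS.
have comS Z : orthogonal Z -> Z *m S *m Z^T = S -> Z *m S = S *m Z.
  by move=> ZO ZS; rewrite -{2}ZS -mulmxA ZO mulmx1.
have conj Z (p q : 'cV[R]_n) : Z *m (p *m q^T) *m Z^T = (Z *m p) *m (Z *m q)^T.
  by rewrite trmx_mul !mulmxA.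
have nn (p : 'cV[R]_n) : (- p) *m (- p)^T = p *m p^T.
  by rewrite [(- p)^T]linearN mulNmx mulmxN opprK.
have XS : X *m S = S *m X.
  apply: comS => //; rewrite SE !mulmxDr !mulmxDl !conj !X2 // !nn.
  by apply/matrixP => i j; move: (_ *m _^T) (_ *m _^T) => A B; rewrite !mxE; ring.
have YS : Y *m S = S *m Y.
  apply: comS => //; rewrite SE !mulmxDr !mulmxDl !conj !YX !Y2 // !mulmxN !opprK !nn.
  by apply/matrixP => i j; rewrite !mxE; ring.
have [m trm] : exists m : nat, \tr (P - S) = (4 * m)%:R.
  have P'P : projector (P - S).
    split; first by rewrite linearB /= PT RT.
    by rewrite mulmxBl !mulmxBr PP PS SP RR subrr subr0.
  have [t' tr'] := projector_trace P'P.
  apply: (IHk t') => //.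
  - by rewrite mulmxBr mulmxBl XP XS.
  - by rewrite mulmxBr mulmxBl YP YS.
  - by rewrite mulmxBr XX -{1}PS mulmxA XX mulNmx PS opprB opprK addrC.
  - by rewrite mulmxBr YY -{1}PS mulmxA YY mulNmx PS opprB opprK addrC.
  have : t'%:R = t%:R - 4 :> R by rewrite -tr' linearB /= trP trR card_ord.
  move=> /eqP; rewrite eq_sym subr_eq -natrD eqr_nat => /eqP tt'.
  by move: tk; rewrite tt' addnC ltnS; apply: leq_trans; lia.
exists m.+1; rewrite mulnS natrD -trm linearB /= trR card_ord addrC subrK //.
Qed.

End Projectors.

(** * The properties of the image of F *)

Section GoodGroup.
Context {R : realType}.
Implicit Types (X Y Z W M N k l : 'M[R]_12) (v w : 'cV[R]_12) (H : seq 'M[R]_12).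

(** These are the properties of the image in O(12) of a finite abelian subgroup of
    Spin(12)/<c> that satisfies the condition on the Lie algebra: [good_star] is this
    condition, and [good_even] is what the spin group contributes.  In the
    latter, (1 - M)(1 + M ^ 2) is four times the projector on the (-1)-eigenspace of
    M, so that d is the dimension of the common (-1)-eigenspace of M and N. *)
Record good_group H : Prop := GoodGroup {
  good_uniq : uniq H;
  good_orthogonal M : M \in H -> orthogonal M;
  goodM M N : M \in H -> N \in H -> M *m N \in H;
  goodT M : M \in H -> M^T \in H;
  goodN M : M \in H -> - M \in H;
  good1 : 1%:M \in H;
  good_comm M N : M \in H -> N \in H -> M *m N = N *m M \/ M *m N = - (N *m M);
  good_star M : M^T = - M -> (forall N, N \in H -> N *m M = M *m N) -> M = 0;
  good_even M N : M \in H -> N \in H -> M *m N = N *m M ->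
    M *m M *m M *m M = 1%:M -> N *m N *m N *m N = 1%:M ->
    exists2 d, ~~ odd d &
      \tr ((1%:M - M) *m (1%:M + M *m M) *m ((1%:M - N) *m (1%:M + N *m N))) = (16 * d)%:R
}.

Context {H : seq 'M[R]_12} (HG : good_group H).

Definition central k := k \in H /\ forall N, N \in H -> k *m N = N *m k.

(** The antisymmetric matrix k - k^T commutes with H. *)
Lemma central_involution k : central k -> k^T = k /\ k *m k = 1%:M.
Proof.
move=> [Hk kC]; have kO := good_orthogonal HG Hk.
have kTC N : N \in H -> N *m k^T = k^T *m N.
  move=> HN; rewrite -[LHS]mul1mx -kO -!mulmxA (mulmxA k) (kC _ HN) -mulmxA.
  by rewrite orthogonalC // mulmx1.
have : k - k^T = 0.
  apply: (good_star HG) => [|N HN]; first by rewrite linearB /= trmxK opprB.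
  by rewrite mulmxBr mulmxBl kTC // kC.
move=> /eqP; rewrite subr_eq0 => /eqP kT; split; first by rewrite -kT.
by rewrite {1}kT.
Qed.

Lemma square_central X : X \in H -> central (X *m X).
Proof.
move=> HX; split=> [|N HN]; first exact: (goodM HG).
case: (good_comm HG HX HN) => E; first by rewrite -mulmxA E mulmxA E mulmxA.
by rewrite -mulmxA E mulmxN (mulmxA X N) E mulNmx opprK mulmxA.
Qed.

Lemma good_fourth X : X \in H -> X *m X *m X *m X = 1%:M.
Proof.
by move=> /square_central /central_involution[_ <-]; rewrite !mulmxA.
Qed.

Lemma centralM k l : central k -> central l -> central (k *m l).
Proof.
move=> [Hk kC] [Hl lC]; split=> [|N HN]; first exact: (goodM HG).
by rewrite -mulmxA lC // mulmxA kC // mulmxA.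
Qed.

Lemma central1 : central 1%:M.
Proof. by split=> [|N _]; [exact: (good1 HG) | rewrite mul1mx mulmx1]. Qed.

Lemma centralN k : central k -> central (- k).
Proof.
by move=> [Hk kC]; split=> [|N HN]; [exact: (goodN HG) | rewrite mulNmx mulmxN kC].
Qed.

Lemma translate_perm X : X \in H -> perm_eq [seq X *m N | N <- H] H.
Proof.
move=> HX; have XO := good_orthogonal HG HX.
have Xinj : injective (mulmx X : 'M[R]_12 -> 'M[R]_12).
  by move=> M N E; rewrite -[M]mul1mx -XO -mulmxA E mulmxA XO mul1mx.
apply: uniq_perm; rewrite ?(map_inj_uniq Xinj) ?(good_uniq HG) // => M.
apply/mapP/idP => [[N HN ->]|HM]; first exact: (goodM HG).
exists (X^T *m M); first by apply: (goodM HG) => //; exact: (goodT HG).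
by rewrite mulmxA orthogonalC // mul1mx.
Qed.

Definition star_term v w (h : 'M[R]_12) : R :=
  dot (h *m w) w * dot (h *m v) v - dot (h *m v) w * dot (h *m w) v.

(** The average over H of an antisymmetric matrix is antisymmetric and commutes
    with H, so it vanishes; the average of v w^T - w v^T is paired here with v
    and w. *)
Lemma star_average v w : \sum_(h <- H) star_term v w h = 0.
Proof.
pose A := \sum_(h <- H) ((h *m v) *m (h *m w)^T - (h *m w) *m (h *m v)^T).
have AT : A^T = - A.
  rewrite /A [_^T]linear_sum -sumrN /=; apply: eq_bigr => h _.
  by rewrite linearB /= [(_ *m _^T)^T]trmx_mul [X in _ - X]trmx_mul !trmxK opprB.
have AC N : N \in H -> N *m A = A *m N.
  move=> HN; have NO := good_orthogonal HG HN.
  suff E : N *m A *m N^T = A by rewrite -{2}E -mulmxA NO mulmx1.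
  rewrite [RHS](perm_big [seq N *m M | M <- H]) /=; last first.
    by rewrite perm_sym; exact: translate_perm.
  rewrite big_map mulmx_sumr mulmx_suml; apply: eq_bigr => h _.
  have conj (p q : 'cV[R]_12) : N *m (p *m q^T) *m N^T = (N *m p) *m (N *m q)^T.
    by rewrite trmx_mul !mulmxA.
  by rewrite mulmxBr mulmxBl !conj !mulmxA.
have A0 := good_star HG AT AC.
transitivity (dot v (A *m w)); last by rewrite A0 mul0mx /dot mulmx0 mxE.
rewrite /A mulmx_suml dotC.
have dsum (F : 'M[R]_12 -> 'cV[R]_12) : dot (\sum_(h <- H) F h) v = \sum_(h <- H) dot (F h) v.
  by elim/big_rec2: _ => [|h a b _ <-]; rewrite ?dotDl // /dot trmx0 mul0mx mxE.
rewrite dsum; apply: eq_bigr => h _; rewrite mulmxBl !mul_outer dotDl dotNl !dotZl.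
by [].
Qed.

(** The term of 1 is 1, hence some other term has to be negative. *)
Lemma star_contra v w : dot v v = 1 -> dot w w = 1 -> dot v w = 0 ->
  (forall h, h \in H -> 0 <= star_term v w h) -> False.
Proof.
move=> v1 w1 vw pos.
have : \sum_(h <- H | h \in H) star_term v w h = 0 by rewrite -big_seq star_average.
move=> /eqP; rewrite psumr_eq0 // => /allP /(_ _ (good1 HG)).
rewrite (good1 HG) /star_term !mul1mx v1 w1 vw /=.
by rewrite mul0r subr0 mulr1 oner_eq0.
Qed.

(** Here 1 - X and 1 - Z may be replaced by 1 in the trace of [good_even], because U
    and V anticommute with the terms that contain X or Z. *)
Lemma even_noncommuting X Z U V : X \in H -> Z \in H -> U \in H -> V \in H ->
  X *m Z = Z *m X -> U *m X = - (X *m U) -> U *m Z = Z *m U ->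
  V *m Z = - (Z *m V) -> V *m X = X *m V ->
  exists2 d, ~~ odd d & \tr ((1%:M + X *m X) *m (1%:M + Z *m Z)) = (16 * d)%:R.
Proof.
move=> HX HZ HU HV XZ UX UZ VZ VX.
have [d d_even dE] := good_even HG HX HZ XZ (good_fourth HX) (good_fourth HZ).
exists d => //; rewrite -dE.
have [_ AC] := square_central HX; have [_ CC] := square_central HZ.
set A := 1%:M + X *m X; set C := 1%:M + Z *m Z.
have com N : N \in H -> A *m N = N *m A /\ C *m N = N *m C.
  by move=> HN; rewrite /A /C !mulmxDl !mulmxDr mul1mx mulmx1 AC // CC.
have [AZ CZ] := com _ HZ; have [AU CU] := com _ HU; have [AV CV] := com _ HV.
have -> : (1%:M - X) *m A *m ((1%:M - Z) *m C) =
    A *m C - X *m (A *m C) - A *m (Z *m C) + X *m (A *m (Z *m C)).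
  rewrite mulmxBl mul1mx [X in _ *m X]mulmxBl mul1mx mulmxBl !mulmxBr -!mulmxA.
  move: (A *m C) (A *m (Z *m C)) (X *m (A *m C)) (X *m (A *m (Z *m C))) => a b c e.
  by apply/matrixP => i j; rewrite !mxE; ring.
have t1 : \tr (X *m (A *m C)) = 0.
  apply: (trace_anticommute (good_orthogonal HG HU)).
  by rewrite (mulmxA U X) UX mulNmx -!mulmxA CU (mulmxA U A) -AU !mulmxA.
have t2 : \tr (A *m (Z *m C)) = 0.
  apply: (trace_anticommute (good_orthogonal HG HV)).
  by rewrite (mulmxA V A) -AV -mulmxA (mulmxA V Z) VZ mulNmx mulmxN -!mulmxA -CV.
have t3 : \tr (X *m (A *m (Z *m C))) = 0.
  apply: (trace_anticommute (good_orthogonal HG HU)).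
  rewrite (mulmxA U X) UX mulNmx -!mulmxA CU; congr (- (_ *m _)).
  by rewrite (mulmxA U A) -AU -mulmxA (mulmxA U Z) UZ -mulmxA.
by rewrite mxtraceD !raddfB /= t1 t2 t3 !subr0 addr0.
Qed.

(** As for [even_noncommuting], the term of X is traceless because of U. *)
Lemma even_central k X U : central k -> X \in H -> U \in H -> U *m X = - (X *m U) ->
  exists2 d, ~~ odd d & \tr ((1%:M - k) *m (1%:M + X *m X)) = (8 * d)%:R.
Proof.
move=> ck HX HU UX; have [_ kk] := central_involution ck; have [Hk kC] := ck.
have k4 : k *m k *m k *m k = 1%:M by rewrite kk mul1mx kk.
have [d d_even dE] := good_even HG Hk HX (kC _ HX) k4 (good_fourth HX).
exists d => //; move: dE; rewrite kk.
have -> : (1%:M - k) *m (1%:M + 1%:M) = 2 *: (1%:M - k).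
  by rewrite mulmxDr !mulmx1 scaler_nat mulr2n.
have [_ AC] := square_central HX.
set A := 1%:M + X *m X.
have AU : A *m U = U *m A by rewrite /A mulmxDl mulmxDr mul1mx mulmx1 AC.
have t0 : \tr ((1%:M - k) *m (X *m A)) = 0.
  apply: (trace_anticommute (good_orthogonal HG HU)).
  rewrite (mulmxA U); have -> : U *m (1%:M - k) = (1%:M - k) *m U.
    by rewrite mulmxBl mulmxBr mul1mx mulmx1 kC.
  by rewrite -mulmxA (mulmxA U X) UX mulNmx mulmxN -!mulmxA AU.
rewrite -scalemxAl mxtraceZ [(1%:M - X) *m A]mulmxBl mul1mx mulmxBr raddfB /= t0 subr0.
have -> : (16 * d = 2 * (8 * d))%N by lia.
by rewrite natrM => /mulfI; apply; rewrite pnatr_eq0.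
Qed.

End GoodGroup.

(** * Signs on a frame *)

Section Frames.
Context {R : rcfType} {n : nat}.
Implicit Types (Q M N E : 'M[R]_n).

Definition diagonal Q M := forall i, M *m col i Q = col i Q \/ M *m col i Q = - col i Q.

Definition neg Q M i : bool := M *m col i Q == - col i Q.

Lemma negE Q M i : orthogonal Q -> diagonal Q M ->
  M *m col i Q = (-1) ^+ neg Q M i *: col i Q.
Proof.
move=> QO MQ; rewrite /neg; case: (MQ i) => ->.
  by rewrite frame_neqN // scale1r.
by rewrite eqxx scaleN1r.
Qed.

Lemma neg_eq Q M i (b : bool) : orthogonal Q ->
  M *m col i Q = (-1) ^+ b *: col i Q -> neg Q M i = b.
Proof.
by move=> QO E; rewrite /neg E; case: b {E};
  rewrite ?expr0 ?scale1r ?frame_neqN // expr1 scaleN1r eqxx.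
Qed.

Lemma diagonalM Q M N : orthogonal Q -> diagonal Q M -> diagonal Q N ->
  diagonal Q (M *m N) /\ forall i, neg Q (M *m N) i = neg Q M i (+) neg Q N i.
Proof.
move=> QO MQ NQ; have E i : M *m N *m col i Q = (-1) ^+ (neg Q M i (+) neg Q N i) *: col i Q.
  by rewrite -mulmxA negE // -scalemxAr negE // scalerA mulrC signr_addb.
split=> i; last exact: neg_eq.
by rewrite E; case: (_ (+) _); rewrite ?expr0 ?scale1r ?expr1 ?scaleN1r; [right|left].
Qed.

Definition eigen Q M (f : 'I_n -> R) := forall i, M *m col i Q = f i *: col i Q.

Lemma eigenM Q M N f g : eigen Q M f -> eigen Q N g ->
  eigen Q (M *m N) (fun i => f i * g i).
Proof. by move=> Mf Ng i; rewrite -mulmxA Ng -scalemxAr Mf scalerA mulrC. Qed.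

Lemma eigen_trace Q M f : orthogonal Q -> eigen Q M f -> \tr M = \sum_i f i.
Proof.
move=> QO Mf; rewrite (frame_trace _ QO); apply: eq_bigr => i _.
by rewrite Mf dotZr orthogonal_col // eqxx mulr1.
Qed.

Lemma eigen_half Q b E : orthogonal Q -> diagonal Q E ->
  eigen Q (half b E) (fun i => (neg Q E i == b)%:R).
Proof.
move=> QO EQ i; rewrite /half -scalemxAl mulmxDl mul1mx -scalemxAl negE //.
rewrite -{1}[col i Q]scale1r scalerA -scalerDl scalerA; congr (_ *: _).
by rewrite -signr_addb; case: b; case: (neg _ _ _); rewrite /= ?expr0 ?expr1; lra.
Qed.

Lemma eigen_plus Q E : orthogonal Q -> diagonal Q E ->
  eigen Q (1%:M + E) (fun i => 2 * (~~ neg Q E i)%:R).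
Proof.
move=> QO EQ i; rewrite mulmxDl mul1mx negE // -{1}[col i Q]scale1r -scalerDl.
by congr (_ *: _); case: (neg _ _ _); rewrite /= ?expr0 ?expr1; lra.
Qed.

Lemma eigen_minus Q E : orthogonal Q -> diagonal Q E ->
  eigen Q (1%:M - E) (fun i => 2 * (neg Q E i)%:R).
Proof.
move=> QO EQ i; rewrite mulmxBl mul1mx negE // -{1}[col i Q]scale1r -scalerBl.
by congr (_ *: _); case: (neg _ _ _); rewrite /= ?expr0 ?expr1; lra.
Qed.

End Frames.

(** * At most one anticommuting pair *)

Section NoQuadruple.
Context {R : realType} {H : seq 'M[R]_12} (HG : good_group H).
Implicit Types (X Y Z W M N k l : 'M[R]_12) (v w : 'cV[R]_12).

Definition sign_comm (b : bool) M N := M *m N = (-1) ^+ b *: (N *m M).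

Lemma sign_commMl b c M M' N : sign_comm b M N -> sign_comm c M' N ->
  sign_comm (b (+) c) (M *m M') N.
Proof.
move=> E E'; rewrite /sign_comm -mulmxA E' -scalemxAr (mulmxA M N) E -scalemxAl scalerA.
by rewrite mulrC signr_addb mulmxA.
Qed.

Lemma sign_commMr b c M N N' : sign_comm b M N -> sign_comm c M N' ->
  sign_comm (b (+) c) M (N *m N').
Proof.
move=> E E'; rewrite /sign_comm (mulmxA M N) E -scalemxAl -(mulmxA N M) E' -scalemxAr scalerA.
by rewrite signr_addb mulmxA.
Qed.

Lemma sign_comm0 M N : M *m N = N *m M -> sign_comm false M N.
Proof. by move=> E; rewrite /sign_comm expr0 scale1r. Qed.

Lemma sign_comm1 M N : M *m N = - (N *m M) -> sign_comm true M N.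
Proof. by move=> E; rewrite /sign_comm expr1 scaleN1r. Qed.

Lemma sign_comm0E M N : sign_comm false M N -> M *m N = N *m M.
Proof. by rewrite /sign_comm expr0 scale1r. Qed.

Lemma sign_comm1E M N : sign_comm true M N -> M *m N = - (N *m M).
Proof. by rewrite /sign_comm expr1 scaleN1r. Qed.

Lemma central_frame (ks : seq 'M[R]_12) : (forall k, k \in ks -> central k (H := H)) ->
  exists2 Q, orthogonal Q & forall k, k \in ks -> diagonal Q k.
Proof.
move=> ksC; have [|||Q QO QP] := @simultaneous_diagonalization R 12 ks.
- by move=> k /ksC /(central_involution HG)[].
- by move=> k /ksC /(central_involution HG)[].
- by move=> k l /ksC [_ kC] /ksC [Hl _]; exact: kC.
by exists Q => // k ks_k i; exact: QP.
Qed.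

(** An orthogonal matrix that squares to 1 on the image of P is symmetric there. *)
Lemma projector_half P Z : projector P -> orthogonal Z -> Z *m P = P *m Z ->
  Z *m Z *m P = P -> projector (P *m half false Z).
Proof.
move=> [PT PP1] ZO ZP ZZ.
have -> : P *m half false Z = 2^-1 *: (P + P *m Z).
  by rewrite /half expr0 scale1r -scalemxAr mulmxDr mulmx1.
have ZT : Z^T *m P = P *m Z by rewrite -{1}ZZ !mulmxA ZO mul1mx ZP.
have PZP : P *m Z *m P = P *m Z by rewrite -mulmxA ZP mulmxA PP1.
have PZZ : P *m Z *m Z = P by rewrite -ZP -mulmxA -ZP mulmxA ZZ.
split; first by rewrite linearZ /= linearD /= trmx_mul PT ZT.
rewrite -scalemxAl -scalemxAr scalerA mulmxDl !mulmxDr PP1 PZP !mulmxA PP1 PZP PZZ.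
by apply/matrixP => i j; rewrite !mxE; lra.
Qed.

(** X and Y act as quaternions on each eigenspace of Z in the image of P, and W
    exchanges the two eigenspaces. *)
Lemma eightfold_trace P X Y Z W : X \in H -> Y \in H -> Z \in H -> W \in H ->
  X *m Y = - (Y *m X) -> X *m Z = Z *m X -> Y *m Z = Z *m Y -> W *m Z = - (Z *m W) ->
  projector P -> (forall N, N \in H -> N *m P = P *m N) ->
  X *m X *m P = - P -> Y *m Y *m P = - P -> Z *m Z *m P = P ->
  exists m : nat, \tr P = (8 * m)%:R.
Proof.
move=> HX HY HZ HW XY XZ YZ WZ PP PC XX YY ZZ.
pose P' := P *m half false Z.
have comZ N : N \in H -> N *m Z = Z *m N -> N *m P' = P' *m N.
  by move=> HN NZ; rewrite /P' mulmxA PC // -!mulmxA (half_comm _ NZ).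
have P'P : projector P'.
  by apply: (projector_half PP (good_orthogonal HG HZ)) => //; exact: PC.
have [m trm] : exists m : nat, \tr P' = (4 * m)%:R.
  apply: (quaternionic_trace P'P (good_orthogonal HG HX) (good_orthogonal HG HY)) => //.
  - exact: comZ.
  - exact: comZ.
  - by rewrite mulmxA XX mulNmx.
  - by rewrite mulmxA YY mulNmx.
exists m; move: trm; rewrite (half_trace _ (good_orthogonal HG HW) WZ) ?PC // !natrM => E.
by lra.
Qed.

(** A subgroup on two anticommuting pairs would split R ^ 12, by the signs a,
    b, c, d of the squares of X, Y, Z, W, into blocks.  The parity of the
    common (-1)-eigenspaces makes the numbers of frame vectors with a = c = 1,
    with b = d = 1 and with ad = bc = 1 multiples of 8.  A frame vector on
    which exactly one of the two pairs generates a quaternion group is counted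
    0 times, one with a = b = c = d = 1 three times, and every other one once;
    since the first kind comes in eights and the second in fours, the sum of
    the three multiples of 8 would be 12 modulo 8. *)
Lemma no_quadruple X Y Z W : X \in H -> Y \in H -> Z \in H -> W \in H ->
  X *m Y = - (Y *m X) -> Z *m W = - (W *m Z) -> X *m Z = Z *m X ->
  X *m W = W *m X -> Y *m Z = Z *m Y -> Y *m W = W *m Y -> False.
Proof.
move=> HX HY HZ HW XY ZW XZ XW YZ YW.
have YX : Y *m X = - (X *m Y) by rewrite XY opprK.
have WZ : W *m Z = - (Z *m W) by rewrite ZW opprK.
pose A := X *m X; pose B := Y *m Y; pose C := Z *m Z; pose D := W *m W.
have cA : central A (H := H) := square_central HG HX.
have cB : central B (H := H) := square_central HG HY.
have cC : central C (H := H) := square_central HG HZ.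
have cD : central D (H := H) := square_central HG HW.
have [|Q QO QP] := @central_frame [:: A; B; C; D].
  by move=> k; rewrite !inE => /or4P[] /eqP ->.
have [dA dB dC dD] : [/\ diagonal Q A, diagonal Q B, diagonal Q C & diagonal Q D].
  by split; apply: QP; rewrite !inE eqxx ?orbT.
have [AT AA] := central_involution HG cA; have [BT BB] := central_involution HG cB.
have [CT CC] := central_involution HG cC; have [DT DD] := central_involution HG cD.
pose a := neg Q A; pose b := neg Q B; pose c := neg Q C; pose d := neg Q D.
pose num (p : 'I_12 -> bool) : nat := (\sum_i p i)%N.
have trace_num (p : 'I_12 -> bool) (z : R) M : eigen Q M (fun i => z * (p i)%:R) -> \tr M = z * (num p)%:R.
  by move=> Mp; rewrite (eigen_trace QO Mp) -mulr_sumr natr_sum.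
have pair8 M N E G U V (e g : 'I_12 -> bool) : M \in H -> N \in H -> U \in H -> V \in H ->
    M *m N = N *m M -> U *m M = - (M *m U) -> U *m N = N *m U ->
    V *m N = - (N *m V) -> V *m M = M *m V -> M *m M = E -> N *m N = G ->
    diagonal Q E -> diagonal Q G -> neg Q E =1 e -> neg Q G =1 g ->
    exists m, num (fun i => ~~ e i && ~~ g i) = (8 * m)%N.
  move=> HM HN HU HV MN UM UN VN VM ME NG dE dG eE gG.
  have [x xe] := even_noncommuting HG HM HN HU HV MN UM UN VN VM.
  rewrite (@trace_num (fun i => ~~ e i && ~~ g i) 4); last first.
    rewrite ME NG => i; rewrite (eigenM (eigen_plus QO dE) (eigen_plus QO dG)) eE gG.
    by congr (_ *: _); case: (e i); case: (g i); rewrite /=; lra.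
  rewrite -natrM => /eqP; rewrite eqr_nat => /eqP E4.
  by exists x./2; move: xe E4; lia.
have [m1 n1] : exists m, num (fun i => ~~ a i && ~~ c i) = (8 * m)%N.
  by apply: (pair8 X Z A C Y W) => //.
have [m2 n2] : exists m, num (fun i => ~~ b i && ~~ d i) = (8 * m)%N.
  by apply: (pair8 Y W B D X Z) => //.
have [m3 n3] : exists m, num (fun i => ~~ (a i (+) d i) && ~~ (b i (+) c i)) = (8 * m)%N.
  have [dAD nAD] := diagonalM QO dA dD; have [dBC nBC] := diagonalM QO dB dC.
  apply: (pair8 (X *m W) (Y *m Z) (A *m D) (B *m C) Y X) => //.
  - exact: (goodM HG).
  - exact: (goodM HG).
  - apply/sign_comm0E/(@sign_commMl true true); first apply: (@sign_commMr true false);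
      last apply: (@sign_commMr false true); exact/sign_comm0 || exact/sign_comm1.
  - by apply/sign_comm1E/(@sign_commMr true false); [exact/sign_comm1|exact/sign_comm0].
  - by apply/sign_comm0E/(@sign_commMr false false); exact/sign_comm0.
  - by apply/sign_comm1E/(@sign_commMr true false); [exact/sign_comm1|exact/sign_comm0].
  - by apply/sign_comm0E/(@sign_commMr false false); exact/sign_comm0.
  - by rewrite -mulmxA (mulmxA W) -XW -(mulmxA X W W) mulmxA.
  - by rewrite -mulmxA (mulmxA Z) -YZ -(mulmxA Y Z Z) mulmxA.
pose P e f g h := half e A *m half f B *m (half g C *m half h D).
have hC k e N : central k (H := H) -> N \in H -> N *m half e k = half e k *m N.
  by move=> [_ kC] HN; apply: half_comm; rewrite kC.
have hh k l e f : central k (H := H) -> central l (H := H) ->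
    half e k *m half f l = half f l *m half e k.
  by move=> ck [Hl lC]; apply: half_comm; apply/esym/hC.
have PC e f g h N : N \in H -> N *m P e f g h = P e f g h *m N.
  have cM p q : N *m p = p *m N -> N *m q = q *m N -> N *m (p *m q) = p *m q *m N.
    by move=> Np Nq; rewrite mulmxA Np -mulmxA Nq mulmxA.
  by move=> HN; apply/cM; apply/cM; apply/hC.
have PP e f g h : projector (P e f g h).
  have p1 : projector (half e A *m half f B).
    by apply: projectorM (half_projector _ AT AA) (half_projector _ BT BB) (hh _ _ _ _ _ _).
  have p2 : projector (half g C *m half h D).
    by apply: projectorM (half_projector _ CT CC) (half_projector _ DT DD) (hh _ _ _ _ _ _).
  apply: projectorM => //.
  have cM (p q r : 'M[R]_12) : r *m p = p *m r -> r *m q = q *m r ->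
      r *m (p *m q) = p *m q *m r.
    by move=> rp rq; rewrite mulmxA rp -mulmxA rq mulmxA.
  by apply/cM; apply/esym/cM; exact: hh.
have Ptr e f g h : \tr (P e f g h) =
    (num (fun i => [&& a i == e, b i == f, c i == g & d i == h]))%:R.
  rewrite -[RHS]mul1r; apply: trace_num => i.
  rewrite (eigenM (eigenM (eigen_half e QO dA) (eigen_half f QO dB))
                  (eigenM (eigen_half g QO dC) (eigen_half h QO dD))).
  by congr (_ *: _); rewrite mul1r -!natrM !mulnb -andbA.
have [HA HB] : A \in H /\ B \in H by case: cA cB => ? _ [].
have [HC HD] : C \in H /\ D \in H by case: cC cD => ? _ [].
have PA e f g h : A *m P e f g h = (-1) ^+ e *: P e f g h.
  move: (half_mul e AA); rewrite /P;
  move: (half e A) (half f B) (half g C) (half h D) => p q r t Ap.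
  by rewrite !mulmxA Ap -!scalemxAl.
have PB e f g h : B *m P e f g h = (-1) ^+ f *: P e f g h.
  move: (half_mul f BB) (hC A e B cA HB); rewrite /P;
  move: (half e A) (half f B) (half g C) (half h D) => p q r t Bq Bp.
  by rewrite !mulmxA Bp -(mulmxA p B) Bq -scalemxAr -!scalemxAl.
have PC' e f g h : C *m P e f g h = (-1) ^+ g *: P e f g h.
  move: (half_mul g CC) (hC D h C cD HC) (hC C g C cC HC); rewrite PC // /P.
  move: (half e A *m half f B) (half g C) (half h D) => p r t Cr Ct rC.
  by rewrite -(mulmxA p) -(mulmxA r) -Ct (mulmxA r C) -rC Cr -scalemxAl -scalemxAr.
have PD e f g h : D *m P e f g h = (-1) ^+ h *: P e f g h.
  move: (half_mul h DD) (hC D h D cD HD); rewrite PC // /P.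
  move: (half e A *m half f B) (half g C) (half h D) => p r t Dt tD.
  by rewrite -(mulmxA p) -(mulmxA r) -tD Dt -!scalemxAr.
have XYcase f g : ~~ (f && g) -> exists m, \tr (P true true f g) = (8 * m)%:R.
  have PX : X *m X *m P true true f g = - P true true f g.
    by rewrite PA expr1 scaleN1r.
  have PY : Y *m Y *m P true true f g = - P true true f g.
    by rewrite PB expr1 scaleN1r.
  case: f g PX PY => [] [] // PX PY _.
  - apply: (eightfold_trace HX HY HW HZ) => //; first exact: PC.
    by rewrite PD expr0 scale1r.
  - apply: (eightfold_trace HX HY HZ HW) => //; first exact: PC.
    by rewrite PC' expr0 scale1r.
  - apply: (eightfold_trace HX HY HZ HW) => //; first exact: PC.
    by rewrite PC' expr0 scale1r.
have ZWcase f g : ~~ (f && g) -> exists m, \tr (P f g true true) = (8 * m)%:R.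
  have PZ : Z *m Z *m P f g true true = - P f g true true.
    by rewrite PC' expr1 scaleN1r.
  have PW : W *m W *m P f g true true = - P f g true true.
    by rewrite PD expr1 scaleN1r.
  case: f g PZ PW => [] [] // PZ PW _.
  - apply: (eightfold_trace HZ HW HY HX) => //; first exact: PC.
    by rewrite PB expr0 scale1r.
  - apply: (eightfold_trace HZ HW HX HY) => //; first exact: PC.
    by rewrite PA expr0 scale1r.
  - apply: (eightfold_trace HZ HW HX HY) => //; first exact: PC.
    by rewrite PA expr0 scale1r.
have [t trt] : exists t, \tr (P false false false false) = (4 * t)%:R.
  set P0 := P _ _ _ _.
  have P0C N : N \in H -> N *m P0 = P0 *m N by exact: PC.
  (* X and Z restrict to commuting involutions on the image of P0, and each
     quarter of it given by their signs has the same dimension *)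
  have quarter : projector (P0 *m half false X *m half false Z).
    apply: projector_half; [|exact: (good_orthogonal HG)| |].
    - apply: projector_half; [exact: PP|exact: (good_orthogonal HG)|exact: P0C|].
      by rewrite PA expr0 scale1r.
    - by rewrite mulmxA P0C // -!mulmxA half_comm.
    - by rewrite mulmxA PC' expr0 scale1r.
  have [t' trt'] := projector_trace quarter.
  exists t'; move: trt'; rewrite (half_trace _ (good_orthogonal HG HW)) //; last first.
    by rewrite mulmxA P0C // -!mulmxA half_comm.
  rewrite (half_trace _ (good_orthogonal HG HY)) ?P0C // natrM => <-.
  by lra.
have get e f g h m : \tr (P e f g h) = (8 * m)%:R ->
    num (fun i => [&& a i == e, b i == f, c i == g & d i == h]) = (8 * m)%N.
  by rewrite Ptr => /eqP; rewrite eqr_nat => /eqP.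
have [m4 /get n4] := XYcase false false isT.
have [m5 /get n5] := XYcase false true isT.
have [m6 /get n6] := XYcase true false isT.
have [m7 /get n7] := ZWcase false false isT.
have [m8 /get n8] := ZWcase false true isT.
have [m9 /get n9] := ZWcase true false isT.
move: trt; rewrite Ptr => /eqP; rewrite eqr_nat => /eqP n0.
have : (num (fun i => ~~ a i && ~~ c i) + num (fun i => ~~ b i && ~~ d i) +
    num (fun i => ~~ (a i (+) d i) && ~~ (b i (+) c i)) +
    (num (fun i => [&& a i == true, b i == true, c i == false & d i == false]) +
    num (fun i => [&& a i == true, b i == true, c i == false & d i == true]) +
    num (fun i => [&& a i == true, b i == true, c i == true & d i == false]) +
    num (fun i => [&& a i == false, b i == false, c i == true & d i == true]) +
    num (fun i => [&& a i == false, b i == true, c i == true & d i == true]) +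
    num (fun i => [&& a i == true, b i == false, c i == true & d i == true])) =
    \sum_(i < 12) 1 + 2 * num (fun i => [&& a i == false, b i == false, c i == false & d i == false]))%N.
  rewrite /num big_distrr -!big_split /=; apply: eq_bigr => i _.
  by case: (a i); case: (b i); case: (c i); case: (d i).
by rewrite sum_nat_const card_ord n0 n1 n2 n3 n4 n5 n6 n7 n8 n9; lia.
Qed.

End NoQuadruple.

(** * Binary codes of length six *)

Section EvenCode.

Notation word := {ffun 'I_6 -> bool}.

Definition weight (w : word) : nat := (\sum_p w p)%N.
Definition addw (a b : word) : word := [ffun p => a p (+) b p].

Lemma F2_eq0 m : (m%:R == 0 :> 'F_2) = ~~ odd m.
Proof. by rewrite -(dvdn_pcharf (pchar_Fp (isT : prime 2))) dvdn2. Qed.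

Lemma F2_natE (x : 'F_2) : x = (x != 0)%:R.
Proof. by case: x => [[|[|//]] ?]; apply: val_inj. Qed.

Lemma dual_word (x : word) : ~~ odd (weight x) ->
  x = [ffun=> false] \/ x = [ffun=> true] \/
  exists p q b, p != q /\ x = [ffun r => b (+) (r \in [set p; q]%SET)].
Proof.
pose X := [set p | x p]%SET.
have xE p : x p = (p \in X) by rewrite inE.
have -> : weight x = #|X|.
  rewrite -sum1_card [RHS]big_mkcond /=; apply: eq_bigr => p _.
  by rewrite inE; case: (x p).
have := max_card (mem X); rewrite card_ord.
case cX: #|X| => [|[|[|[|[|[|[|m]]]]]]] /= m6 // _.
- left; apply/ffunP => p; rewrite ffunE xE.
  by move/eqP: cX; rewrite cards_eq0 => /eqP ->; rewrite inE.
- have /cards2P [p [q [pq XE]]] : #|X| == 2 by rewrite cX.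
  right; right; exists p, q, false; split=> //.
  by apply/ffunP => r; rewrite ffunE xE XE.
- have /cards2P [p [q [pq XE]]] : #|~: X| == 2.
    by have := cardsC X; rewrite cX card_ord => /(@addnI 4) ->.
  right; right; exists p, q, true; split=> //.
  by apply/ffunP => r; rewrite ffunE -XE inE xE; case: (_ \in _).
- right; left; apply/ffunP => p; rewrite ffunE xE.
  have : #|~: X| = 0 by have := cardsC X; rewrite cX card_ord => /(@addnI 6).
  by move/eqP; rewrite cards_eq0 => /eqP/setP/(_ p); rewrite !inE => /negbFE ->.
Qed.

(** A binary code of length 6 that contains the all-one word and separates all
    positions by even words contains all even words: a word orthogonal to its
    even part has even weight and cannot have weight 2, nor weight 4 since its
    complement is orthogonal as well. *)
Lemma even_code_full (C : word -> Prop) :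
  (forall a b, C a -> C b -> C (addw a b)) -> C [ffun=> true] ->
  (forall p q, p != q -> exists a, [/\ C a, ~~ odd (weight a) & a p != a q]) ->
  forall w, ~~ odd (weight w) -> C w.
Proof.
move=> CD C1 Csep w w_even.
pose even a := `[< C a >] && ~~ odd (weight a).
pose vec (a : word) : 'rV['F_2]_6 := \row_p (a p)%:R.
pose M : 'M['F_2]_(#|{: word}|, 6) :=
  \matrix_(i < #|{: word}|, p < 6) (even (enum_val i) && enum_val i p)%:R.
have /submxP[u wM] : (vec w <= M)%MS.
  rewrite submxE; apply/eqP/matrixP => i0 j; rewrite ord1 {i0} [RHS]mxE.
  pose x : word := [ffun p => cokermx M p j != 0].
  have orth (a : word) : (\sum_p (a p)%:R * cokermx M p j)%R =
      (\sum_p (a p && x p)%N)%:R.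
    rewrite natr_sum; apply: eq_bigr => p _; rewrite ffunE [X in _ * X]F2_natE.
    by rewrite -natrM mulnb.
  have xC a : even a -> ~~ odd (\sum_p (a p && x p))%N.
    move=> ea; have := mulmx_coker M => /matrixP/(_ (enum_rank a) j).
    rewrite [LHS]mxE [RHS]mxE => E; rewrite -F2_eq0 -orth; apply/eqP; rewrite -[RHS]E.
    by apply: eq_bigr => p _; rewrite !mxE enum_rankK ea.
  have e1 : even [ffun=> true].
    rewrite /even; apply/andP; split; first exact/asboolP.
    rewrite /weight (eq_bigr (fun=> 1%N)) ?sum_nat_const ?card_ord //.
    by move=> p _; rewrite ffunE.
  have x_even : ~~ odd (weight x).
    by have := xC _ e1; under eq_bigr => p _ do rewrite ffunE.
  rewrite mxE; under eq_bigr => p _ do rewrite mxE.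
  rewrite orth; apply/eqP; rewrite F2_eq0.
  have [x0|[x1|[p [q [b [pq xE]]]]]] := dual_word x_even.
  - by rewrite big1 // => p _; rewrite x0 ffunE andbF.
  - by under eq_bigr => p _ do rewrite x1 ffunE andbT.
  have [a [Ca a_even apq]] := Csep p q pq.
  have ea : even a by rewrite /even a_even andbT; exact/asboolP.
  have := xC _ ea; case/negP; rewrite xE.
  have pair : odd (\sum_r (a r && (r \in [set p; q]%SET)))%N.
    rewrite (bigD1 p) //= (bigD1 q) 1?eq_sym //= big1 ?addn0.
      by rewrite !inE !eqxx orbT !andbT oddD; move: apq; case: (a p); case: (a q).
    by move=> r /andP[rp rq]; rewrite !inE (negbTE rp) (negbTE rq) andbF.
  case: b {xE}; last by under eq_bigr => r _ do rewrite ffunE.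
  have : weight a = (\sum_r (a r && (r \in [set p; q]%SET)) +
      \sum_r (a r && ([ffun r => true (+) (r \in [set p; q]%SET)] : word) r))%N.
    rewrite -big_split; apply: eq_bigr => r _; rewrite ffunE.
    by case: (a r); case: (_ \in _).
  by move/(congr1 odd); rewrite oddD pair (negbTE a_even); case: (odd _).
pose PC (v : 'rV['F_2]_6) := C [ffun p => v 0 p != 0].
have PC0 : PC 0.
  have := CD _ _ C1 C1; congr C; apply/ffunP => p; rewrite !ffunE mxE eqxx //.
have PCD v v' : PC v -> PC v' -> PC (v + v').
  move=> vC v'C; have := CD _ _ vC v'C; congr C; apply/ffunP => p; rewrite !ffunE mxE.
  by move: (v 0 p) (v' 0 p) => [[|[|//]] ?] [[|[|//]] ?].
have : PC (vec w).
  rewrite wM mulmx_sum_row; elim/big_rec: _ => // i v _ vC; apply: PCD => //.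
  have [->|u1] := eqVneq (u 0 i) 0; first by rewrite scale0r.
  rewrite [u 0 i]F2_natE u1 scale1r.
  case ei: (even (enum_val i)); last first.
    suff -> : row i M = 0 by [].
    by apply/rowP => p; rewrite !mxE ei.
  have /andP[/asboolP Ca _] := ei; move: Ca; congr C; apply/ffunP => p.
  by rewrite ffunE !mxE ei; case: (enum_val i p).
congr C; apply/ffunP => p; rewrite ffunE mxE; by case: (w p).
Qed.

End EvenCode.

(** * Grouping the frame into planes *)

Section Planes.

Definition lo (p : 'I_6) : 'I_12 := inord p.*2.
Definition hi (p : 'I_6) : 'I_12 := inord p.*2.+1.
Definition plane (i : 'I_12) : 'I_6 := inord i./2.

Lemma val_lo p : lo p = p.*2 :> nat.
Proof. by rewrite /lo inordK //; case: p => p /=; lia. Qed.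

Lemma val_hi p : hi p = p.*2.+1 :> nat.
Proof. by rewrite /hi inordK //; case: p => p /=; lia. Qed.

Lemma plane_lo p : plane (lo p) = p.
Proof. by rewrite /plane val_lo doubleK inord_val. Qed.

Lemma plane_hi p : plane (hi p) = p.
Proof. by rewrite /plane val_hi /= uphalf_double inord_val. Qed.

Lemma lo_hi p q : (lo p == hi q) = false.
Proof. by rewrite -val_eqE /= val_lo val_hi; apply/negbTE; lia. Qed.

Lemma lo_eq p q : (lo p == lo q) = (p == q).
Proof. by apply/eqP/eqP => [E|-> //]; rewrite -[p]plane_lo E plane_lo. Qed.

Lemma hi_eq p q : (hi p == hi q) = (p == q).
Proof. by apply/eqP/eqP => [E|-> //]; rewrite -[p]plane_hi E plane_hi. Qed.

Lemma plane_cases (i : 'I_12) : i = if odd i then hi (plane i) else lo (plane i).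
Proof.
apply: val_inj; have i12 := ltn_ord i.
have pE : plane i = i./2 :> nat by rewrite /plane inordK //; lia.
by case: ifP => oi; rewrite /= ?val_hi ?val_lo pE; lia.
Qed.

Lemma planeP (T : 'I_12 -> Prop) : (forall p, T (lo p)) -> (forall p, T (hi p)) ->
  forall i, T i.
Proof. by move=> Tl Th i; rewrite (plane_cases i); case: ifP. Qed.

Lemma sum_planes (V : nmodType) (F : 'I_12 -> V) :
  \sum_i F i = \sum_p (F (lo p) + F (hi p)).
Proof.
rewrite (eq_bigr (fun i : 'I_12 => F (inord i))) => [|i _]; last by rewrite inord_val.
rewrite /lo /hi -(big_mkord xpredT (fun i => F (inord i))).
rewrite -(big_mkord xpredT (fun p => F (inord p.*2) + F (inord p.*2.+1))).
by rewrite !big_nat_recr ?big_geq //= !add0r !addrA.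
Qed.

Lemma sum_planes_nat (F : 'I_12 -> nat) :
  (\sum_i F i = \sum_p (F (lo p) + F (hi p)))%N.
Proof. exact: sum_planes. Qed.

Context {R : rcfType}.

Definition plane_frame (u w : 'I_6 -> 'cV[R]_12) : 'M[R]_12 :=
  \matrix_(r, i) (if odd i then w (plane i) else u (plane i)) r 0.

Lemma plane_frame_lo u w p : col (lo p) (plane_frame u w) = u p.
Proof. by apply/colP => r; rewrite !mxE val_lo odd_double plane_lo. Qed.

Lemma plane_frame_hi u w p : col (hi p) (plane_frame u w) = w p.
Proof. by apply/colP => r; rewrite !mxE val_hi /= odd_double plane_hi. Qed.

Lemma plane_frame_orthogonal u w :
  (forall p q, dot (u p) (u q) = (p == q)%:R) ->
  (forall p q, dot (w p) (w q) = (p == q)%:R) ->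
  (forall p q, dot (u p) (w q) = 0) -> orthogonal (plane_frame u w).
Proof.
move=> uu ww uw; apply: orthogonalP.
apply: planeP => p; apply: planeP => q;
  rewrite ?plane_frame_lo ?plane_frame_hi ?uu ?ww ?uw ?lo_eq ?hi_eq ?lo_hi //.
by rewrite dotC uw eq_sym lo_hi.
Qed.

End Planes.

(** * The normal form of a nonabelian group *)

Section Nonabelian.
Context {R : realType} {H : seq 'M[R]_12} (HG : good_group H).
Implicit Types (X Y Z W M N Q k l : 'M[R]_12) (v w : 'cV[R]_12).
Notation central := (central (H := H)).

(** U exchanges the two eigenspaces of Z, which are orthogonal. *)
Lemma dot_anticommute_eigen (e : R) Z U v w : orthogonal Z -> e * e = 1 ->
  Z *m v = e *: v -> Z *m w = e *: w -> Z *m U = - (U *m Z) -> dot (U *m v) w = 0.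
Proof.
move=> ZO e2 Zv Zw ZU; have := orthogonal_dot (U *m v) w ZO.
rewrite mulmxA ZU mulNmx -mulmxA Zv Zw -scalemxAr dotNl dotZl dotZr mulrA e2 mul1r.
by lra.
Qed.

Lemma dot_skew Z v : orthogonal Z -> Z *m (Z *m v) = - v -> dot (Z *m v) v = 0.
Proof.
move=> ZO Zv; have := orthogonal_dot (Z *m v) v ZO; rewrite Zv dotNl dotC.
by lra.
Qed.

(** Vectors of the same joint eigenspace of the centre do not see the central part of
    an element of H. *)
Lemma star_term_central k U v w (b : bool) : central k -> U \in H ->
  k *m v = (-1) ^+ b *: v -> k *m w = (-1) ^+ b *: w ->
  star_term v w (k *m U) = star_term v w U.
Proof.
move=> [_ kC] HU kv kw; rewrite /star_term kC // -!mulmxA kv kw -!scalemxAr !dotZl.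
have : (-1) ^+ b * (-1) ^+ b = 1 :> R by rewrite -signr_addb addbb.
move: ((-1) ^+ b) (dot (U *m w) w) (dot (U *m v) v) (dot (U *m v) w) (dot (U *m w) v).
move=> e p q r t e2.
rewrite (_ : _ - _ = e * e * (p * q - r * t)); last by ring.
by rewrite e2 mul1r.
Qed.

(** The planes of the frame are the joint eigenspaces of the centre; in each of them X and Y act as two reflections or as a reflection
    and a quarter turn, according to the signs of their squares.  The parity
    conditions come from the common (-1)-eigenspaces of central elements with
    X, with Y and with X Y. *)
Definition normal_form X Y Q : Prop :=
  [/\ forall k, central k -> diagonal Q k /\ forall p, neg Q k (hi p) = neg Q k (lo p),
    forall p, ~~ (neg Q (X *m X) (lo p) && neg Q (Y *m Y) (lo p)),
    forall p q, p != q -> exists2 k, central k & neg Q k (lo p) != neg Q k (lo q),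
    forall p, let a := neg Q (X *m X) (lo p) in let b := neg Q (Y *m Y) (lo p) in
      let u := col (lo p) Q in let w := col (hi p) Q in
      [/\ X *m u = (if a then w else - u), X *m w = (if a then - u else w),
          Y *m u = (if a then - u else if b then w else - w)
        & Y *m w = (if a then w else - u)] &
    forall k, central k ->
      [/\ ~~ odd (\sum_p (neg Q k (lo p) && ~~ neg Q (X *m X) (lo p))),
          ~~ odd (\sum_p (neg Q k (lo p) && ~~ neg Q (Y *m Y) (lo p))) &
          ~~ odd (\sum_p (neg Q k (lo p) && (neg Q (X *m X) (lo p) (+) neg Q (Y *m Y) (lo p))))]].

Context (X Y : 'M[R]_12) (HX : X \in H) (HY : Y \in H) (XY : X *m Y = - (Y *m X)).

Let XO : orthogonal X := good_orthogonal HG HX.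
Let YO : orthogonal Y := good_orthogonal HG HY.
Let YX : Y *m X = - (X *m Y). Proof. by rewrite XY opprK. Qed.

(** Modulo the centre, H is generated by X and Y: an element can be corrected
    by 1, X, Y or X Y so that it commutes with X and Y, and such an element
    commutes with all others, since two that do not would complete X and Y to
    a quadruple. *)
Lemma central_decomposition h : h \in H ->
  exists k U, [/\ central k, U \in [:: 1%:M; X; Y; X *m Y] & h = k *m U].
Proof.
have sc M N : M \in H -> N \in H -> exists b, sign_comm b M N.
  move=> HM HN; case: (good_comm HG HM HN) => E.
    by exists false; exact: sign_comm0.
  by exists true; exact: sign_comm1.
have XYin U : U \in [:: 1%:M; X; Y; X *m Y] -> U \in H.
  by rewrite !inE => /or4P[] /eqP -> //; [exact: (good1 HG)|exact: (goodM HG)].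
have red M : M \in H -> exists U, [/\ U \in [:: 1%:M; X; Y; X *m Y],
    sign_comm false (M *m U) X & sign_comm false (M *m U) Y].
  move=> HM; have [b MX] := sc _ _ HM HX; have [c MY] := sc _ _ HM HY.
  have XX : sign_comm false X X by exact: sign_comm0.
  have YY : sign_comm false Y Y by exact: sign_comm0.
  have XY' := sign_comm1 XY; have YX' := sign_comm1 YX.
  case: b c MX MY => [] [] MX MY.
  - exists (X *m Y); rewrite !inE eqxx !orbT; split=> //.
      exact: (sign_commMl MX (sign_commMl XX YX')).
    exact: (sign_commMl MY (sign_commMl XY' YY)).
  - exists Y; rewrite !inE eqxx !orbT; split=> //.
      exact: (sign_commMl MX YX').
    exact: (sign_commMl MY YY).
  - exists X; rewrite !inE eqxx !orbT; split=> //.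
      exact: (sign_commMl MX XX).
    exact: (sign_commMl MY XY').
  - by exists 1%:M; rewrite !inE eqxx mulmx1; split.
have redC M N : M \in H -> N \in H -> sign_comm false M X -> sign_comm false M Y ->
    sign_comm false N X -> sign_comm false N Y -> M *m N = N *m M.
  move=> HM HN /sign_comm0E MX /sign_comm0E MY /sign_comm0E NX /sign_comm0E NY.
  case: (good_comm HG HM HN) => // MN; case: (no_quadruple HG HX HY HM HN XY MN) => //.
move=> Hh; have [U [HU hX hY]] := red h Hh.
have HU' := XYin U HU.
have hU_central : central (h *m U).
  split=> [|N HN]; first exact: (goodM HG).
  have [V [HV NX NY]] := red N HN; have HV' := XYin V HV.
  have VO := good_orthogonal HG HV'.
  have hN : h *m U *m (N *m V) = N *m V *m (h *m U).
    by apply: redC => //; exact: (goodM HG).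
  have hV : h *m U *m V = V *m (h *m U).
    apply/sign_comm0E; move: HV; rewrite !inE => /or4P[] /eqP -> //.
    - by apply: sign_comm0; rewrite mulmx1 mul1mx.
    - exact: (sign_commMr hX hY).
  have E : h *m U *m N *m V = N *m (h *m U) *m V.
    by rewrite -(mulmxA _ N) hN -(mulmxA N V) -hV !mulmxA.
  by rewrite -[LHS]mulmx1 -[RHS]mulmx1 -(orthogonalC VO) (mulmxA _ V) E !mulmxA.
exists (h *m U *m (U *m U)), U; split=> //.
  by apply: (centralM HG) => //; exact: square_central.
have := good_fourth HG HU'; rewrite -!mulmxA => U4.
by rewrite U4 mulmx1.
Qed.

Let A := X *m X.
Let B := Y *m Y.
Let cA : central A. Proof. exact: square_central. Qed.
Let cB : central B. Proof. exact: square_central. Qed.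

(** On a joint eigenvector of the centre with A = B = -1, the group would act
    through quaternions, and multiplication by X from the other side would be
    an antisymmetric matrix commuting with H; this is detected on v and X v. *)
Lemma no_quaternion v : dot v v = 1 ->
  (forall k, central k -> k *m v = v \/ k *m v = - v) ->
  A *m v = - v -> B *m v = - v -> False.
Proof.
move=> v1 vK Av Bv.
have XXv : X *m (X *m v) = - v by rewrite mulmxA.
have YYv : Y *m (Y *m v) = - v by rewrite mulmxA.
have XYv : X *m Y *m (X *m Y *m v) = - v.
  rewrite !mulmxA -(mulmxA X Y X) YX mulmxN mulNmx mulNmx mulmxA -/A -(mulmxA A Y Y) -/B.
  by rewrite -mulmxA Bv mulmxN Av opprK.
pose w := X *m v.
have w1 : dot w w = 1 by rewrite orthogonal_dot.
have Xv0 : dot (X *m v) v = 0 by exact: dot_skew.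
have Yv0 : dot (Y *m v) v = 0 by exact: dot_skew.
have XYO : orthogonal (X *m Y) by exact: orthogonalM.
have XYv0 : dot (X *m Y *m v) v = 0 by exact: dot_skew.
apply: (@star_contra _ _ HG v w) => //; first by rewrite dotC.
move=> h /central_decomposition [k [U [ck UXY ->]]].
have HU : U \in H.
  by move: UXY; rewrite !inE => /or4P[] /eqP -> //; [exact: (good1 HG)|exact: (goodM HG)].
have [b kv] : exists b : bool, k *m v = (-1) ^+ b *: v.
  by case: (vK _ ck) => ->; [exists false; rewrite scale1r | exists true; rewrite scaleN1r].
have kw : k *m w = (-1) ^+ b *: w.
  by rewrite /w mulmxA ck.2 // -mulmxA kv -scalemxAr.
rewrite (star_term_central ck HU kv kw) /star_term.
have YvXv : dot (Y *m v) (X *m v) = 0.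
  by rewrite -(orthogonal_dot _ _ XO) XXv dotNr mulmxA XYv0 oppr0.
have YXv0 : dot (Y *m (X *m v)) v = 0 by rewrite mulmxA YX mulNmx dotNl XYv0 oppr0.
move: UXY; rewrite !inE => /or4P[] /eqP ->.
- by rewrite !mul1mx w1 v1 Xv0 dotC Xv0 mulr0 subr0 mulr1.
- by rewrite Xv0 mulr0 /w XXv dotNl v1 w1; lra.
- by rewrite Yv0 YvXv !(mulr0, mul0r) subr0.
- have XYvw : dot (X *m Y *m v) w = 0 by rewrite -mulmxA orthogonal_dot.
  by rewrite XYv0 XYvw !(mulr0, mul0r) subr0.
Qed.

(** M where A = 1 and N where A = -1. *)
Definition glue M N := M *m half false A + N *m half true A.

Let half_C b N : N \in H -> N *m half b A = half b A *m N.
Proof. by move=> HN; apply: half_comm; rewrite cA.2. Qed.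

Let half_P b : projector (half b A).
Proof. by have [AT AA] := central_involution HG cA; exact: half_projector. Qed.

Let half_01 b : half b A *m half (~~ b) A = 0.
Proof.
have [AT AA] := central_involution HG cA.
rewrite {1}/half -scalemxAl mulmxDl mul1mx -scalemxAl half_mul // scalerA -signr_addb.
by case: b; rewrite /= expr1 scaleN1r subrr scaler0.
Qed.

Let half_sum : half false A + half true A = 1%:M.
Proof. by apply/matrixP => i j; rewrite !mxE /= ?expr0 ?expr1; lra. Qed.

Lemma glueM M N M' N' : M' \in H -> N' \in H ->
  glue M N *m glue M' N' = glue (M *m M') (N *m N').
Proof.
move=> HM HN; rewrite /glue mulmxDl !mulmxDr.
have E b c K L : L \in H -> K *m half b A *m (L *m half c A) =
    K *m L *m (half b A *m half c A).
  by move=> HL; rewrite -!mulmxA (mulmxA (half b A)) -half_C // !mulmxA.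
rewrite !E // (half_01 false) (half_01 true) !mulmx0 addr0 add0r.
by rewrite (half_P false).2 (half_P true).2.
Qed.

Lemma glueT M N : M \in H -> N \in H -> (glue M N)^T = glue M^T N^T.
Proof.
move=> HM HN; rewrite /glue linearD /= !trmx_mul (half_P false).1 (half_P true).1.
by rewrite -!half_C ?(goodT HG).
Qed.

Lemma glue1 : glue 1%:M 1%:M = 1%:M.
Proof. by rewrite /glue !mul1mx half_sum. Qed.

Lemma glue_orthogonal M N : M \in H -> N \in H -> orthogonal (glue M N).
Proof.
move=> HM HN; rewrite /orthogonal glueT // glueM //.
by rewrite (good_orthogonal HG HM) (good_orthogonal HG HN) glue1.
Qed.

Lemma glue_central k M N : central k -> M \in H -> N \in H ->
  k *m glue M N = glue M N *m k.
Proof.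
move=> ck HM HN; rewrite /glue mulmxDl mulmxDr !mulmxA !ck.2 //.
by rewrite -!mulmxA !half_C ?ck.1.
Qed.

Lemma glue_apply M N v (b : bool) : A *m v = (-1) ^+ b *: v ->
  glue M N *m v = (if b then N else M) *m v.
Proof.
move=> Av; rewrite /glue mulmxDl -!mulmxA.
have E c : half c A *m v = (b == c)%:R *: v.
  rewrite /half -scalemxAl mulmxDl mul1mx -scalemxAl Av scalerA -{1}[v]scale1r.
  rewrite -scalerDl scalerA; congr (_ *: _).
  by rewrite -signr_addb; case: b {Av}; case: c; rewrite /= ?expr0 ?expr1; lra.
by rewrite !E; case: b {Av E}; rewrite /= scale0r scale1r mulmx0 ?addr0 ?add0r.
Qed.

Let centre := [seq k <- H | `[< central k >]].

Let centreP k : central k -> k \in centre.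
Proof. by move=> ck; rewrite mem_filter ck.1 andbT; exact/asboolP. Qed.

Let centre_central k : k \in centre -> central k.
Proof. by rewrite mem_filter => /andP[/asboolP]. Qed.

Lemma quaternion_free : B *m half true A = half true A.
Proof.
have [Q QO QP] := central_frame HG centre_central.
have dA := QP _ (centreP cA); have dB := QP _ (centreP cB).
apply: (frame_ext QO) => i; rewrite -mulmxA (eigen_half true QO dA) -scalemxAr.
case nA: (neg Q A i); last by rewrite !scale0r.
rewrite !scale1r (negE i QO dB); case nB: (neg Q B i); rewrite ?scale1r //.
case: (@no_quaternion (col i Q)).
- by rewrite orthogonal_col // eqxx.
- by move=> k ck; exact: (QP _ (centreP ck)).
- by rewrite (negE i QO dA) nA expr1 scaleN1r.
- by rewrite (negE i QO dB) nB expr1 scaleN1r.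
Qed.

(** In each joint eigenspace of the centre, D is the one of X and Y that is an
    involution, and W anticommutes with it. *)
Let D := glue X Y.
Let BY := - (B *m Y).
Let HBY : BY \in H. Proof. by apply: (goodN HG); apply: (goodM HG) => //; exact: cB.1. Qed.
Let W := glue BY X.

Lemma glue_involution : D^T = D /\ D *m D = 1%:M.
Proof.
have XT Z : Z \in H -> Z^T = Z *m (Z *m Z).
  move=> HZ; have := good_fourth HG HZ; rewrite -!mulmxA => Z4.
  by rewrite -[LHS]mulmx1 -Z4 mulmxA (good_orthogonal HG HZ) mul1mx.
have [AT AA] := central_involution HG cA.
have DT : D^T = D.
  rewrite /D glueT // !XT // /glue -/A -/B -(mulmxA X A) -(mulmxA Y B).
  rewrite quaternion_free half_mul //.
  by rewrite expr0 scale1r.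
by split=> //; rewrite -{1}DT; exact: glue_orthogonal.
Qed.

Lemma glue_anticommute : D *m W = - (W *m D).
Proof.
have XBY : X *m BY = - (BY *m X).
  rewrite /BY mulmxN mulNmx opprK (mulmxA X B) -cB.2 // -(mulmxA B X) XY.
  by rewrite mulmxN opprK (mulmxA B Y).
by rewrite /D /W !glueM // XBY YX /glue !mulNmx opprD.
Qed.

(** On two vectors of the same joint eigenspace of the centre and of D, an element of
    H is a scalar or maps them to the other eigenspace of D; so no star term is
    negative. *)
Lemma joint_multiplicity v w (d : R) : dot v v = 1 -> dot w w = 1 -> dot v w = 0 ->
  d * d = 1 -> D *m v = d *: v -> D *m w = d *: w ->
  (forall k, central k -> exists b : bool, k *m v = (-1) ^+ b *: v /\ k *m w = (-1) ^+ b *: w) ->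
  False.
Proof.
move=> v1 w1 vw d2 Dv Dw kvw.
have [a [Av Aw]] := kvw _ cA.
apply: (@star_contra _ _ HG v w) => // h /central_decomposition [k [U [ck UXY ->]]].
have HU : U \in H.
  by move: UXY; rewrite !inE => /or4P[] /eqP -> //; [exact: (good1 HG)|exact: (goodM HG)].
have [b [kv kw]] := kvw _ ck; rewrite (star_term_central ck HU kv kw).
have one : star_term v w 1%:M = 1 by rewrite /star_term !mul1mx v1 w1 vw; lra.
have pos Z (e : R) : Z *m v = e *: v -> Z *m w = e *: w -> 0 <= star_term v w Z.
  move=> Zv Zw; rewrite /star_term Zv Zw !dotZl v1 w1 vw; nra.
have anti Z V : orthogonal Z -> Z *m v = d *: v -> Z *m w = d *: w ->
    Z *m V = - (V *m Z) -> 0 <= star_term v w V.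
  move=> ZO Zv Zw ZV; rewrite /star_term.
  rewrite (dot_anticommute_eigen ZO d2 Zw Zw ZV) (dot_anticommute_eigen ZO d2 Zv Zw ZV).
  by rewrite !mul0r subr0.
move: Dv Dw; rewrite /D (glue_apply _ _ Av) (glue_apply _ _ Aw).
case: a {Av Aw} => Zv Zw; move: UXY; rewrite !inE => /or4P[] /eqP ->; rewrite ?one //.
- by apply: (anti _ _ YO Zv Zw).
- by apply: pos Zv Zw.
- by apply: (anti _ _ YO Zv Zw); rewrite mulmxA YX mulNmx.
- by apply: pos Zv Zw.
- by apply: (anti _ _ XO Zv Zw).
- by apply: (anti _ _ XO Zv Zw); rewrite mulmxA -[in RHS]mulmxA YX mulmxN opprK mulmxA.
Qed.

(** The trace of D is zero, so that its (-1)-eigenspace has dimension 6; a frame u of it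
    that diagonalizes the centre, completed by W u, gives the planes. *)
Lemma plane_normal_form : exists2 Q, orthogonal Q & normal_form X Y Q.
Proof.
have [DT DD] := glue_involution.
have [|||Q0 Q0O Q0P] := @simultaneous_diagonalization R 12 (D :: centre).
- move=> k; rewrite inE => /orP[/eqP -> //|/centre_central ck].
  exact: (central_involution HG ck).1.
- move=> k; rewrite inE => /orP[/eqP -> //|/centre_central ck].
  exact: (central_involution HG ck).2.
- move=> k l; rewrite !inE => /orP[/eqP ->|/centre_central ck] /orP[/eqP ->|/centre_central cl] //.
  + by apply/esym/glue_central.
  + exact: glue_central.
  + by rewrite ck.2 ?cl.1.
have dD : diagonal Q0 D by move=> i; apply: Q0P; rewrite mem_head.
have dK k : central k -> diagonal Q0 k.
  by move=> ck i; apply: Q0P; rewrite inE centreP ?orbT.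
pose P0 := [set i | neg Q0 D i]%SET.
have cP0 : #|P0| = 6%N.
  have HhA b N : N \in H -> N *m half b A = half b A *m N by exact: half_C.
  have trD : \tr D = 0.
    have t0 (U V : 'M[R]_12) b : U \in H -> U *m V = - (V *m U) -> \tr (V *m half b A) = 0.
      move=> HU UV; apply: (trace_anticommute (good_orthogonal HG HU)).
      by rewrite (mulmxA U V) UV mulNmx -(mulmxA V) HhA // mulmxA.
    by rewrite /D /glue mxtraceD (t0 Y) ?(t0 X) ?addr0.
  have : \tr (1%:M - D) = 2 * #|P0|%:R.
    rewrite (eigen_trace Q0O (eigen_minus Q0O dD)) -mulr_sumr -natr_sum.
    congr (_ * _%:R); rewrite -sum1_card [RHS]big_mkcond; apply: eq_bigr => i _.
    by rewrite inE; case: (neg _ _ _).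
  rewrite raddfB /= trD mxtrace1 subr0 -natrM => /eqP; rewrite eqr_nat => /eqP.
  by move: #|P0| => c; lia.
pose en (p : 'I_6) : 'I_12 := enum_val (cast_ord (esym cP0) p).
have enP p : neg Q0 D (en p) by have := enum_valP (cast_ord (esym cP0) p); rewrite inE.
have en_inj p q : (en p == en q) = (p == q).
  by rewrite (inj_eq (@enum_val_inj _ _)) (inj_eq (@cast_ord_inj _ _ _)).
pose u p := col (en p) Q0; pose w p := W *m u p.
have WO : orthogonal W by exact: glue_orthogonal.
have DO : orthogonal D by rewrite /orthogonal DT.
have Du p : D *m u p = - u p by rewrite /u negE // enP expr1 scaleN1r.
have uu p q : dot (u p) (u q) = (p == q)%:R by rewrite orthogonal_col // en_inj.
have ww p q : dot (w p) (w q) = (p == q)%:R by rewrite orthogonal_dot.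
have uw p q : dot (u p) (w q) = 0.
  have Dw : D *m w q = w q by rewrite /w mulmxA glue_anticommute mulNmx -mulmxA Du mulmxN opprK.
  by have := orthogonal_dot (u p) (w q) DO; rewrite Du Dw dotNl; lra.
pose Q := plane_frame u w; have QO : orthogonal Q by exact: plane_frame_orthogonal.
have Ku k p : central k -> k *m u p = (-1) ^+ neg Q0 k (en p) *: u p.
  by move=> ck; rewrite /u negE //; exact: dK.
have Kw k p : central k -> k *m w p = (-1) ^+ neg Q0 k (en p) *: w p.
  by move=> ck; rewrite /w mulmxA glue_central // -mulmxA Ku // -scalemxAr.
have nlo k p : central k -> neg Q k (lo p) = neg Q0 k (en p).
  by move=> ck; apply: neg_eq => //; rewrite plane_frame_lo Ku.
have nhi k p : central k -> neg Q k (hi p) = neg Q0 k (en p).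
  by move=> ck; apply: neg_eq => //; rewrite plane_frame_hi Kw.
have dQ k : central k -> diagonal Q k.
  move=> ck; apply: planeP => p; rewrite ?plane_frame_lo ?plane_frame_hi ?Ku ?Kw //;
  by case: (neg _ _ _); rewrite ?expr0 ?expr1 ?scale1r ?scaleN1r; [right|left].
exists Q => //; rewrite /normal_form -/A -/B.
have notboth p : ~~ (neg Q A (lo p) && neg Q B (lo p)).
  apply/negP => /andP[]; rewrite !nlo // => nA nB.
  apply: (@no_quaternion (u p)).
  - by rewrite uu eqxx.
  - move=> k ck; rewrite Ku //.
    by case: (neg _ _ _); rewrite ?expr0 ?expr1 ?scale1r ?scaleN1r; [right|left].
  - by rewrite Ku // nA expr1 scaleN1r.
  - by rewrite Ku // nB expr1 scaleN1r.
split=> //.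
- by move=> k ck; split=> [|p]; [exact: dQ|rewrite nlo ?nhi].
- move=> p q pq; apply/not_exists2P => no.
  apply: (@joint_multiplicity (u p) (u q) (-1)); rewrite ?uu ?eqxx ?(negbTE pq) ?scaleN1r ?Du //.
    by rewrite mulrNN mulr1.
  move=> k ck; exists (neg Q0 k (en p)); split; first exact: Ku.
  rewrite Ku //; congr (_ ^+ nat_of_bool _ *: _).
  by case: (no k) => // /negP/negPn/eqP; rewrite !nlo.
- move=> p /=; rewrite plane_frame_lo plane_frame_hi.
  have Au := Ku _ p cA; have Bu := Ku _ p cB.
  have := notboth p; rewrite !nlo //.
  have := Du p; rewrite /D (glue_apply _ _ Au) => {}Du.
  have := erefl (w p); rewrite {2}/w /W (glue_apply _ _ Au) => wE.
  move: Au Bu Du wE; case: (neg Q0 A (en p)); case: (neg Q0 B (en p)) => //=;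
    rewrite ?expr0 ?expr1 ?scale1r ?scaleN1r => Au Bu Du wE _.
  + have Xu : X *m u p = w p by [].
    split=> //; first by rewrite -Xu mulmxA.
    by rewrite -Xu mulmxA YX mulNmx -mulmxA Du mulmxN opprK.
  + have Yu : Y *m u p = w p by rewrite wE /BY mulNmx cB.2 // -mulmxA Bu mulmxN opprK.
    split=> //; last by rewrite -Yu mulmxA.
    by rewrite -Yu mulmxA XY mulNmx -mulmxA Du mulmxN opprK.
  + have Yu : Y *m u p = - w p by rewrite wE /BY mulNmx opprK cB.2 // -mulmxA Bu.
    have wY : w p = - (Y *m u p) by rewrite Yu opprK.
    split=> //; last by rewrite wY mulmxN mulmxA Bu.
    by rewrite {1}wY mulmxN mulmxA XY mulNmx opprK -mulmxA Du mulmxN.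
- move=> k ck.
  have par Z U : Z \in H -> U \in H -> U *m Z = - (Z *m U) ->
      ~~ odd (\sum_p (neg Q k (lo p) && ~~ neg Q (Z *m Z) (lo p))).
    move=> HZ HU UZ; have [d d_even] := even_central HG ck HZ HU UZ.
    have cZ : central (Z *m Z) by exact: square_central.
    rewrite (eigen_trace QO (eigenM (eigen_minus QO (dQ _ ck)) (eigen_plus QO (dQ _ cZ)))).
    have term i : 2 * (neg Q k i)%:R * (2 * (~~ neg Q (Z *m Z) i)%:R) =
        4 * (neg Q k i && ~~ neg Q (Z *m Z) i : nat)%:R :> R.
      by case: (neg Q k i); case: (neg Q _ i); rewrite /=; lra.
    rewrite (eq_bigr _ (fun i _ => term i)).
    rewrite -mulr_sumr -natr_sum -natrM => /eqP; rewrite eqr_nat => /eqP.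
    rewrite sum_planes_nat; under eq_bigr => p _ do rewrite !nhi // !nlo //.
    rewrite big_split /=; under [in X in _ -> X]eq_bigr => p _ do rewrite !nlo //.
    by move: (\sum_p _)%N => t E; have -> : t = d by lia.
  split; [exact: (par X Y)|by apply: (par Y X)|].
  have HXY : X *m Y \in H by exact: (goodM HG).
  have XYX : X *m (X *m Y) = - (X *m Y *m X) by rewrite -mulmxA YX mulmxN opprK.
  have := par _ _ HXY HX XYX; congr (~~ odd _); apply: eq_bigr => p _; congr (nat_of_bool (_ && _)).
  have [dAB nAB] := diagonalM QO (dQ _ cA) (dQ _ cB).
  rewrite -nAB -[RHS]negbK; congr (~~ _).
  have -> : X *m Y *m (X *m Y) = - (A *m B).
    by rewrite -mulmxA (mulmxA Y) YX mulNmx mulmxN /A /B !mulmxA.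
  by apply: neg_eq => //; rewrite mulNmx negE //; case: (neg _ _ _);
    rewrite ?expr0 ?expr1 ?scale1r ?scaleN1r ?opprK.
Qed.

End Nonabelian.

(** * The two types of nonabelian groups *)

Section Types.
Context {R : realType} {H : seq 'M[R]_12} (HG : good_group H).
Implicit Types (Z W M N k l : 'M[R]_12) (v w : 'cV[R]_12) (Q : 'M[R]_12).
Notation central := (central (H := H)).

Definition plane_monomial Q M (f s0 s1 : 'I_6 -> bool) := forall p,
  M *m col (lo p) Q = (-1) ^+ s0 p *: col (if f p then hi p else lo p) Q /\
  M *m col (hi p) Q = (-1) ^+ s1 p *: col (if f p then lo p else hi p) Q.

Definition plane_sign (s : 'I_6 -> bool) Q M := plane_monomial Q M xpred0 s s.

Lemma plane_signP Q M : orthogonal Q -> diagonal Q M ->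
  (forall p, neg Q M (hi p) = neg Q M (lo p)) ->
  plane_sign (fun p => neg Q M (lo p)) Q M.
Proof. by move=> QO MQ Mp p; split=> /=; rewrite (negE _ QO MQ) ?Mp. Qed.

Lemma plane_sign_ext Q M N s t : orthogonal Q -> plane_sign s Q M -> plane_sign t Q N ->
  s =1 t -> M = N.
Proof.
move=> QO Ms Nt st; apply: (frame_ext QO); apply: planeP => p.
  by rewrite (Ms p).1 (Nt p).1 /= st.
by rewrite (Ms p).2 (Nt p).2 /= st.
Qed.

Lemma plane_signM Q M N s t : plane_sign s Q M -> plane_sign t Q N ->
  plane_sign (fun p => s p (+) t p) Q (M *m N).
Proof.
move=> Ms Nt p; rewrite -!mulmxA; have [-> ->] := Nt p; rewrite /= -!scalemxAr.
by have [-> ->] := Ms p; rewrite /= !scalerA -!signr_addb addbC.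
Qed.

Lemma plane_signN Q : plane_sign xpredT Q (- 1%:M).
Proof. by move=> p; rewrite !mulNmx !mul1mx /= expr1 !scaleN1r. Qed.

Lemma plane_sign1 Q : plane_sign xpred0 Q 1%:M.
Proof. by move=> p; rewrite !mul1mx /= expr0 !scale1r. Qed.

Lemma plane_sign_neg Q M s p : orthogonal Q -> plane_sign s Q M ->
  neg Q M (lo p) = s p /\ neg Q M (hi p) = s p.
Proof. by move=> QO Ms; split; apply: neg_eq => //; case: (Ms p). Qed.

(** These are the planes whose sign is changed by the generator of F1, F2 or F3 with the
    same name. *)
Definition word_b1 (p : 'I_6) := (p < 2)%N.
Definition word_b2 (p : 'I_6) := (1 < p < 4)%N.
Definition word_b3 (p : 'I_6) := (0 < p < 3)%N.
Definition word_b4 (p : 'I_6) := (2 < p < 5)%N.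
Definition word_a1 (p : 'I_6) := (p < 3)%N.

(** The matrix -1, which is the image of c, comes for free. *)
Definition generates (gens : seq 'M[R]_12) := forall G : 'M[R]_12 -> Prop,
  (forall M N, G M -> G N -> G (M *m N)) -> G (- 1%:M) ->
  (forall M, M \in gens -> G M) -> forall h, h \in H -> G h.

Lemma big6 (F : 'I_6 -> nat) :
  (\sum_p F p = F (inord 0) + F (inord 1) + F (inord 2) + F (inord 3) + F (inord 4) + F (inord 5))%N.
Proof.
rewrite (eq_bigr (fun p : 'I_6 => F (inord p))) => [|p _]; last by rewrite inord_val.
by rewrite -(big_mkord xpredT (fun i => F (inord i))) !big_nat_recr ?big_geq.
Qed.

Lemma even_words : [/\ ~~ odd (\sum_p word_b1 p), ~~ odd (\sum_p word_b2 p),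
  ~~ odd (\sum_p word_b3 p) & ~~ odd (\sum_p word_b4 p)].
Proof. by split; rewrite big6 /word_b1 /word_b2 /word_b3 /word_b4 !inordK. Qed.

(** The words of the first four generators separate the six planes. *)
Lemma adjacent_generate Q (G : 'M[R]_12 -> Prop) (m1 m2 m3 m4 : 'M[R]_12) :
  orthogonal Q -> (forall M N, G M -> G N -> G (M *m N)) -> G (- 1%:M) ->
  G m1 -> G m2 -> G m3 -> G m4 ->
  plane_sign word_b1 Q m1 -> plane_sign word_b2 Q m2 ->
  plane_sign word_b3 Q m3 -> plane_sign word_b4 Q m4 ->
  forall k s, plane_sign s Q k -> ~~ odd (\sum_p s p) -> G k.
Proof.
move=> QO GM GN G1 G2 G3 G4 M1 M2 M3 M4 k s ks s_even.
pose C (w : {ffun 'I_6 -> bool}) := exists2 g, G g & plane_sign w Q g.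
have wE (t : 'I_6 -> bool) : plane_sign [ffun p => t p] Q = plane_sign t Q.
  by congr plane_sign; apply/funext => p; rewrite ffunE.
suff [g Gg gs] : C [ffun p => s p].
  by rewrite wE in gs; rewrite (plane_sign_ext QO ks gs).
apply: even_code_full.
- move=> a b [g Gg ga] [h Gh hb]; exists (g *m h); first exact: GM.
  have := plane_signM ga hb; congr (plane_sign _ _ _).
  by apply/funext => p; rewrite ffunE.
- by exists (- 1%:M) => //; rewrite wE; exact: plane_signN.
- have w2 (t : 'I_6 -> bool) m : G m -> plane_sign t Q m -> ~~ odd (\sum_p t p) ->
      [/\ C [ffun p => t p] & ~~ odd (weight [ffun p => t p])].
    move=> Gm mt te; split; first by exists m => //; rewrite wE.
    by rewrite /weight; under eq_bigr => p _ do rewrite ffunE.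
  have [o1 o2 o3 o4] := even_words.
  have [c1 e1] := w2 _ _ G1 M1 o1; have [c2 e2] := w2 _ _ G2 M2 o2.
  have [c3 e3] := w2 _ _ G3 M3 o3; have [c4 e4] := w2 _ _ G4 M4 o4.
  move=> p q pq.
  have : [|| word_b1 p != word_b1 q, word_b2 p != word_b2 q, word_b3 p != word_b3 q
         | word_b4 p != word_b4 q].
    move: pq; rewrite -val_eqE /word_b1 /word_b2 /word_b3 /word_b4 /=.
    by case: p => [[|[|[|[|[|[|//]]]]]] ?]; case: q => [[|[|[|[|[|[|//]]]]]] ?].
  case/or4P => ne; [exists [ffun p => word_b1 p]|exists [ffun p => word_b2 p]|
    exists [ffun p => word_b3 p]|exists [ffun p => word_b4 p]]; split=> //; by rewrite !ffunE.
- by rewrite /weight; under eq_bigr => p _ do rewrite ffunE.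
Qed.

Lemma normal_form_perm X Y Q (f : 'I_6 -> 'I_6) : injective f -> orthogonal Q ->
  normal_form (H := H) X Y Q -> exists Q', [/\ orthogonal Q', normal_form (H := H) X Y Q' &
    forall M p, neg Q' M (lo p) = neg Q M (lo (f p))].
Proof.
move=> f_inj QO [n1 n2 n3 n4 n5].
pose Q' := plane_frame (fun p => col (lo (f p)) Q) (fun p => col (hi (f p)) Q).
have clo p : col (lo p) Q' = col (lo (f p)) Q by rewrite plane_frame_lo.
have chi p : col (hi p) Q' = col (hi (f p)) Q by rewrite plane_frame_hi.
have nlo M p : neg Q' M (lo p) = neg Q M (lo (f p)) by rewrite /neg clo.
have nhi M p : neg Q' M (hi p) = neg Q M (hi (f p)) by rewrite /neg chi.
exists Q'; split=> //.
  apply: plane_frame_orthogonal => p q; rewrite orthogonal_col // ?lo_eq ?hi_eq ?lo_hi //;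
  by rewrite (inj_eq f_inj).
have re (F : 'I_6 -> bool) : (\sum_p F (f p) = \sum_p F p)%N.
  by rewrite [RHS](reindex f) //; apply: onW_bij; exact: injF_bij.
split.
- move=> k /n1 [kQ kn]; split; last by move=> p; rewrite nlo nhi kn.
  by apply: planeP => p; rewrite ?clo ?chi; exact: kQ.
- by move=> p; rewrite !nlo.
- by move=> p q pq; have [|k ck kpq] := n3 (f p) (f q); [rewrite (inj_eq f_inj)|exists k; rewrite ?nlo].
- by move=> p; rewrite clo chi !nlo; exact: n4.
move=> k ck; under eq_bigr => p _ do rewrite !nlo.
under [in X in [/\ _, X & _]]eq_bigr => p _ do rewrite !nlo.
under [in X in [/\ _, _ & X]]eq_bigr => p _ do rewrite !nlo.
have [e1 e2 e3] := n5 k ck; split.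
- by rewrite (re (fun p => neg Q k (lo p) && ~~ neg Q (X *m X) (lo p))).
- by rewrite (re (fun p => neg Q k (lo p) && ~~ neg Q (Y *m Y) (lo p))).
- by rewrite (re (fun p => neg Q k (lo p) && (neg Q (X *m X) (lo p) (+) neg Q (Y *m Y) (lo p)))).
Qed.

(** X acts as delta and Y acts as b5. *)
Definition type3 X Y : Prop := exists Q m1 m2 m3 m4,
  [/\ orthogonal Q, [/\ m1 \in H, m2 \in H, m3 \in H & m4 \in H],
    [/\ plane_sign word_b1 Q m1, plane_sign word_b2 Q m2,
        plane_sign word_b3 Q m3 & plane_sign word_b4 Q m4],
    plane_monomial Q X xpredT xpred0 xpredT /\ plane_monomial Q Y xpred0 xpredT xpred0 &
    generates [:: m1; m2; m3; m4; Y; X]].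

(** When all planes are of the type of X ^ 2 = -1, the centre changes signs of even
    numbers of planes by the parity conditions, and makes all such changes since it
    separates the planes. *)
Lemma type3_normal_form X Y : X \in H -> Y \in H -> X *m Y = - (Y *m X) ->
  X *m X = - 1%:M -> type3 X Y.
Proof.
move=> HX HY XY XX; have [Q QO [n1 n2 n3 n4 n5]] := plane_normal_form HG HX HY XY.
have nXX p : neg Q (X *m X) (lo p) = true.
  by rewrite XX; case: (plane_sign_neg p QO (plane_signN Q)).
have nYY p : neg Q (Y *m Y) (lo p) = false by have := n2 p; rewrite nXX; case: (neg _ _ _).
have ks k : central k -> plane_sign (fun p => neg Q k (lo p)) Q k.
  by move=> /n1[kQ kn]; exact: plane_signP.
have k_even k : central k -> ~~ odd (\sum_p neg Q k (lo p)).
  move=> /n5[_ _]; congr (~~ odd _); apply: eq_bigr => p _.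
  by rewrite nXX nYY andbT.
have all_even (s : 'I_6 -> bool) : ~~ odd (\sum_p s p) ->
    exists2 k, central k & plane_sign s Q k.
  move=> s_even; pose C (w : {ffun 'I_6 -> bool}) :=
    exists2 k, central k & forall p, neg Q k (lo p) = w p.
  suff [k ck kw] : C [ffun p => s p].
    exists k => //; have := ks k ck; congr plane_sign; apply/funext => p.
    by rewrite kw ffunE.
  apply: even_code_full.
  - move=> a b [k ck ka] [l cl lb]; exists (k *m l); first exact: (centralM HG).
    have [dk _] := n1 k ck; have [dl _] := n1 l cl.
    by move=> p; rewrite (diagonalM QO dk dl).2 ffunE ka lb.
  - exists (- 1%:M); first exact/(centralN HG)/(central1 HG).
    by move=> p; rewrite ffunE; case: (plane_sign_neg p QO (plane_signN Q)).
  - move=> p q /n3[k ck kpq]; exists [ffun p => neg Q k (lo p)].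
    rewrite !ffunE; split=> //; first by exists k => // r; rewrite ffunE.
    by rewrite /weight; under eq_bigr => r _ do rewrite ffunE; exact: k_even.
  - by rewrite /weight; under eq_bigr => p _ do rewrite ffunE.
have [o1 o2 o3 o4] := even_words.
have [m1 c1 w1] := all_even _ o1; have [m2 c2 w2] := all_even _ o2.
have [m3 c3 w3] := all_even _ o3; have [m4 c4 w4] := all_even _ o4.
exists Q, m1, m2, m3, m4; split=> //.
- by split; [case: c1|case: c2|case: c3|case: c4].
- split=> p; have := n4 p; rewrite nXX nYY /= => -[E1 E2 E3 E4];
  by rewrite /= ?E1 ?E2 ?E3 ?E4 ?expr0 ?expr1 ?scale1r ?scaleN1r.
move=> G GM GN Gg h Hh.
have Gk k : central k -> G k.
  move=> ck; apply: (adjacent_generate QO GM GN _ _ _ _ w1 w2 w3 w4 (ks k ck) (k_even k ck));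
  by apply: Gg; rewrite !inE eqxx ?orbT.
have [k [U [ck UXY ->]]] := central_decomposition HG HX HY XY Hh.
apply: (GM); first exact: Gk.
have GX : G X by apply: Gg; rewrite !inE eqxx !orbT.
have GY : G Y by apply: Gg; rewrite !inE eqxx !orbT.
move: UXY; rewrite !inE => /or4P[] /eqP -> //; last exact: GM.
exact/Gk/(central1 HG).
Qed.

(** X acts as a2 and Y acts as a3; the type of a plane is its number modulo 3, and the
    central generator changes the signs of one plane of each type. *)
Definition type1 X Y : Prop := exists Q m,
  [/\ orthogonal Q, m \in H, plane_sign word_a1 Q m,
    plane_monomial Q X (fun p => p %% 3 == 2)%N (fun p => p %% 3 != 2)%N (fun p => p %% 3 == 2)%N /\
    plane_monomial Q Y (fun p => p %% 3 != 2)%N (fun p => p %% 3 != 1)%N (fun p => p %% 3 != 2)%N &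
    generates [:: m; X; Y]].

(** Complements of even subsets of an odd set are odd, and so is what remains when two
    disjoint odd subsets are removed. *)
Lemma odd_types (a b k : 'I_6 -> bool) : odd (\sum_p k p) ->
  ~~ odd (\sum_p (k p && ~~ a p)) -> ~~ odd (\sum_p (k p && ~~ b p)) ->
  (forall p, ~~ (a p && b p)) ->
  [/\ odd (\sum_p (k p && a p)), odd (\sum_p (k p && b p)) &
      odd (\sum_p (k p && ~~ a p && ~~ b p))].
Proof.
move=> ko ka kb ab.
have E1 : (\sum_p k p = \sum_p (k p && a p) + \sum_p (k p && ~~ a p))%N.
  by rewrite -big_split; apply: eq_bigr => p _; case: (k p); case: (a p).
have E2 : (\sum_p k p = \sum_p (k p && b p) + \sum_p (k p && ~~ b p))%N.
  by rewrite -big_split; apply: eq_bigr => p _; case: (k p); case: (b p).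
have E3 : (\sum_p k p = \sum_p (k p && a p) + \sum_p (k p && b p) +
    \sum_p (k p && ~~ a p && ~~ b p))%N.
  rewrite -!big_split; apply: eq_bigr => p _ /=.
  by case: (k p); case: (a p) (b p) (ab p) => [] [].
by move: ko ka kb E1 E2 E3; do !move: (\sum_p _)%N => ?; split; lia.
Qed.

(** If some central element changes the signs of an odd number of planes, then
    it changes, and so does its opposite, an odd number of planes of each of
    the three types.  As there are six planes, there is exactly one plane for
    each type and each sign. *)
Lemma type1_normal_form X Y Q k : X \in H -> Y \in H -> X *m Y = - (Y *m X) ->
  orthogonal Q -> normal_form (H := H) X Y Q -> central k ->
  odd (\sum_p neg Q k (lo p)) -> type1 X Y.
Proof.
move=> HX HY XY QO nf ck k_odd; have [n1 n2 n3 n4 n5] := nf.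
pose a p := neg Q (X *m X) (lo p); pose b p := neg Q (Y *m Y) (lo p).
pose kn (e : bool) p := neg Q k (lo p) (+) e.
have odd_e e : [/\ odd (\sum_p (kn e p && a p)), odd (\sum_p (kn e p && b p)) &
    odd (\sum_p (kn e p && ~~ a p && ~~ b p))].
  have [dk _] := n1 k ck.
  have cN : central (- k) by exact: (centralN HG).
  have nN p : neg Q (- k) (lo p) = ~~ neg Q k (lo p).
    by apply: neg_eq => //; rewrite mulNmx negE //; case: (neg _ _ _);
      rewrite ?expr0 ?expr1 ?scale1r ?scaleN1r ?opprK.
  case: e; last first.
    have [e1 e2 _] := n5 k ck.
    rewrite /kn; under eq_bigr => p _ do rewrite addbF.
    under [in X in [/\ _, X & _]]eq_bigr => p _ do rewrite addbF.
    under [in X in [/\ _, _ & X]]eq_bigr => p _ do rewrite addbF.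
    exact: odd_types.
  have [e1 e2 _] := n5 _ cN.
  rewrite /kn; under eq_bigr => p _ do rewrite addbT -nN.
  under [in X in [/\ _, X & _]]eq_bigr => p _ do rewrite addbT -nN.
  under [in X in [/\ _, _ & X]]eq_bigr => p _ do rewrite addbT -nN.
  apply: odd_types => //.
  have : (\sum_p neg Q (- k) (lo p) + \sum_p neg Q k (lo p) = \sum_(p < 6) 1)%N.
    by rewrite -big_split; apply: eq_bigr => p _; rewrite nN; case: (neg _ _ _).
  rewrite sum_nat_const card_ord; move: k_odd; move: (\sum_p _)%N (\sum_p _)%N.
  by move=> x y; lia.
pose typ p : nat := if a p then 2%N else if b p then 1%N else 0%N.
have odd_ex (F : 'I_6 -> bool) : odd (\sum_p F p) -> exists p, F p.
  move=> oF; apply/not_existsP => noF; move: oF; rewrite big1 // => p _.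
  by case: (F p) (noF p).
have pick (q : 'I_6) : exists p, typ p = (q %% 3)%N /\ neg Q k (lo p) = (q < 3)%N.
  have [o2 o1 o0] := odd_e (~~ (q < 3)%N).
  have knE p : kn (~~ (q < 3)%N) p -> neg Q k (lo p) = (q < 3)%N.
    by rewrite /kn; case: (neg _ _ _); case: (q < 3)%N.
  have : (q %% 3 < 3)%N by rewrite ltn_mod.
  case: (q %% 3)%N => [|[|[|//]]] _.
  - have [p /andP[/andP[kp ap] bp]] := odd_ex _ o0; exists p.
    by rewrite /typ (negbTE ap) (negbTE bp) (knE _ kp).
  - have [p /andP[kp bp]] := odd_ex _ o1; exists p.
    have ap : a p = false by have := n2 p; rewrite -/(a p) -/(b p) bp andbT => /negbTE.
    by rewrite /typ ap bp (knE _ kp).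
  - have [p /andP[kp ap]] := odd_ex _ o2; exists p.
    by rewrite /typ ap (knE _ kp).
have [f fP] := choice pick.
have f_inj : injective f.
  move=> p q E; apply: val_inj; have [t1 k1] := fP p; have [t2 k2] := fP q.
  rewrite -E in t2 k2; have := ltn_ord p; have := ltn_ord q.
  rewrite t1 in t2; rewrite k1 in k2; move: t2 k2 => /=; lia.
have [Q' [Q'O nf' nE]] := normal_form_perm f_inj QO nf; have [n1' n2' n3' n4' n5'] := nf'.
have nA p : neg Q' (X *m X) (lo p) = (p %% 3 == 2)%N.
  have [<- _] := fP p; rewrite nE -/(a (f p)) /typ.
  by case: (a (f p)); case: (b (f p)).
have nB p : neg Q' (Y *m Y) (lo p) = (p %% 3 == 1)%N.
  have [<- _] := fP p; rewrite nE -/(b (f p)) /typ.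
  by have := n2 (f p); rewrite -/(a (f p)) -/(b (f p)); case: (a (f p)); case: (b (f p)).
have cs l (s : 'I_6 -> bool) : central l -> (forall p, neg Q' l (lo p) = s p) -> plane_sign s Q' l.
  move=> cl ls; have [dl nl] := n1' l cl; have := plane_signP Q'O dl nl.
  by congr plane_sign; apply/funext => p; rewrite ls.
have kw : plane_sign word_a1 Q' k.
  by apply: cs => // p; rewrite nE; case: (fP p).
have cA : central (X *m X) by exact: square_central.
have cB : central (Y *m Y) by exact: square_central.
exists Q', k; split=> //; first by case: ck.
  by split=> p; have := n4' p; rewrite nA nB /= => -[E1 E2 E3 E4]; rewrite /= ?E1 ?E2 ?E3 ?E4;
    have : (p %% 3 < 3)%N by [rewrite ltn_mod]; case: (p %% 3)%N => [|[|[|//]]] _ /=;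
    rewrite ?expr0 ?expr1 ?scale1r ?scaleN1r.
move=> G GM GN Gg h Hh.
have Gk : G k by apply: Gg; rewrite !inE eqxx.
have GX : G X by apply: Gg; rewrite !inE eqxx !orbT.
have GY : G Y by apply: Gg; rewrite !inE eqxx !orbT.
have G1 : G 1%:M by have := GM _ _ GN GN; rewrite mulNmx mulmxN opprK mulmx1.
pose pw (e : bool) (M : 'M[R]_12) := if e then M else 1%:M.
have Gpw e M : G M -> G (pw e M) by case: e.
have spw e s M : plane_sign s Q' M -> plane_sign (fun p => e && s p) Q' (pw e M).
  by case: e => // _; exact: plane_sign1.
have Gcentral l : central l -> G l.
  move=> cl; pose s i := neg Q' l (lo (inord i)).
  pose g := pw (s 0%N (+) s 3%N) k *m (pw (s 5%N) (X *m X) *m (pw (s 4%N) (Y *m Y) *m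
    pw (s 3%N) (- 1%:M *m (X *m X *m (Y *m Y))))).
  suff -> : l = g by do ?[apply: (GM)]; apply: Gpw => //; do ?[apply: (GM)].
  have sA := cs _ _ cA nA; have sB := cs _ _ cB nB.
  have gs := plane_signM (spw (s 0%N (+) s 3%N) _ _ kw) (plane_signM (spw (s 5%N) _ _ sA)
    (plane_signM (spw (s 4%N) _ _ sB)
       (spw (s 3%N) _ _ (plane_signM (plane_signN Q') (plane_signM sA sB))))).
  apply: (plane_sign_ext Q'O (cs l _ cl (fun p => erefl)) gs) => p.
  have [] := n5' l cl; rewrite !big6 !nA !nB !inordK // -!/(s _) /=.
  have -> : neg Q' l (lo p) = s p by rewrite /s inord_val.
  rewrite /word_a1; case: p => [[|[|[|[|[|[|//]]]]]] ?] /=;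
  by case: (s 0%N); case: (s 1%N); case: (s 2); case: (s 3); case: (s 4); case: (s 5).
have [l [U [cl UXY ->]]] := central_decomposition HG HX HY XY Hh.
apply: (GM); first exact: Gcentral.
by move: UXY; rewrite !inE => /or4P[] /eqP -> //; exact: GM.
Qed.

(** By the parity conditions, the central elements also change the signs of an even
    number of planes of each type.  Hence no type can have exactly two planes, as the
    centre would not separate them; since the types have even size, as is seen from
    the central element -1, one has all six. *)
Lemma one_type X Y Q : X \in H -> Y \in H -> X *m Y = - (Y *m X) ->
  orthogonal Q -> normal_form (H := H) X Y Q ->
  (forall k, central k -> ~~ odd (\sum_p neg Q k (lo p))) ->
  [\/ X *m X = - 1%:M, Y *m Y = - 1%:M | X *m Y *m (X *m Y) = - 1%:M].
Proof.
move=> HX HY XY QO [n1 n2 n3 n4 n5] k_even.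
pose a p := neg Q (X *m X) (lo p); pose b p := neg Q (Y *m Y) (lo p).
have no_two (c : 'I_6 -> bool) : (forall k, central k ->
    ~~ odd (\sum_p (neg Q k (lo p) && c p))) -> (\sum_p c p != 2)%N.
  move=> kc; apply/negP => c2.
  have : #|[set p | c p]%SET| == 2.
    have -> // : #|[set p | c p]%SET| = (\sum_p c p)%N.
    rewrite -sum1_card big_mkcond; apply: eq_bigr => p _.
    by rewrite inE; case: (c p).
  case/cards2P => p [q [pq cE]]; have [k ck kpq] := n3 p q pq.
  have cP r : c r = (r == p) || (r == q) by have /setP/(_ r) := cE; rewrite !inE.
  have := kc k ck; rewrite (bigD1 p) //= (bigD1 q) 1?eq_sym //= big1 => [|r /andP[rp rq]].
    by rewrite !cP !eqxx orbT !andbT addn0 oddD; move: kpq; case: (neg _ _ _); case: (neg _ _ _).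
  by rewrite cP (negbTE rp) (negbTE rq) andbF.
have par k : central k -> [/\ ~~ odd (\sum_p (neg Q k (lo p) && a p)),
    ~~ odd (\sum_p (neg Q k (lo p) && b p)) &
    ~~ odd (\sum_p (neg Q k (lo p) && (~~ a p && ~~ b p)))].
  move=> ck; have [e1 e2 e3] := n5 k ck; have := k_even k ck.
  move: e1 e2 e3; rewrite -/a -/b => e1 e2 e3 e.
  have E1 : (\sum_p neg Q k (lo p) = \sum_p (neg Q k (lo p) && a p) +
      \sum_p (neg Q k (lo p) && ~~ a p))%N.
    by rewrite -big_split; apply: eq_bigr => p _; case: (neg _ _ _); case: (a p).
  have E2 : (\sum_p neg Q k (lo p) = \sum_p (neg Q k (lo p) && b p) +
      \sum_p (neg Q k (lo p) && ~~ b p))%N.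
    by rewrite -big_split; apply: eq_bigr => p _; case: (neg _ _ _); case: (b p).
  have E3 : (\sum_p neg Q k (lo p) = \sum_p (neg Q k (lo p) && a p) +
      \sum_p (neg Q k (lo p) && b p) + \sum_p (neg Q k (lo p) && (~~ a p && ~~ b p)))%N.
    rewrite -!big_split; apply: eq_bigr => p _ /=; have := n2 p; rewrite -/(a p) -/(b p).
    by case: (neg _ _ _); case: (a p); case: (b p).
  have {}e1 : ~~ odd (\sum_p (neg Q k (lo p) && ~~ a p)) by [].
  have {}e2 : ~~ odd (\sum_p (neg Q k (lo p) && ~~ b p)) by [].
  by move: e e1 e2 E1 E2 E3; do !move: (\sum_p _)%N => ?; split; lia.
have cN : central (- 1%:M) by exact/(centralN HG)/(central1 HG).
have nN p : neg Q (- 1%:M) (lo p) = true by case: (plane_sign_neg p QO (plane_signN Q)).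
have [] := par _ cN.
under eq_bigr => p _ do rewrite nN /=; move=> ea.
under eq_bigr => p _ do rewrite nN /=; move=> eb.
under eq_bigr => p _ do rewrite nN /=; move=> e0.
have a2 : (\sum_p a p != 2)%N by apply: no_two => k /par[].
have b2 : (\sum_p b p != 2)%N by apply: no_two => k /par[].
have c2 : (\sum_p (~~ a p && ~~ b p) != 2)%N.
  by apply: (no_two (fun p => ~~ a p && ~~ b p)) => k /par[].
have total : (\sum_p a p + \sum_p b p + \sum_p (~~ a p && ~~ b p) = 6)%N.
  transitivity (\sum_(p < 6) 1)%N; last by rewrite sum_nat_const card_ord.
  rewrite -!big_split; apply: eq_bigr => p _ /=; have := n2 p; rewrite -/(a p) -/(b p).
  by case: (a p); case: (b p).
have full (c : 'I_6 -> bool) : (\sum_p c p = 6)%N -> forall p, c p.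
  move=> c6 p; apply/negPn/negP => cp.
  have : (\sum_p c p <= \sum_(q | q != p) 1)%N.
    rewrite (bigD1 p) //= (negbTE cp) add0n; apply: leq_sum => q _; exact: leq_b1.
  by rewrite c6 sum_nat_const cardC1 card_ord.
have all_neg M (s : 'I_6 -> bool) : plane_sign s Q M -> (forall p, s p) -> M = - 1%:M.
  by move=> Ms s1; apply: (plane_sign_ext QO Ms (plane_signN Q)) => p; rewrite s1.
have cA : central (X *m X) by exact: square_central.
have cB : central (Y *m Y) by exact: square_central.
have sA : plane_sign a Q (X *m X) by have [dA nA] := n1 _ cA; exact: plane_signP.
have sB : plane_sign b Q (Y *m Y) by have [dB nB] := n1 _ cB; exact: plane_signP.
have : [\/ (\sum_p a p = 6), (\sum_p b p = 6) | (\sum_p (~~ a p && ~~ b p) = 6)]%N.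
  move: ea eb e0 a2 b2 c2 total; move: (\sum_p a p)%N (\sum_p b p)%N (\sum_p (~~ a p && ~~ b p))%N.
  move=> x y z ex ey ez x2 y2 z2 t.
  by have [?|[?|?]] : x = 6%N \/ y = 6%N \/ z = 6%N by [lia]; [constructor 1|constructor 2|constructor 3].
case=> /full F.
- by constructor 1; exact: (all_neg _ _ sA).
- by constructor 2; exact: (all_neg _ _ sB).
- constructor 3; have -> : X *m Y *m (X *m Y) = - 1%:M *m (X *m X *m (Y *m Y)).
    have YX : Y *m X = - (X *m Y) by rewrite XY opprK.
    by rewrite mulNmx mul1mx -mulmxA (mulmxA Y X) YX mulNmx mulmxN !mulmxA.
  apply: (all_neg _ _ (plane_signM (plane_signN Q) (plane_signM sA sB))) => p.
  by have /andP[/negbTE -> /negbTE ->] := F p.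
Qed.

(** When all planes are of the same type, one of X, Y and X Y squares to -1 and can play
    the role of delta. *)
Lemma nonabelian_types X Y : X \in H -> Y \in H -> X *m Y = - (Y *m X) ->
  exists X' Y', [/\ X' \in H, Y' \in H, X' *m Y' = - (Y' *m X') & type1 X' Y' \/ type3 X' Y'].
Proof.
move=> HX HY XY; have [Q QO nf] := plane_normal_form HG HX HY XY.
have YX : Y *m X = - (X *m Y) by rewrite XY opprK.
have [[k ck k_odd]|no] := pselect (exists2 k, central k & odd (\sum_p neg Q k (lo p))).
  exists X, Y; split=> //; left; exact: (type1_normal_form HX HY XY QO nf ck k_odd).
have k_even k : central k -> ~~ odd (\sum_p neg Q k (lo p)).
  by move=> ck; apply/negP => o; apply: no; exists k.
have HXY : X *m Y \in H by exact: (goodM HG).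
have XYY : X *m Y *m Y = - (Y *m (X *m Y)) by rewrite (mulmxA Y X) YX mulNmx opprK.
have [E|E|E] := one_type HX HY XY QO nf k_even.
- by exists X, Y; split=> //; right; exact: type3_normal_form.
- by exists Y, X; split=> //; right; exact: type3_normal_form.
- by exists (X *m Y), Y; split=> //; right; exact: type3_normal_form.
Qed.

End Types.

(** * The type of an abelian group *)

Section Abelian.
Context {R : realType} {H : seq 'M[R]_12} (HG : good_group H).
Context (Hab : forall M N, M \in H -> N \in H -> M *m N = N *m M).
Implicit Types (M N g h k : 'M[R]_12) (Q : 'M[R]_12).

Definition type2 : Prop := exists Q m1 m2 m3 m4 m5,
  [/\ orthogonal Q, [/\ m1 \in H, m2 \in H, m3 \in H, m4 \in H & m5 \in H],
    [/\ plane_sign word_b1 Q m1, plane_sign word_b2 Q m2,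
        plane_sign word_b3 Q m3 & plane_sign word_b4 Q m4],
    plane_monomial Q m5 xpred0 xpredT xpred0 &
    generates (H := H) [:: m1; m2; m3; m4; m5]].

Let all_central h : h \in H -> central (H := H) h.
Proof. by move=> Hh; split=> // N HN; exact: Hab. Qed.

(** Translation by an element on which f is odd changes the sign of the sum. *)
Lemma character_sum (f : 'M[R]_12 -> bool) :
  (forall g h, g \in H -> h \in H -> f (g *m h) = f g (+) f h) ->
  (exists2 g, g \in H & f g) -> \sum_(h <- H) (-1) ^+ f h = 0 :> R.
Proof.
move=> fM [g Hg fg]; set S := \sum_(h <- H) _.
suff : S = - S by lra.
rewrite {1}/S (perm_big [seq g *m h | h <- H]) /=; last first.
  by rewrite perm_sym; exact: translate_perm.
rewrite big_map -sumrN big_seq [RHS]big_seq; apply: eq_bigr => h Hh.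
by rewrite fM // fg /=; case: (f h); rewrite ?expr0 ?expr1 ?opprK.
Qed.

(** The parity of half the weight gives a character s of H, and s = -1 only at elements
    of weight 6, where the trace vanishes; hence s tr ^ 2 = tr ^ 2.  Averaged over H, tr ^ 2
    counts the pairs of equal characters of frame vectors, of which there are twelve,
    and s tr ^ 2 counts the pairs of characters with quotient s.  Therefore every frame
    vector has a partner, whose character is s times its own. *)
Lemma abelian_type2 : type2.
Proof.
have [Q QO dQ] := central_frame HG all_central.
pose n h i := neg Q h i.
have nM g h i : g \in H -> h \in H -> n (g *m h) i = n g i (+) n h i.
  by move=> Hg Hh; rewrite /n (diagonalM QO (dQ g Hg) (dQ h Hh)).2.
have nN h i : h \in H -> n (- h) i = ~~ n h i.
  move=> Hh; apply: neg_eq => //; rewrite mulNmx (negE _ QO (dQ h Hh)) -/(n h i).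
  by case: (n h i); rewrite ?expr0 ?expr1 ?scale1r ?scaleN1r ?opprK.
have hh h : h \in H -> h *m h = 1%:M by move=> /all_central /(central_involution HG)[].
have H0 : (0 < size H)%N by have := good1 HG; case: (H).
(* otherwise no star term of the two frame vectors is negative *)
have sep i j : i != j -> exists2 h, h \in H & n h i != n h j.
  move=> ij; apply/not_exists2P => no.
  have nij h : h \in H -> n h i = n h j.
    by move=> Hh; case: (no h) => // /negP/negPn/eqP.
  apply: (@star_contra _ _ HG (col i Q) (col j Q)); rewrite ?orthogonal_col ?eqxx ?(negbTE ij) //.
  move=> h Hh; rewrite /star_term !(negE _ QO (dQ h Hh)) -!/(n h _) nij // !dotZl.
  rewrite !orthogonal_col // !eqxx (eq_sym j i) (negbTE ij) !mulr0 subr0 !mulr1.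
  by rewrite -signr_addb addbb.
have even g h : g \in H -> h \in H -> ~~ odd (\sum_i (n g i && n h i)).
  move=> Hg Hh; have g4 := good_fourth HG Hg; have h4 := good_fourth HG Hh.
  have [d d_even] := good_even HG Hg Hh (Hab Hg Hh) g4 h4; rewrite !hh //.
  have E M : (1%:M - M) *m (1%:M + 1%:M) = 2 *: (1%:M - M) :> 'M[R]_12.
    by rewrite mulmxDr !mulmx1 scaler_nat mulr2n.
  rewrite !E -scalemxAl -scalemxAr scalerA mxtraceZ.
  rewrite (eigen_trace QO (eigenM (eigen_minus QO (dQ g Hg)) (eigen_minus QO (dQ h Hh)))).
  have term i : 2 * (neg Q g i)%:R * (2 * (neg Q h i)%:R) = 4 * (n g i && n h i : nat)%:R :> R.
    by rewrite /n; case: (neg Q g i); case: (neg Q h i); rewrite /=; lra.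
  rewrite (eq_bigr _ (fun i _ => term i)) -mulr_sumr -natr_sum mulrA -!natrM => /eqP.
  by rewrite eqr_nat => /eqP; move: (\sum_i _)%N => x; lia.
pose wt h := (\sum_i n h i)%N.
have wt_even h : h \in H -> ~~ odd (wt h).
  by move=> Hh; have := even h h Hh Hh; under eq_bigr => i _ do rewrite andbb.
have wtN h : h \in H -> (wt (- h) + wt h = 12)%N.
  move=> Hh; transitivity (\sum_(i < 12) 1)%N; last by rewrite sum_nat_const card_ord.
  by rewrite -big_split; apply: eq_bigr => i _; rewrite nN //; case: (n h i).
have wt2 h : h \in H -> (wt h != 2)%N.
  move=> Hh; apply/negP => w2; have  : #|[set i | n h i]%SET| == 2%N.
    have -> // : #|[set i | n h i]%SET| = wt h.
    rewrite -sum1_card big_mkcond; apply: eq_bigr => i _.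
    by rewrite inE; case: (n h i).
  case/cards2P => i [j [ij hE]]; have [g Hg gij] := sep i j ij.
  have hP r : n h r = (r == i) || (r == j) by have /setP/(_ r) := hE; rewrite !inE.
  have := even g h Hg Hh; rewrite (bigD1 i) //= (bigD1 j) 1?eq_sym //= big1 => [|r /andP[ri rj]].
    by rewrite !hP !eqxx orbT !andbT addn0 oddD; move: gij; case: (n g i); case: (n g j).
  by rewrite hP (negbTE ri) (negbTE rj) andbF.
have wt10 h : h \in H -> (wt h != 10)%N.
  move=> Hh; have := wt2 _ (goodN HG Hh); have := wtN h Hh.
  by move: (wt h) (wt _) => x y; lia.
(* on lifts to the spin group, this is the character given by the square *)
pose s h := odd (wt h)./2.
have sM g h : g \in H -> h \in H -> s (g *m h) = s g (+) s h.
  move=> Hg Hh; have ge := wt_even g Hg; have he := wt_even h Hh; have gh := even g h Hg Hh.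
  have : (wt (g *m h) + 2 * \sum_i (n g i && n h i) = wt g + wt h)%N.
    rewrite /wt big_distrr -!big_split; apply: eq_bigr => i _ /=; rewrite nM //.
    by case: (n g i); case: (n h i).
  by rewrite /s; move: ge he gh; move: (wt _) (wt g) (wt h) (\sum_i _)%N => x y z t; lia.
pose tr2 h : R := (\sum_i (-1) ^+ n h i) ^+ 2.
have trE h : \sum_i (-1) ^+ n h i = 12 - 2 * (wt h)%:R :> R.
  have -> : 12 = \sum_(i < 12) 1 :> R by rewrite sumr_const card_ord.
  rewrite /wt natr_sum mulr_sumr -sumrB; apply: eq_bigr => i _.
  by case: (n h i); rewrite ?expr0 ?expr1 ?mulr0 ?mulr1; lra.
have wt6 h : h \in H -> s h -> wt h = 6%N.
  move=> Hh sh; have := wt_even h Hh; have := wt2 h Hh; have := wt10 h Hh.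
  have := wtN h Hh; move: sh.
  by rewrite /s; move: (wt h) (wt (- h)) => x y; lia.
have s_tr h : h \in H -> (-1) ^+ s h * tr2 h = tr2 h.
  move=> Hh; case: (boolP (s h)) => [sh|_]; last by rewrite expr0 mul1r.
  suff -> : tr2 h = 0 by rewrite mulr0.
  rewrite /tr2 trE wt6 // (_ : 12 - 2 * 6%:R = 0) ?expr0n //; lra.
have tr2E h : tr2 h = \sum_i \sum_j (-1) ^+ (n h i (+) n h j).
  rewrite /tr2 expr2 mulr_suml; apply: eq_bigr => i _; rewrite mulr_sumr.
  by apply: eq_bigr => j _; rewrite signr_addb.
have const f : (forall h, h \in H -> f h = false) -> \sum_(h <- H) (-1) ^+ f h = (size H)%:R :> R.
  move=> f0; rewrite big_seq (eq_bigr (fun=> 1)) => [|h Hh]; last by rewrite f0 ?expr0.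
  by rewrite -big_seq big_const_seq count_predT iter_addr_0.
have total : \sum_(h <- H) tr2 h = 12 * (size H)%:R.
  under eq_bigr => h _ do rewrite tr2E.
  rewrite exchange_big /=; have -> : 12 = \sum_(i < 12) 1 :> R by rewrite sumr_const card_ord.
  rewrite mulr_suml; apply: eq_bigr => i _; rewrite mul1r exchange_big (bigD1 i) //=.
  rewrite [X in _ + X]big1 ?addr0.
    by apply: (const (fun h => n h i (+) n h i)) => h _; rewrite addbb.
  move=> j ji; apply: (character_sum (f := fun h => n h i (+) n h j)) => [g h Hg Hh|].
    by rewrite !nM // addbACA.
  have [g Hg gij] := sep j i ji; exists g => //.
  by move: gij; case: (n g i); case: (n g j).
have H0R : 0 < (size H)%:R :> R by rewrite ltr0n.
have [A0 HA0 sA0] : exists2 h, h \in H & s h.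
  apply/not_exists2P => no.
  have : 16 * (size H)%:R <= \sum_(h <- H) tr2 h.
    have -> : 16 * (size H)%:R = \sum_(h <- H) (16 : R).
      by rewrite big_const_seq count_predT iter_addr_0 mulr_natr.
    rewrite big_seq [leRHS]big_seq; apply: ler_sum => h Hh.
    have sh : s h = false by apply/negbTE/negP; case: (no h).
    have := wtN h Hh; have := wt_even h Hh; have := wt2 h Hh; have := wt10 h Hh; move: sh.
    rewrite /s /tr2 trE => s0 w10 w2 we wN.
    have : [\/ wt h = 0, wt h = 4, wt h = 8 | wt h = 12]%N.
      move: s0 w10 w2 we wN; move: (wt h) (wt (- h)) => x y e1 e2 e3 e4 e5.
      by have [?|[?|[?|?]]] : x = 0%N \/ x = 4%N \/ x = 8%N \/ x = 12%N by [lia];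
        [constructor 1|constructor 2|constructor 3|constructor 4].
    by case=> ->; rewrite expr2; lra.
  by rewrite total; lra.
(* a frame vector without partner would leave at most eleven pairs with quotient s *)
have partner i : exists j, forall h, h \in H -> n h j = n h i (+) s h.
  apply/not_existsP => no.
  pose f i' j h := n h i' (+) n h j (+) s h.
  pose e i' j : R := \sum_(h <- H) (-1) ^+ f i' j h.
  have e_cases i' j : (forall h, h \in H -> f i' j h = false) /\ e i' j = (size H)%:R \/ e i' j = 0.
    have [f0|nf] := pselect (forall h, h \in H -> f i' j h = false).
      by left; split=> //; exact: const.
    right; apply: (character_sum (f := f i' j)) => [g h Hg Hh|].
      by rewrite /f !nM // sM // !addbA; case: (n g i'); case: (n g j); case: (n h i');
        case: (n h j); case: (s g); case: (s h).
    move/existsNP: nf => [g /not_implyP[Hg fg]]; exists g => //.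
    by case: (f i' j g) fg.
  have row_le i' : \sum_j e i' j <= (size H)%:R.
    have [[j0 j0P]|none] := pselect (exists j, forall h, h \in H -> f i' j h = false).
      rewrite (bigD1 j0) //= big1 ?addr0 => [|j jj0].
        by case: (e_cases i' j0) => [[_ ->]|->] //; exact: ltW.
      case: (e_cases i' j) => // -[jP _]; have [h Hh] := sep j j0 jj0.
      have := jP h Hh; have := j0P h Hh; rewrite /f.
      by case: (n h i'); case: (n h j); case: (n h j0); case: (s h).
    rewrite big1 => [|j _]; first exact: ltW.
    by case: (e_cases i' j) => // -[jP _]; case: none; exists j.
  have row0 : \sum_j e i j = 0.
    rewrite big1 // => j _; case: (e_cases i j) => // -[jP _]; case: (no j) => h Hh.
    by have := jP h Hh; rewrite /f; case: (n h i); case: (n h j); case: (s h).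
  have : \sum_(h <- H) tr2 h <= 11 * (size H)%:R.
    rewrite big_seq (eq_bigr _ (fun h Hh => esym (s_tr h Hh))) -big_seq.
    have -> : \sum_(h <- H) (-1) ^+ s h * tr2 h = \sum_i' \sum_j e i' j.
      rewrite [RHS](eq_bigr (fun i' => \sum_(h <- H) \sum_j (-1) ^+ f i' j h)) => [|i' _].
        rewrite [RHS]exchange_big; apply: eq_bigr => h _ /=; rewrite tr2E mulr_sumr.
        apply: eq_bigr => i' _; rewrite mulr_sumr; apply: eq_bigr => j _.
        by rewrite /f -signr_addb addbC.
      by rewrite /e exchange_big.
    rewrite (bigD1 i) //= row0 add0r; apply: (le_trans (ler_sum _ (fun i' _ => row_le i'))).
    by rewrite sumr_const cardC1 card_ord mulr_natl.
  by rewrite total; lra.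
have [sg sgP] := choice partner.
have sg_inj : injective sg.
  move=> i j E; apply/eqP/negPn/negP => /sep[h Hh].
  have := sgP i h Hh; rewrite E sgP //.
  by case: (n h i); case: (n h j); case: (s h).
pose S0 := [set i | n A0 i]%SET.
have cS0 : #|S0| = 6%N.
  transitivity (wt A0); last exact: wt6.
  rewrite -sum1_card big_mkcond; apply: eq_bigr => i _.
  by rewrite inE; case: (n A0 i).
pose en (p : 'I_6) : 'I_12 := enum_val (cast_ord (esym cS0) p).
have enP p : n A0 (en p) by have := enum_valP (cast_ord (esym cS0) p); rewrite inE.
have en_inj : injective en by move=> p q /enum_val_inj /cast_ord_inj.
have en_sg p q : en p <> sg (en q).
  by move=> E; have := enP p; rewrite E sgP // enP sA0.
pose u p := col (en p) Q; pose w p := col (sg (en p)) Q; pose Q' := plane_frame u w.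
have Q'O : orthogonal Q'.
  apply: plane_frame_orthogonal => p q; rewrite orthogonal_col //.
  - by rewrite (inj_eq en_inj).
  - by rewrite (inj_eq sg_inj) (inj_eq en_inj).
  - by case: eqP => // /en_sg.
have clo p : col (lo p) Q' = u p by rewrite plane_frame_lo.
have chi p : col (hi p) Q' = w p by rewrite plane_frame_hi.
have n_hi h p : h \in H -> n h (sg (en p)) = n h (en p) (+) s h by exact: sgP.
have sign0 h : h \in H -> s h = false -> plane_sign (fun p => n h (en p)) Q' h.
  move=> Hh sh p; rewrite /= ?clo ?chi !(negE _ QO (dQ h Hh)) -!/(n h _) n_hi // sh addbF.
  by [].
have wt_planes h : h \in H -> s h = false -> wt h = (2 * \sum_p n h (en p))%N.
  move=> Hh sh; pose pi i := if odd (nat_of_ord i) then sg (en (plane i)) else en (plane i).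
  have pi_lo p : pi (lo p) = en p by rewrite /pi val_lo odd_double plane_lo.
  have pi_hi p : pi (hi p) = sg (en p) by rewrite /pi val_hi /= odd_double plane_hi.
  have pi_inj : injective pi.
    apply: planeP => p; apply: planeP => q; rewrite ?pi_lo ?pi_hi.
    - by move/en_inj ->.
    - by move/en_sg.
    - by move/esym/en_sg.
    - by move/sg_inj/en_inj ->.
  rewrite /wt (reindex pi); last exact/onW_bij/injF_bij.
  rewrite sum_planes_nat big_distrr; apply: eq_bigr => p _ /=.
  by rewrite pi_lo pi_hi n_hi // sh addbF mul2n addnn.
have even0 h : h \in H -> s h = false -> ~~ odd (\sum_p n h (en p)).
  by move=> Hh sh; move: (sh); rewrite /s wt_planes // mul2n doubleK => ->.
have sN1 : s (- 1%:M) = false.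
  rewrite /s; have -> : wt (- 1%:M) = 12%N; last by [].
  have w0 : wt 1%:M = 0%N.
    rewrite /wt big1 // => i _; suff -> : n 1%:M i = false by [].
    by apply: neg_eq => //; rewrite mul1mx scale1r.
  by have := wtN _ (good1 HG); rewrite w0 addn0.
have nN1 i : n (- 1%:M) i = true.
  by apply: neg_eq => //; rewrite mulNmx mul1mx expr1 scaleN1r.
have HN1 : - 1%:M \in H by exact/(goodN HG)/(good1 HG).
have all_even (t : 'I_6 -> bool) : ~~ odd (\sum_p t p) ->
    exists2 h, h \in H & plane_sign t Q' h.
  move=> t_even; pose C (x : {ffun 'I_6 -> bool}) :=
    exists h, [/\ h \in H, s h = false & forall p, n h (en p) = x p].
  suff [h [Hh sh hx]] : C [ffun p => t p].
    exists h => //; have := sign0 h Hh sh; congr plane_sign; apply/funext => p.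
    by rewrite hx ffunE.
  apply: even_code_full.
  - move=> a b [g [Hg sgg ga]] [h [Hh sh hb]]; exists (g *m h); split.
    + exact: (goodM HG).
    + by rewrite sM // sgg sh.
    + by move=> p; rewrite nM // ga hb ffunE.
  - by exists (- 1%:M); split=> // p; rewrite ffunE nN1.
  - move=> p q pq; have [|h Hh hpq] := sep (en p) (en q); first by rewrite (inj_eq en_inj).
    have [h' [Hh' sh' hpq']] : exists h', [/\ h' \in H, s h' = false & n h' (en p) != n h' (en q)].
      case sh: (s h); last by exists h.
      exists (h *m A0); split; first exact: (goodM HG).
        by rewrite sM // sh sA0.
      by rewrite !nM // !enP; move: hpq; case: (n h (en p)); case: (n h (en q)).
    exists [ffun p => n h' (en p)]; rewrite !ffunE; split=> //.
      by exists h'; split=> // r; rewrite ffunE.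
    by rewrite /weight; under eq_bigr => r _ do rewrite ffunE; exact: even0.
  - by rewrite /weight; under eq_bigr => p _ do rewrite ffunE.
have [o1 o2 o3 o4] := even_words.
have [m1 c1 w1] := all_even _ o1; have [m2 c2 w2] := all_even _ o2.
have [m3 c3 w3] := all_even _ o3; have [m4 c4 w4] := all_even _ o4.
exists Q', m1, m2, m3, m4, A0; split=> //.
  move=> p; rewrite /= ?clo ?chi !(negE _ QO (dQ A0 HA0)) -!/(n A0 _) n_hi // enP sA0.
  by [].
move=> G GM GN Gg h Hh.
have G0 g : g \in H -> s g = false -> G g.
  move=> Hg sgg; apply: (adjacent_generate Q'O GM GN _ _ _ _ w1 w2 w3 w4 (sign0 g Hg sgg));
  by [apply: Gg; rewrite !inE eqxx ?orbT|exact: even0].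
case sh: (s h); last exact: G0.
have GA : G A0 by apply: Gg; rewrite !inE eqxx !orbT.
have -> : h = h *m A0 *m A0 by rewrite -mulmxA hh // mulmx1.
by apply: (GM) => //; apply: G0; [exact: (goodM HG)|rewrite sM // sh sA0].
Qed.

End Abelian.

(** * The generators of the Clifford algebra *)

Section Generators.
Context {R : realType}.
Implicit Types (x y z : clifford R 12) (p q : 'I_6).

Definition gl p : clifford R 12 := clifford_gen (lo p).
Definition gh p : clifford R 12 := clifford_gen (hi p).

Lemma gl_sqr p : gl p * gl p = -1. Proof. exact: clifford_gen_sqr. Qed.
Lemma gh_sqr p : gh p * gh p = -1. Proof. exact: clifford_gen_sqr. Qed.

Lemma gh_gl p q : gh p * gl q = - (gl q * gh p).
Proof. by apply: clifford_gen_anti; rewrite eq_sym lo_hi. Qed.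

Lemma gl_gl p q : p != q -> gl p * gl q = - (gl q * gl p).
Proof. by move=> pq; apply: clifford_gen_anti; rewrite lo_eq. Qed.

Lemma gh_gh p q : p != q -> gh p * gh q = - (gh q * gh p).
Proof. by move=> pq; apply: clifford_gen_anti; rewrite hi_eq. Qed.

Definition pl p : clifford R 12 := gl p * gh p.

Lemma pl_sqr p : pl p * pl p = -1.
Proof.
have E : gh p * (gl p * gh p) = gl p.
  by rewrite mulrA gh_gl mulNr -mulrA gh_sqr mulrN1 opprK.
by rewrite /pl -(mulrA (gl p)) E gl_sqr.
Qed.

Lemma pl_gl p q : p != q -> pl p * gl q = gl q * pl p.
Proof.
move=> pq; rewrite /pl -(mulrA (gl p)) gh_gl mulrN (mulrA (gl p)) gl_gl // mulNr opprK.
by rewrite mulrA.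
Qed.

Lemma pl_gh p q : p != q -> pl p * gh q = gh q * pl p.
Proof.
move=> pq; have E : gl p * gh q = - (gh q * gl p) by rewrite gh_gl opprK.
by rewrite /pl -(mulrA (gl p)) gh_gh // mulrN (mulrA (gl p)) E mulNr opprK mulrA.
Qed.

Lemma pl_pl p q : pl p * pl q = pl q * pl p.
Proof.
have [-> //|pq] := eqVneq p q.
by rewrite [X in _ * X]/pl mulrA pl_gl // -(mulrA (gl q)) pl_gh // mulrA.
Qed.

Lemma c_planes : c_elt = \prod_(p < 6) pl p :> clifford R 12.
Proof.
rewrite c_eltE (eq_bigr (fun i : 'I_12 => clifford_gen (inord i))) => [|i _]; last first.
  by rewrite inord_val.
rewrite [RHS](eq_bigr (fun p : 'I_6 => pl (inord p))) => [|p _]; last by rewrite inord_val.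
rewrite -(big_mkord xpredT (fun i => clifford_gen (inord i))).
rewrite -(big_mkord xpredT (fun i => pl (inord i))).
rewrite !big_nat_recr ?big_geq //= !mul1r.
by rewrite /pl /gl /gh /lo /hi !inordK //= !mulrA.
Qed.

Lemma c_sqr : c_elt * c_elt = 1 :> clifford R 12.
Proof.
have sq (s : seq 'I_6) : (\prod_(p <- s) pl p) * (\prod_(p <- s) pl p) = (-1) ^+ size s.
  elim: s => [|p s IHs]; first by rewrite !big_nil mulr1.
  rewrite !big_cons /= exprS -IHs.
  have com : (\prod_(q <- s) pl q) * pl p = pl p * \prod_(q <- s) pl q.
    elim: s {IHs} => [|q s IHs]; first by rewrite big_nil mulr1 mul1r.
    by rewrite big_cons -(mulrA (pl q)) IHs (mulrA (pl q)) (pl_pl q p) -(mulrA (pl p)).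
  move: (\prod_(q <- s) pl q) com => S com.
  by rewrite mulrA -(mulrA (pl p) S) com (mulrA (pl p) (pl p)) pl_sqr mulrA.
rewrite c_planes /index_enum sq -(size_map val).
by rewrite -enumT size_map size_enum_ord -signr_odd.
Qed.

End Generators.

(** * The image of a finite subgroup of the half-spin group *)

Section HalfSpin.
Context {R : realType}.
Local Notation G := (HSpin12 R).
Implicit Types (x y z : spin R 12) (M N : 'M[R]_12).

Lemma clsM x y : cls (x * y)%g = (cls x * cls y)%g.
Proof. exact: central_pi_morph. Qed.

Lemma cls1 : cls (1%g : spin R 12) = 1%g.
Proof. by []. Qed.

Lemma clsV x : cls (x^-1)%g = (cls x)^-1%g.
Proof. by apply: (mulgI (cls x)); rewrite -clsM !mulgV. Qed.

Lemma cls_repr (a : G) : cls (repr a) = a.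
Proof. exact: central_piK. Qed.

Lemma generated_c z : generated [set c_spin (R := R)]%classic z -> z = 1%g \/ z = c_spin.
Proof.
pose S := [set z : spin R 12 | z = 1%g \/ z = c_spin]%classic.
have cc : (c_spin * c_spin)%g = 1%g :> spin R 12 by apply: val_inj; exact: c_sqr.
have cV : (c_spin^-1)%g = c_spin :> spin R 12.
  by apply: (mulgI c_spin); rewrite mulgV cc.
move=> /(_ S); apply; split=> [|_ ->]; last by right.
split=> [|a b]; first by left.
by case=> -> [->|->]; rewrite ?invg1 ?mulg1 ?cV ?mul1g ?cc; [left|right|right|left].
Qed.

Lemma cls_eq x y : cls x = cls y -> y = x \/ y = (x * c_spin)%g.
Proof.
move=> /central_piP /generated_c[E|E]; [left|right].
  by rewrite -[y](mulVKg x) E mulg1.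
by rewrite -[y](mulVKg x) E.
Qed.

Lemma cls_c : cls (c_spin (R := R)) = 1%g.
Proof.
apply/esym/central_piP; rewrite invg1 mul1g => S [_]; exact.
Qed.

Lemma spin_unit_prod_val x : unit_prod false (val x).
Proof. exact/spin_unit_prod/spinP. Qed.

Lemma spin_unit x : val x \is a GRing.unit.
Proof. exact: unit_prod_unit (spin_unit_prod_val x). Qed.

Lemma lifts_orthogonal x M : lifts (val x) M -> orthogonal M.
Proof.
move=> xM; have [N NO xN] := unit_prod_lifts (spin_unit_prod_val x).
by rewrite (lifts_inj (spin_unit x) xM xN).
Qed.

Context (F : set G) (Fgroup : is_subgroup F) (Ffinite : finite_set F)
  (Fabelian : is_abelian F) (Fstar : condition_star F).

Definition image M := exists2 x, F (cls x) & lifts (val x) M.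

Lemma F_comm x y : F (cls x) -> F (cls y) ->
  val x * val y = val y * val x \/ val x * val y = c_elt * (val y * val x).
Proof.
move=> Fx Fy; have := Fabelian Fx Fy; rewrite -!clsM => /esym/cls_eq[E|E].
  by left; rewrite -val_spinM E.
right; rewrite -val_spinM E (val_spinM (y * x)%g c_spin) /=.
have := unit_prod_c (spin_unit_prod_val (y * x)%g).
by rewrite expr0 mul1r.
Qed.

Lemma lifts_comm x y M N : lifts (val x) M -> lifts (val y) N ->
  (val x * val y = val y * val x -> M *m N = N *m M) /\
  (val x * val y = c_elt * (val y * val x) -> M *m N = - (N *m M)).
Proof.
move=> xM yN; have xyU : val x * val y \is a GRing.unit := spin_unit (x * y)%g.
have xy := liftsM xM yN; have yx := liftsM yN xM; split=> E.
  by apply: (lifts_inj xyU xy); rewrite E.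
apply: (lifts_inj xyU xy); rewrite E -[N *m M]mul1mx -mulNmx.
by apply: liftsM => //; exact: lifts_c.
Qed.

Lemma orthogonal_anticommute M N : orthogonal M -> orthogonal N ->
  M *m N = N *m M -> M *m N = - (N *m M) -> False.
Proof.
move=> MO NO E E'; have NMO : orthogonal (N *m M) by exact: orthogonalM.
have NM0 : N *m M = 0.
  by apply/matrixP => i j; move: E'; rewrite E => /matrixP/(_ i j); rewrite !mxE; lra.
have := orthogonal_det NMO; rewrite NM0 det0 mul0r => /eqP.
by rewrite eq_sym oner_eq0.
Qed.

(** A class has two lifts up to sign, x and x c, whose images are opposite. *)
Lemma image_list : exists2 H : seq 'M[R]_12, uniq H & forall M, (M \in H) <-> image M.
Proof.
have lift_a (a : G) : exists M : 'M[R]_12, lifts (val (repr a : spin R 12)) M.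
  by have [M _ aM] := unit_prod_lifts (spin_unit_prod_val (repr a)); exists M.
have [f fP] := choice lift_a.
have [s sF] := (finite_seqP F).1 Ffinite.
exists (undup ([seq f a | a <- s] ++ [seq - f a | a <- s])); first exact: undup_uniq.
have inF a : (a \in s) <-> F a by rewrite sF.
move=> M; rewrite mem_undup mem_cat; split.
  case/orP => /mapP[a /inF Fa ->].
    by exists (repr a); rewrite ?cls_repr.
  exists (repr a * c_spin)%g; first by rewrite clsM cls_c mulg1 cls_repr.
  by rewrite -[f a]mulmx1 -mulmxN; apply: liftsM => //; exact: lifts_c.
case=> x Fx xM; have /cls_eq := cls_repr (cls x) => xE.
have xf : M = f (cls x) \/ M = - f (cls x).
  have rM := fP (cls x); case: xE => xE.
    by left; apply: (lifts_inj (spin_unit x) xM); rewrite {1}xE.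
  right; apply: (lifts_inj (spin_unit x) xM); rewrite {1}xE -[f _]mulmx1 -mulmxN.
  by apply: liftsM => //; exact: lifts_c.
have fs : f (cls x) \in [seq f a | a <- s] by apply: map_f; exact/inF.
have fsN : - f (cls x) \in [seq - f a | a <- s].
  by apply: (map_f (fun a => - f a)); exact/inF.
by case: xf => ->; rewrite ?fs ?fsN ?orbT.
Qed.

(** An antisymmetric matrix M corresponds to the element sum_(i < j) M i j e_i e_j
    of the Lie algebra, equivariantly. *)
Lemma star_matrix M : M^T = - M -> (forall N, image N -> N *m M = M *m N) -> M = 0.
Proof.
move=> MT MC.
have Mij i j : M j i = - M i j by have /matrixP/(_ i j) := MT; rewrite !mxE.
pose X : clifford R 12 := \sum_(i < 12) \sum_(j < 12 | (i < j)%N)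
  M i j *: (clifford_gen i * clifford_gen j).
pose T (A : 'M[R]_12) : clifford R 12 :=
  \sum_i \sum_j A i j *: (clifford_gen i * clifford_gen j).
have TX : T M = 2 *: X.
  have split_ij i : \sum_j M i j *: (clifford_gen i * clifford_gen j) =
      \sum_(j < 12 | (i < j)%N) M i j *: (clifford_gen i * clifford_gen j) +
      \sum_(j < 12 | (j < i)%N) M i j *: (clifford_gen i * clifford_gen j) :> clifford R 12.
    rewrite (bigID (fun j : 'I_12 => (i < j)%N)) /=; congr (_ + _).
    rewrite (bigID (fun j : 'I_12 => (j < i)%N)) /= [X in _ + X]big1 ?addr0 => [|j /andP[ij ji]].
      by apply: eq_bigl => j; case: ltngtP.
    have -> : j = i by apply: val_inj => /=; move: ij ji; case: ltngtP.
    have -> : M i i = 0 by have := Mij i i; lra.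
    by rewrite scale0r.
  rewrite /T (eq_bigr _ (fun i _ => split_ij i)) big_split /= scaler_nat mulr2n; congr (_ + _).
  rewrite /X [RHS](eq_bigr (fun i : 'I_12 => \sum_(j < 12) (if (i < j)%N then
    M i j *: (clifford_gen i * clifford_gen j) else 0))) => [|i _]; last by rewrite big_mkcond.
  rewrite exchange_big /=; apply: eq_bigr => i _; rewrite big_mkcond; apply: eq_bigr => j _.
  case: ifP => // ji; rewrite Mij clifford_gen_anti ?scaleNr ?scalerN ?opprK //.
  by rewrite -val_eqE /= neq_ltn ji orbT.
have X_so12 : so12 X by exists (fun i j => M i j).
have TC x N : lifts (val x) N -> val x * T M = T (N *m M *m N^T) * val x.
  move=> xN.
  have gE i : val x * clifford_gen i = (\sum_k N k i *: clifford_gen k) * val x.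
    rewrite -cvec_delta xN; congr (_ * _); rewrite cvecE; apply: eq_bigr => k _.
    by rewrite -colE mxE.
  rewrite /T mulr_sumr mulr_suml.
  transitivity (\sum_i \sum_j \sum_k \sum_l (N k i * M i j * N l j) *:
      (clifford_gen k * clifford_gen l) * val x).
    apply: eq_bigr => i _; rewrite mulr_sumr; apply: eq_bigr => j _.
    rewrite -scalerAr (mulrA (val x)) gE -(mulrA _ (val x)) gE mulrA mulr_suml mulr_suml scaler_sumr.
    apply: eq_bigr => k _; rewrite mulr_sumr mulr_suml scaler_sumr; apply: eq_bigr => l _.
    rewrite -(scalerAl (N k i)) -(scalerAr (N l j)) scalerA -scalerAl scalerA -scalerAl.
    by congr (_ *: _); ring.
  transitivity (\sum_k \sum_l \sum_i \sum_j (N k i * M i j * N l j) *: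
      (clifford_gen k * clifford_gen l) * val x).
    rewrite (eq_bigr (fun i => \sum_k \sum_j \sum_l (N k i * M i j * N l j) *:
      (clifford_gen k * clifford_gen l) * val x)) => [|i _]; last exact: exchange_big.
    rewrite exchange_big; apply: eq_bigr => k _ /=.
    rewrite (eq_bigr (fun i => \sum_l \sum_j (N k i * M i j * N l j) *:
      (clifford_gen k * clifford_gen l) * val x)) => [|i _]; last exact: exchange_big.
    by rewrite exchange_big.
  apply: eq_bigr => k _; rewrite mulr_suml; apply: eq_bigr => l _.
  rewrite mxE; under [in RHS]eq_bigr => j _ do rewrite mxE mxE mulr_suml.
  rewrite exchange_big /= scaler_suml mulr_suml; apply: eq_bigr => j _.
  by rewrite scaler_suml mulr_suml; apply: eq_bigr => i _.
have Xfix : so12_fixed F X.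
  split=> // x Fx.
  have [N NO xN] := unit_prod_lifts (spin_unit_prod_val x).
  have NM : N *m M *m N^T = M.
    by rewrite MC; [rewrite -mulmxA orthogonalC // mulmx1 | exists x].
  have := TC x N xN; rewrite NM TX -scalerAr -scalerAl => E.
  have two : (2 : R) != 0 by rewrite pnatr_eq0.
  by rewrite /Ad (scalerI two E) mulrK // spin_unit.
have X0 : X = 0 by have : so12_fixed F X := Xfix; rewrite Fstar.
have Mlt (i j : 'I_12) : (i < j)%N -> M i j = 0.
  move=> ij; have /ffunP/(_ (symdiff [set i]%SET [set j]%SET)) := X0.
  have coef (a b : 'I_12) : (a < b)%N ->
      (M a b *: (clifford_gen a * clifford_gen b)) (symdiff [set i]%SET [set j]%SET) =
      M a b * (clifford_sign R [set a]%SET [set b]%SET * ((a == i) && (b == j))%:R) :> R.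
    move=> ab; rewrite clifford_basisM clifford_scaleE clifford_scaleE ffunE.
    congr (_ * (_ * (nat_of_bool _)%:R)).
    apply/eqP/andP => [/setP E|[/eqP -> /eqP ->]] //.
    have Ea := E a; have Eb := E b; move: Ea Eb ij ab.
    rewrite !inE !eqxx -!val_eqE /= => + + ij ab.
    by case: (eqVneq (a : nat) i) => ai; case: (eqVneq (a : nat) j) => aj;
      case: (eqVneq (b : nat) i) => bi; case: (eqVneq (b : nat) j) => bj;
      case: (eqVneq (a : nat) b) => E1; case: (eqVneq (b : nat) a) => E2 //= _ _; lia.
  rewrite [RHS]ffunE /X sum_ffunE (bigD1 i) //= sum_ffunE (bigD1 j) //= coef // !eqxx mulr1.
  rewrite big1 ?addr0 => [|b /andP[ib /negbTE bj]]; last by rewrite coef // bj andbF !mulr0.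
  rewrite big1 ?addr0 => [E|a /negbTE ai]; last first.
    by rewrite sum_ffunE big1 // => b ab; rewrite coef // ai !mulr0.
  have := congr1 (fun t => t * clifford_sign R [set i]%SET [set j]%SET) E.
  by rewrite -mulrA clifford_sign_sqr mulr1 mul0r.
apply/matrixP => i j; rewrite mxE; case: (ltngtP i j) => ij.
- exact: Mlt.
- by rewrite Mij Mlt // oppr0.
- have -> : j = i by exact: val_inj.
  by have := Mij i i; lra.
Qed.

Lemma image_good H : uniq H -> (forall M, (M \in H) <-> image M) -> good_group H.
Proof.
move=> uH HP; split=> //.
- by move=> M /HP[x _ /lifts_orthogonal].
- move=> M N /HP[x Fx xM] /HP[y Fy yN]; apply/HP; exists (x * y)%g; last exact: liftsM.
  by rewrite clsM; exact: (is_subgroupM Fgroup).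
- move=> M /HP[x Fx xM]; apply/HP; exists (x^-1)%g.
    by rewrite clsV; exact: (is_subgroupV Fgroup).
  by apply: liftsV => //; [exact: spin_unit|exact: lifts_orthogonal xM].
- move=> M /HP[x Fx xM]; apply/HP; exists (x * c_spin)%g; first by rewrite clsM cls_c mulg1.
  by rewrite -[M]mulmx1 -mulmxN; apply: liftsM => //; exact: lifts_c.
- by apply/HP; exists 1%g; [rewrite cls1; case: Fgroup|exact: lifts1].
- move=> M N /HP[x Fx xM] /HP[y Fy yN]; have [L1 L2] := lifts_comm xM yN.
  by case: (F_comm Fx Fy) => E; [left; exact: L1|right; exact: L2].
- move=> M MT MC; apply: star_matrix => // N /HP; exact: MC.
- move=> M N /HP[x Fx xM] /HP[y Fy yN] MN M4 N4.
  have MO := lifts_orthogonal xM; have NO := lifts_orthogonal yN.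
  apply: (commuting_parity (spin_unit_prod_val x) (spin_unit_prod_val y) xM yN) => //.
  have [_ L2] := lifts_comm xM yN.
  case: (F_comm Fx Fy) => // /L2 E.
  by case: (orthogonal_anticommute MO NO MN E).
Qed.

End HalfSpin.

(** * The action of the explicit generators *)

Section Actions.
Context {R : realType}.
Implicit Types (x y z : clifford R 12) (p q : 'I_6) (f s : 'I_6 -> bool).

Definition plane_acts x f s0 s1 := forall p,
  x * gl p = (-1) ^+ s0 p *: ((if f p then gh p else gl p) * x) /\
  x * gh p = (-1) ^+ s1 p *: ((if f p then gl p else gh p) * x).

Lemma plane_actsM x y f s0 s1 f' s0' s1' :
  plane_acts x f s0 s1 -> plane_acts y f' s0' s1' ->
  plane_acts (x * y) (fun p => f p (+) f' p)
    (fun p => s0' p (+) (if f' p then s1 p else s0 p))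
    (fun p => s1' p (+) (if f' p then s0 p else s1 p)).
Proof.
move=> xa ya p; have [xl xh] := xa p; have [yl yh] := ya p.
rewrite -!mulrA yl yh -!scalerAr; case: (f' p) => /=;
  rewrite !(mulrA x) xl xh -!scalerAl !scalerA -!signr_addb;
  by case: (f p); rewrite /= -!mulrA.
Qed.

Lemma plane_acts_ext x f s0 s1 f' s0' s1' : plane_acts x f s0 s1 ->
  f =1 f' -> s0 =1 s0' -> s1 =1 s1' -> plane_acts x f' s0' s1'.
Proof. by move=> xa ff ss0 ss1 p; rewrite -ff -ss0 -ss1. Qed.

Lemma acts_gl q : plane_acts (gl q) xpred0 (fun p => p != q) xpredT.
Proof.
move=> p; rewrite /= expr1 scaleN1r gh_gl opprK; split=> //.
have [->|pq] := eqVneq p q; first by rewrite expr0 scale1r.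
by rewrite expr1 scaleN1r gl_gl // eq_sym.
Qed.

Lemma acts_gh q : plane_acts (gh q) xpred0 xpredT (fun p => p != q).
Proof.
move=> p; rewrite /= expr1 scaleN1r gh_gl; split=> //.
have [->|pq] := eqVneq p q; first by rewrite expr0 scale1r.
by rewrite expr1 scaleN1r gh_gh // eq_sym.
Qed.

Definition turn q : clifford R 12 := (Num.sqrt 2)^-1 *: (1 + gl q * gh q).
Definition swap q : clifford R 12 := (Num.sqrt 2)^-1 *: (gl q + gh q).

Lemma acts_turn q : plane_acts (turn q) (pred1 q) xpred0 (pred1 q).
Proof.
have comm x y (a : R) : x * y = y * x -> (a *: (1 + x)) * y = y * (a *: (1 + x)).
  by move=> E; rewrite -scalerAl -scalerAr mulrDl mulrDr mul1r mulr1 E.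
move=> p; rewrite /turn -/(pl q) /= expr0 scale1r.
have [->|pq] := eqVneq p q; last first.
  by rewrite expr0 scale1r !comm ?pl_gl ?pl_gh // eq_sym.
have E1 : pl q * gl q = gh q :> clifford R 12.
  by rewrite /pl -(mulrA (gl q)) gh_gl mulrN (mulrA (gl q)) gl_sqr mulN1r opprK.
have E2 : gh q * pl q = gl q :> clifford R 12.
  by rewrite /pl (mulrA (gh q)) gh_gl mulNr -(mulrA (gl q)) gh_sqr mulrN1 opprK.
have E3 : pl q * gh q = - gl q :> clifford R 12 by rewrite /pl -(mulrA (gl q)) gh_sqr mulrN1.
have E4 : gl q * pl q = - gh q :> clifford R 12 by rewrite /pl (mulrA (gl q)) gl_sqr mulN1r.
rewrite expr1 scaleN1r -!scalerAl -!scalerAr -scalerN !mulrDl !mulrDr !mul1r !mulr1.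
by rewrite E1 E2 E3 E4 opprB; split=> //; rewrite addrC.
Qed.

Lemma acts_swap q : plane_acts (swap q) (pred1 q) (predC1 q) (predC1 q).
Proof.
move=> p; rewrite /swap /= -!scalerAl -!scalerAr !mulrDl !mulrDr.
have [->|pq] := eqVneq p q.
  rewrite /= !expr0 !scale1r !gl_sqr !gh_sqr; split; last by rewrite addrC.
  by rewrite addrC.
have qp : q != p by rewrite eq_sym.
rewrite /= !expr1 !scaleN1r !gh_gl (gl_gl qp) (gh_gh qp) -!scalerN !opprD !opprK.
by split.
Qed.

Definition plane0 : 'I_6 := @Ordinal 6 0 isT.
Definition plane1 : 'I_6 := @Ordinal 6 1 isT.
Definition plane2 : 'I_6 := @Ordinal 6 2 isT.
Definition plane3 : 'I_6 := @Ordinal 6 3 isT.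
Definition plane4 : 'I_6 := @Ordinal 6 4 isT.
Definition plane5 : 'I_6 := @Ordinal 6 5 isT.

Lemma acts_a1 : plane_acts (a1 R) xpred0 word_a1 word_a1.
Proof.
apply: (plane_acts_ext (plane_actsM (plane_actsM (plane_actsM (plane_actsM (plane_actsM
  (acts_gl plane0) (acts_gh plane0)) (acts_gl plane1)) (acts_gh plane1)) (acts_gl plane2)) (acts_gh plane2)));
by case=> [[|[|[|[|[|[|//]]]]]] ?].
Qed.

Lemma acts_b1 : plane_acts (b1 R) xpred0 word_b1 word_b1.
Proof.
apply: (plane_acts_ext (plane_actsM (plane_actsM (plane_actsM
  (acts_gl plane0) (acts_gh plane0)) (acts_gl plane1)) (acts_gh plane1)));
by case=> [[|[|[|[|[|[|//]]]]]] ?].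
Qed.

Lemma acts_b2 : plane_acts (b2 R) xpred0 word_b2 word_b2.
Proof.
apply: (plane_acts_ext (plane_actsM (plane_actsM (plane_actsM
  (acts_gl plane2) (acts_gh plane2)) (acts_gl plane3)) (acts_gh plane3)));
by case=> [[|[|[|[|[|[|//]]]]]] ?].
Qed.

Lemma acts_b3 : plane_acts (b3 R) xpred0 word_b3 word_b3.
Proof.
apply: (plane_acts_ext (plane_actsM (plane_actsM (plane_actsM
  (acts_gl plane1) (acts_gh plane1)) (acts_gl plane2)) (acts_gh plane2)));
by case=> [[|[|[|[|[|[|//]]]]]] ?].
Qed.

Lemma acts_b4 : plane_acts (b4 R) xpred0 word_b4 word_b4.
Proof.
apply: (plane_acts_ext (plane_actsM (plane_actsM (plane_actsM
  (acts_gl plane3) (acts_gh plane3)) (acts_gl plane4)) (acts_gh plane4)));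
by case=> [[|[|[|[|[|[|//]]]]]] ?].
Qed.

Lemma acts_b5 : plane_acts (b5 R) xpred0 xpredT xpred0.
Proof.
apply: (plane_acts_ext (plane_actsM (plane_actsM (plane_actsM (plane_actsM (plane_actsM
  (acts_gl plane0) (acts_gl plane1)) (acts_gl plane2)) (acts_gl plane3)) (acts_gl plane4)) (acts_gl plane5)));
by case=> [[|[|[|[|[|[|//]]]]]] ?].
Qed.

Lemma acts_delta : plane_acts (delta R) xpredT xpred0 xpredT.
Proof.
apply: (plane_acts_ext (plane_actsM (plane_actsM (plane_actsM (plane_actsM (plane_actsM
  (acts_turn plane0) (acts_turn plane1)) (acts_turn plane2)) (acts_turn plane3)) (acts_turn plane4)) (acts_turn plane5)));
by case=> [[|[|[|[|[|[|//]]]]]] ?].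
Qed.

Lemma acts_a2 : plane_acts (a2 R) (fun p => p %% 3 == 2)%N (fun p => p %% 3 != 2)%N
  (fun p => p %% 3 == 2)%N.
Proof.
apply: (plane_acts_ext (plane_actsM (plane_actsM (plane_actsM (plane_actsM (plane_actsM
  (acts_gl plane0) (acts_gl plane1)) (acts_turn plane2)) (acts_gl plane3)) (acts_gl plane4)) (acts_turn plane5)));
by case=> [[|[|[|[|[|[|//]]]]]] ?].
Qed.

Lemma acts_a3 : plane_acts (a3 R) (fun p => p %% 3 != 2)%N (fun p => p %% 3 != 1)%N
  (fun p => p %% 3 != 2)%N.
Proof.
apply: (plane_acts_ext (plane_actsM (plane_actsM (plane_actsM (plane_actsM (plane_actsM
  (acts_swap plane0) (acts_turn plane1)) (acts_gl plane2)) (acts_swap plane3)) (acts_turn plane4)) (acts_gl plane5)));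
by case=> [[|[|[|[|[|[|//]]]]]] ?].
Qed.

(** If y acts on the standard frame as M acts on the frame Q, then conjugation by a lift
    of Q takes y to a lift of M. *)
Lemma lifts_conj (q y : clifford R 12) (Q M : 'M[R]_12) f s0 s1 : q \is a GRing.unit -> orthogonal Q -> lifts q Q ->
  plane_monomial Q M f s0 s1 -> plane_acts y f s0 s1 -> lifts (q * y * q^-1) M.
Proof.
move=> qU QO qQ MQ ya.
have -> : M = Q *m (Q^T *m M *m Q) *m Q^T.
  by rewrite !mulmxA orthogonalC // mul1mx -mulmxA orthogonalC // mulmx1.
apply: liftsM; last exact: liftsV.
apply: liftsM => //; apply: lifts_delta.
have E i : Q^T *m col i Q = delta_mx i 0 by rewrite -colM QO colE mul1mx.
have M_delta i : Q^T *m M *m Q *m delta_mx i 0 = Q^T *m (M *m col i Q).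
  by rewrite -!mulmxA colE.
apply: planeP => p; rewrite M_delta; have [Ml Mh] := MQ p; have [yl yh] := ya p.
  rewrite Ml -scalemxAr E cvecZ cvec_delta -scalerAl -/(gl p) yl.
  by case: (f p).
rewrite Mh -scalemxAr E cvecZ cvec_delta -scalerAl -/(gh p) yh.
by case: (f p).
Qed.

(** If conjugation by a multiplies each factor x p by pl p, up to sign, then the factors
    pl p can be collected, and their product is c. *)
Lemma twisted_product a (x x' : 'I_6 -> clifford R 12) (e : 'I_6 -> bool) :
  (forall p, a * x p = x' p * a) -> (forall p, x' p = (-1) ^+ e p *: (pl p * x p)) ->
  (forall p q, p != q -> pl p * x q = x q * pl p) ->
  a * \prod_p x p = (-1) ^+ (\sum_p e p) *: (c_elt * \prod_p x p * a).
Proof.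
move=> ax x'E plx; rewrite c_planes.
have ax_prod (s : seq 'I_6) : a * \prod_(p <- s) x p = \prod_(p <- s) x' p * a.
  elim: s => [|p s IHs]; first by rewrite !big_nil mulr1 mul1r.
  by rewrite !big_cons mulrA ax -mulrA IHs mulrA.
rewrite ax_prod scalerAl; congr (_ * _).
have : uniq (index_enum 'I_6) by exact: index_enum_uniq.
elim: (index_enum _) => [|p s IHs] /=; first by rewrite !big_nil mulr1 expr0 scale1r.
case/andP => ps us; rewrite !big_cons IHs // x'E exprD -scalerAl -scalerAr scalerA.
congr (_ *: _).
have com : x p * \prod_(q <- s) pl q = \prod_(q <- s) pl q * x p.
  elim: s ps {IHs us} => [|q s IHs]; first by rewrite !big_nil mulr1 mul1r.
  rewrite inE negb_or => /andP[pq ps]; rewrite !big_cons mulrA -plx; last by rewrite eq_sym.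
  by rewrite -mulrA IHs // mulrA.
move: (\prod_(q <- s) pl q) com (\prod_(q <- s) x q) (pl p) => S com S' t.
by rewrite -!mulrA (mulrA (x p) S) com !mulrA.
Qed.

Lemma pl_turn p q : p != q -> pl p * turn q = turn q * pl p.
Proof.
by move=> pq; rewrite /turn -/(pl q) -scalerAl -scalerAr mulrDl mulrDr mulr1 mul1r pl_pl.
Qed.

Lemma pl_swap p q : p != q -> pl p * swap q = swap q * pl p.
Proof.
by move=> pq; rewrite /swap -scalerAl -scalerAr mulrDl mulrDr pl_gl // pl_gh.
Qed.

Lemma pl_gl_id p : pl p * gl p = gh p :> clifford R 12.
Proof. by rewrite /pl -(mulrA (gl p)) gh_gl mulrN (mulrA (gl p)) gl_sqr mulN1r opprK. Qed.

Lemma pl_gh_id p : pl p * gh p = - gl p :> clifford R 12.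
Proof. by rewrite /pl -(mulrA (gl p)) gh_sqr mulrN1. Qed.

Lemma delta_b5 : delta R * b5 R = c_elt * b5 R * delta R.
Proof.
have -> : b5 R = \prod_p gl p by rewrite !big_ord_recl big_ord0 mulr1 !mulrA.
rewrite (@twisted_product _ _ (fun p => gh p) xpred0).
- by rewrite big1 ?expr0 ?scale1r.
- by move=> p; case: (acts_delta p) => ->; rewrite expr0 scale1r.
- by move=> p; rewrite expr0 scale1r pl_gl_id.
- exact: pl_gl.
Qed.

Lemma a2_a3 : a2 R * a3 R = c_elt * a3 R * a2 R.
Proof.
pose x (p : 'I_6) := if (p %% 3 == 0)%N then swap p else if (p %% 3 == 1)%N then turn p else gl p.
have -> : a3 R = \prod_p x p by rewrite !big_ord_recl big_ord0 mulr1 !mulrA.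
rewrite (@twisted_product _ _ (fun p => (-1) ^+ (p %% 3 == 1)%N *: (pl p * x p))
  (fun p => p %% 3 == 1)%N) //.
- by rewrite big6 !inordK //= -signr_odd /= expr0 scale1r.
- move=> p; have [al ah] := acts_a2 p; rewrite /x; move: al ah.
  have : (p %% 3 < 3)%N by rewrite ltn_mod.
  case: (p %% 3)%N => [|[|[|//]]] _ /=; rewrite ?expr0 ?expr1 ?scale1r ?scaleN1r => al ah.
  + rewrite /swap -!scalerAr mulrDr al ah -!scalerAl; congr (_ *: _).
    by rewrite mulrDr pl_gl_id pl_gh_id mulrDl mulNr addrC.
  + have apl : a2 R * pl p = - (pl p * a2 R).
      by rewrite /pl (mulrA (a2 R)) al mulNr -(mulrA (gl p) (a2 R)) ah (mulrA (gl p)).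
    rewrite /turn -/(pl p) -!scalerAr -scaleNr -!scalerAl scaleNr -scalerN; congr (_ *: _).
    by rewrite !mulrDr mulr1 apl pl_sqr mulrDl mulN1r mulr1 opprD opprK addrC.
  + by rewrite al pl_gl_id.
- move=> p q pq; rewrite /x; case: ifP => _; first exact: pl_swap.
  by case: ifP => _; [exact: pl_turn|exact: pl_gl].
Qed.

Lemma a1_sqr : a1 R * a1 R = -1.
Proof.
have -> : a1 R = pl plane0 * pl plane1 * pl plane2 by rewrite /pl !mulrA.
move: (@pl_sqr R plane0) (@pl_sqr R plane1) (@pl_sqr R plane2).
move: (@pl_pl R plane0 plane1) (@pl_pl R plane0 plane2) (@pl_pl R plane1 plane2).
move: (pl plane0) (pl plane1) (pl plane2) => a b c ab ac bc aa bb cc.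
have -> : a * b * c * (a * b * c) = (a * a) * (b * b) * (c * c).
  rewrite -!mulrA; congr (_ * _); rewrite !mulrA.
  by rewrite -(mulrA b c a) -ac (mulrA b a) -ab -!mulrA (mulrA c b) -bc !mulrA.
by rewrite aa bb cc mulrNN mulr1 mul1r.
Qed.

End Actions.

(** * Conjugation in the half-spin group *)

Section Conjugation.
Context {R : realType}.
Local Notation G := (HSpin12 R).
Implicit Types (x y z : spin R 12) (M N Q : 'M[R]_12).

Lemma spin_neg x y : val y = - val x -> cls y = (scls (-1) (m1_spin R) * cls x)%g.
Proof.
by move=> yx; rewrite -clsM; congr cls; apply: val_inj; rewrite /= yx mulN1r.
Qed.

Lemma subgroup_lift (S : set G) x y M : is_subgroup S -> S (scls (-1) (m1_spin R)) ->
  S (cls x) -> lifts (val x) M -> lifts (val y) M -> S (cls y).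
Proof.
move=> SG Sm1 Sx xM yM.
have [E|E] := lift_sign (spin_unit_prod_val y) (spin_unit_prod_val x) (lifts_orthogonal xM) yM xM.
  by rewrite (val_inj E).
by rewrite (spin_neg E); exact: (is_subgroupM SG).
Qed.

Context (F : set G) (Fgroup : is_subgroup F) (Fm1 : F (scls (-1) (m1_spin R))).

(** A subgroup containing [-1] is determined by its image in SO(12), so that it
    is enough to conjugate lifts of generators of the image, up to sign. *)
Lemma conjugate_generated (S : set G) (H gens : seq 'M[R]_12) (q : clifford R 12) :
  unit_prod false q -> (forall M, (M \in H) <-> image F M) ->
  (forall a, S a -> exists (y : clifford R 12) (hy : in_spin y) M,
    [/\ a = scls y hy, M \in H & lifts (q * y * q^-1) M]) ->
  (forall M, M \in gens -> exists (y : clifford R 12) (hy : in_spin y),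
    S (scls y hy) /\ lifts (q * y * q^-1) M) ->
  generates (H := H) gens -> generated S (scls (-1) (m1_spin R)) ->
  conjugate_subsets F (generated S).
Proof.
move=> qu HP fw bw gen Sm1; have SG := generated_subgroup S.
have qU := unit_prod_unit qu.
pose g0 : spin R 12 := mkspin (unit_prod_spin qu); exists (cls g0)^-1%g.
have conjE x : (cls x ^ (cls g0)^-1 = cls (g0 * x * g0^-1))%g.
  by rewrite !clsM clsV conjgE invgK mulgA.
apply/seteqP; split=> a.
  move=> Fa; have [N NO aN] := unit_prod_lifts (spin_unit_prod_val (repr a : spin R 12)).
  have HN : N \in H by apply/HP; exists (repr a) => //; rewrite cls_repr.
  pose T M := exists2 w, generated S (cls w) & lifts (q * val w * q^-1) M.
  have [w Sw wN] : T N.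
    apply: (gen T) HN.
    - move=> M M' [w Sw wM] [w' Sw' wM']; exists (w * w')%g.
        by rewrite clsM; exact: (is_subgroupM SG).
      have := liftsM wM wM'; congr lifts.
      by rewrite !mulrA mulrVK.
    - exists c_spin; first by rewrite cls_c; exact: SG.1.
      have -> : q * val (c_spin (R := R)) * q^-1 = c_elt :> clifford R 12.
        by rewrite /= (unit_prod_c qu) expr0 mul1r mulrK.
      exact: lifts_c.
    - move=> M /bw[y [hy [Sy yM]]]; exists (mkspin hy) => //.
      by move=> K [_ SK]; exact: SK.
  have [E|E] := lift_sign (spin_unit_prod_val (repr a)) (spin_unit_prod_val (g0 * w * g0^-1)%g)
    (lifts_orthogonal aN) aN wN.
    by exists (cls w) => //; rewrite conjE -(val_inj E) cls_repr.
  exists (scls (-1) (m1_spin R) * cls w)%g; first exact: (is_subgroupM SG).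
  rewrite -clsM conjE -[RHS]cls_repr; congr cls; apply: val_inj; rewrite E /=.
  by rewrite mulN1r mulrN mulNr.
case=> b Sb <-; pose F' := [set b : G | F (b ^ (cls g0)^-1)%g]%classic.
suff : F' b by [].
apply: Sb; split.
  split=> [|c d]; first by rewrite /F' /= conj1g; exact: Fgroup.1.
  by rewrite /F' /= conjMg conjVg; exact: Fgroup.2.
move=> c /fw[y [hy [M [-> HM yM]]]]; rewrite /F' /= /scls conjE.
have /HP[x Fx xM] := HM.
exact: (subgroup_lift Fgroup Fm1 Fx xM).
Qed.

(** Conjugation by an odd element replaces c by -c, hence a frame in which the
    lifts of two anticommuting matrices of the image have commutator c has a definite
    orientation. *)
Lemma orientation b (q y y' : clifford R 12) M N : is_abelian F -> unit_prod b q ->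
  unit_prod false y -> unit_prod false y' -> y * y' = c_elt * y' * y ->
  image F M -> image F N -> M *m N = - (N *m M) ->
  lifts (q * y * q^-1) M -> lifts (q * y' * q^-1) N -> b = false.
Proof.
move=> Fab qu yu y'u yy' [x Fx xM] [z Fz zN] MN qyM qyN.
have qU := unit_prod_unit qu.
have conj_u t : unit_prod false t -> unit_prod false (q * t * q^-1).
  move=> tu; have := unit_prodM (unit_prodM qu tu) (unit_prodV qu).
  by rewrite addbF addbb.
have MO := lifts_orthogonal xM; have NO := lifts_orthogonal zN.
have [L1 L2] := lifts_comm xM zN.
have xz : val x * val z = c_elt * (val z * val x).
  case: (F_comm Fab Fx Fz) => // /L1 E; case: (orthogonal_anticommute MO NO E MN).
have aa' : (q * y * q^-1) * (q * y' * q^-1) = c_elt * ((q * y' * q^-1) * (q * y * q^-1)).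
  have [->|->] := lift_sign (conj_u _ yu) (spin_unit_prod_val x) MO qyM xM;
  have [->|->] := lift_sign (conj_u _ y'u) (spin_unit_prod_val z) NO qyN zN;
  by rewrite ?mulNr ?mulrN ?mulNr ?mulrN xz.
have conjM (t t' : clifford R 12) : (q * t * q^-1) * (q * t' * q^-1) = q * (t * t') * q^-1.
  by rewrite !mulrA mulrVK.
have y'y : y' * y \is a GRing.unit := unit_prod_unit (unit_prodM y'u yu).
move: aa'; rewrite !conjM yy' -(mulrA c_elt) (mulrA q c_elt) (unit_prod_c qu).
case: b {qu conj_u} => //; rewrite expr1 mulN1r !mulNr -!mulrA => /esym E.
case: (unit_neqN _ E); rewrite !mulrA unitrMl ?unitrV // -(mulrA _ y') unitrMr // unitrMl //.
exact: (unit_prod_unit (@unit_prod_c_elt R)).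
Qed.

End Conjugation.

(** * The classification *)

Section OrientedFrame.
Context {R : realType}.
Implicit Types (Q M : 'M[R]_12).

Lemma plane_monomial_flip Q M A s0 s1 : plane_monomial Q M xpred0 s0 s1 ->
  plane_monomial (Q *m diagN A) M xpred0 s0 s1.
Proof.
move=> MQ p; have [Ml Mh] := MQ p; rewrite /=.
have E i : col i (Q *m diagN A) = (-1) ^+ (i \in A) *: col i Q.
  by rewrite colE -mulmxA diagN_delta -scalemxAr -colE.
by rewrite !E -!scalemxAr Ml Mh /= !scalerA; split; congr (_ *: _); exact: mulrC.
Qed.

(** The orientation of a frame is corrected by the sign of one of its vectors. *)
Lemma oriented_frame Q : orthogonal Q -> exists q A,
  [/\ unit_prod false q, lifts q (Q *m diagN A) & orthogonal (Q *m diagN A)].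
Proof.
move=> QO; have [b [q [qu qQ]]] := pin_lift QO.
pose A : {set 'I_12} := if b then [set hi plane5]%SET else finset.set0.
have qAu := unit_prodM qu (diag_lift_unit_prod (R := R) A).
have bA : b (+) odd #|A| = false.
  by rewrite /A; case: (b); rewrite ?cards1 ?cards0.
rewrite bA in qAu; exists (q * diag_lift A), A.
have qA : lifts (q * diag_lift A) (Q *m diagN A) by exact/liftsM/lifts_diagN.
split=> //; have [N NO qN] := unit_prod_lifts qAu.
by rewrite (lifts_inj (unit_prod_unit qAu) qA qN).
Qed.

End OrientedFrame.

Section Models.
Context {R : realType}.
Context (F : set (HSpin12 R)) (Fgroup : is_subgroup F) (Fabelian : is_abelian F)
  (Fm1 : F (scls (-1) (m1_spin R))) (H : seq 'M[R]_12) (HG : good_group H)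
  (HP : forall M, (M \in H) <-> image F M).

Lemma generated_sub (S : set (HSpin12 R)) a : S a -> generated S a.
Proof. by move=> Sa K [_]; apply. Qed.

Lemma type1_conjugate X Y : X \in H -> Y \in H -> X *m Y = - (Y *m X) ->
  type1 (H := H) X Y -> conjugate_subsets F (F1 R).
Proof.
move=> HX HY XY [Q [m [QO Hm wm [wX wY] gen]]].
have [b [q [qu qQ]]] := pin_lift QO.
have qU := unit_prod_unit qu.
have lm : lifts (q * a1 R * q^-1) m.
  by apply: (lifts_conj qU QO qQ _ (acts_a1 (R := R))).
have lX := lifts_conj qU QO qQ wX (acts_a2 (R := R)).
have lY := lifts_conj qU QO qQ wY (acts_a3 (R := R)).
have b0 : b = false.
  apply: (orientation Fabelian qu (spin_unit_prod (a2_spin R)) (spin_unit_prod (a3_spin R))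
    (a2_a3 (R := R)) _ _ XY lX lY); exact/HP.
rewrite b0 in qu; apply: (conjugate_generated Fgroup Fm1 qu HP _ _ gen).
- move=> _ [[->|->]|->]; [exists (a1 R), (a1_spin R), m|exists (a2 R), (a2_spin R), X|
    exists (a3 R), (a3_spin R), Y]; by [].
- move=> M; rewrite !inE => /or3P[]/eqP ->; [exists (a1 R), (a1_spin R)|
    exists (a2 R), (a2_spin R)|exists (a3 R), (a3_spin R)]; split=> //=; tauto.
- have -> : scls (-1) (m1_spin R) = (scls (a1 R) (a1_spin R) * scls (a1 R) (a1_spin R))%g.
    by rewrite /scls -clsM; congr cls; apply: val_inj; rewrite /= a1_sqr.
  by apply: (is_subgroupM (generated_subgroup _)); apply: generated_sub; left; left.
Qed.

Let central_lift (q : clifford R 12) : unit_prod false q -> lifts (q * (-1) * q^-1) 1%:M.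
Proof.
move=> /unit_prod_unit qU; rewrite mulrN1 mulNr mulrV //; apply: liftsN; exact: lifts1.
Qed.

Let F2_fw (q : clifford R 12) m1 m2 m3 m4 m5 a : unit_prod false q ->
  [/\ m1 \in H, m2 \in H, m3 \in H, m4 \in H & m5 \in H] ->
  [/\ lifts (q * b1 R * q^-1) m1, lifts (q * b2 R * q^-1) m2, lifts (q * b3 R * q^-1) m3,
      lifts (q * b4 R * q^-1) m4 & lifts (q * b5 R * q^-1) m5] ->
  @F2_gens R a -> exists (y : clifford R 12) (hy : in_spin y) M,
    [/\ a = scls y hy, M \in H & lifts (q * y * q^-1) M].
Proof.
move=> qu [H1 H2 H3 H4 H5] [l1 l2 l3 l4 l5] [[[[[->|->]|->]|->]|->]|->].
- exists (-1), (m1_spin R), 1%:M; split=> //; [exact: (good1 HG)|exact: central_lift].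
- by exists (b1 R), (b1_spin R), m1.
- by exists (b2 R), (b2_spin R), m2.
- by exists (b3 R), (b3_spin R), m3.
- by exists (b4 R), (b4_spin R), m4.
- by exists (b5 R), (b5_spin R), m5.
Qed.

Let F2_bw (q : clifford R 12) m1 m2 m3 m4 m5 M :
  [/\ lifts (q * b1 R * q^-1) m1, lifts (q * b2 R * q^-1) m2, lifts (q * b3 R * q^-1) m3,
      lifts (q * b4 R * q^-1) m4 & lifts (q * b5 R * q^-1) m5] ->
  M \in [:: m1; m2; m3; m4; m5] -> exists (y : clifford R 12) (hy : in_spin y),
    @F2_gens R (scls y hy) /\ lifts (q * y * q^-1) M.
Proof.
move=> [l1 l2 l3 l4 l5]; rewrite !inE => /or4P[|||/orP[]] /eqP ->.
- exists (b1 R), (b1_spin R); split=> //; do 4 left; by right.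
- exists (b2 R), (b2_spin R); split=> //; do 3 left; by right.
- exists (b3 R), (b3_spin R); split=> //; do 2 left; by right.
- exists (b4 R), (b4_spin R); split=> //; left; by right.
- by exists (b5 R), (b5_spin R); split=> //; right.
Qed.

Let F2_m1 : @F2_gens R (scls (-1) (m1_spin R)).
Proof. by do 5 left. Qed.

Lemma type2_conjugate : type2 (H := H) -> conjugate_subsets F (F2 R).
Proof.
case=> Q [m1 [m2 [m3 [m4 [m5 [QO Hm [w1 w2 w3 w4] w5 gen]]]]]].
have [q [A [qu qQ QAO]]] := oriented_frame QO; have qU := unit_prod_unit qu.
have l : [/\ lifts (q * b1 R * q^-1) m1, lifts (q * b2 R * q^-1) m2,
    lifts (q * b3 R * q^-1) m3, lifts (q * b4 R * q^-1) m4 & lifts (q * b5 R * q^-1) m5].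
  split; [apply: (lifts_conj qU QAO qQ _ (acts_b1 (R := R)))
    | apply: (lifts_conj qU QAO qQ _ (acts_b2 (R := R)))
    | apply: (lifts_conj qU QAO qQ _ (acts_b3 (R := R)))
    | apply: (lifts_conj qU QAO qQ _ (acts_b4 (R := R)))
    | apply: (lifts_conj qU QAO qQ _ (acts_b5 (R := R)))]; exact: plane_monomial_flip.
apply: (conjugate_generated Fgroup Fm1 qu HP _ _ gen).
- by move=> a; exact: (F2_fw qu Hm l).
- by move=> M; exact: (F2_bw l).
- by apply: generated_sub; exact: F2_m1.
Qed.

Lemma type3_conjugate X Y : X \in H -> Y \in H -> X *m Y = - (Y *m X) ->
  type3 (H := H) X Y -> conjugate_subsets F (F3 R).
Proof.
move=> HX HY XY [Q [m1 [m2 [m3 [m4 [QO [H1 H2 H3 H4] [w1 w2 w3 w4] [wX wY] gen]]]]]].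
have [b [q [qu qQ]]] := pin_lift QO.
have qU := unit_prod_unit qu.
have lX := lifts_conj qU QO qQ wX (acts_delta (R := R)).
have lY := lifts_conj qU QO qQ wY (acts_b5 (R := R)).
have b0 : b = false.
  apply: (orientation Fabelian qu (spin_unit_prod (delta_spin R)) (spin_unit_prod (b5_spin R))
    (delta_b5 (R := R)) _ _ XY lX lY); exact/HP.
rewrite b0 in qu.
have l : [/\ lifts (q * b1 R * q^-1) m1, lifts (q * b2 R * q^-1) m2,
    lifts (q * b3 R * q^-1) m3, lifts (q * b4 R * q^-1) m4 & lifts (q * b5 R * q^-1) Y].
  split=> //; [apply: (lifts_conj qU QO qQ _ (acts_b1 (R := R)))
    | apply: (lifts_conj qU QO qQ _ (acts_b2 (R := R)))
    | apply: (lifts_conj qU QO qQ _ (acts_b3 (R := R)))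
    | apply: (lifts_conj qU QO qQ _ (acts_b4 (R := R)))]; by [].
apply: (conjugate_generated Fgroup Fm1 qu HP _ _ gen).
- move=> a [/(F2_fw qu _ l)|->]; first exact.
  by exists (delta R), (delta_spin R), X.
- move=> M; rewrite -[[:: m1; m2; m3; m4; Y; X]]/([:: m1; m2; m3; m4; Y] ++ [:: X]) mem_cat.
  case/orP => [/(F2_bw l)[y [hy [Sy yM]]]|].
    by exists y, hy; split=> //; left.
  by rewrite inE => /eqP ->; exists (delta R), (delta_spin R); split=> //; right.
- by apply: generated_sub; left.
Qed.

End Models.

Local Open Scope classical_set_scope.

Theorem proposition2p5 (R : realType) (F : set (HSpin12 R))
    (Fgroup : is_subgroup F) (Ffinite : finite_set F) (Fabelian : is_abelian F)
    (Fstar : condition_star F) (Fm1 : F (scls (-1) (m1_spin R))) :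
  conjugate_subsets F (F1 R) \/ conjugate_subsets F (F2 R) \/
  conjugate_subsets F (F3 R).
Proof.
have [H uH HP] := image_list Ffinite.
have HG := image_good Fgroup Fabelian Fstar uH HP.
have [[X [Y [HX HY XY]]]|none] :=
    pselect (exists X Y, [/\ X \in H, Y \in H & X *m Y = - (Y *m X)]).
  have [X' [Y' [HX' HY' XY' [t1|t3]]]] := nonabelian_types HG HX HY XY.
    by left; exact: (type1_conjugate Fgroup Fabelian Fm1 HP HX' HY' XY' t1).
  by right; right; exact: (type3_conjugate Fgroup Fabelian Fm1 HG HP HX' HY' XY' t3).
right; left; apply: (type2_conjugate Fgroup Fm1 HG HP); apply: (abelian_type2 HG).
move=> X Y HX HY; have [//|XY] := good_comm HG HX HY.
by case: none; exists X, Y.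
Qed.
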